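(* Let $n,N\ge 1$ be integers, let $\Omega\subset\mathbb{R}^n$ be a domain, let $s\in(0,1)$ and $p_s=\frac{n}{s}$. Let $u:\Omega\to\mathbb{R}^N$ be measurable with $|u(x)|=1$ for a.e. $x\in\Omega$ and $E_{s,p_s}(u)<\infty$, and assume that for every $\psi\in C_0^\infty(\Omega,\mathbb{R}^N)$ \[ 0=\frac{d}{dt}\Big|_{t=0}E_{s,p_s}\left(\frac{u+t\psi}{|u+t\psi|}\right). \] Then for every $\varphi\in C_0^\infty(\Omega)$ and every constant matrix $(\omega_{ij})_{i,j=1}^N$ with $\omega_{ij}=-\omega_{ji}\in\{-1,0,1\}$, \[ \sum_{i,j=1}^N\omega_{ij}\int_\Omega\int_\Omega\frac{|u(x)-u(y)|^{p_s-2}\,(u^i(x)-u^i(y))\,(u^j(x)\varphi(x)-u^j(y)\varphi(y))}{|x-y|^{n+sp_s}}\,dx\,dy=0 . \]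
   Context: The energy of a measurable map $v:\Omega\to\mathbb{R}^N$ is \[ E_{s,p_s}(v):=\int_\Omega\int_\Omega\frac{|v(x)-v(y)|^{p_s}}{|x-y|^{n+sp_s}}\,dx\,dy . \] $u=(u^1,\dots,u^N)$. The expression $|u(x)-u(y)|^{p_s-2}(u^i(x)-u^i(y))$ is read as $0$ when $u(x)=u(y)$. *)

(* Defs.v *)
From HB Require Import structures.
From mathcomp Require Import all_boot all_order all_algebra.
From mathcomp Require Import all_classical all_reals all_analysis.

Set Implicit Arguments.
Unset Strict Implicit.
Unset Printing Implicit Defensive.

Import Order.TTheory GRing.Theory Num.Theory.
Import numFieldNormedType.Exports.

Local Open Scope classical_set_scope.
Local Open Scope ring_scope.

Lemma product_measure_sigma_finite d1 d2 (T1 : measurableType d1)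
    (T2 : measurableType d2) (R : realType)
    (m1 : {sigma_finite_measure set T1 -> \bar R})
    (m2 : {sigma_finite_measure set T2 -> \bar R}) :
  sigma_finite setT (m1 \x m2)%E.
Proof.
have /sigma_finiteP[F [TF ndF Foo]] := sigma_finiteT m1.
have /sigma_finiteP[G [TG ndG Goo]] := sigma_finiteT m2.
exists (fun n => F n `*` G n).
  rewrite -setXTT TF TG predeqE => -[x y]; split.
    move=> [/= [n _ Fnx] [k _ Gky]]; exists (maxn n k) => //; split.
    - by move: x Fnx; exact/subsetPset/ndF/leq_maxl.
    - by move: y Gky; exact/subsetPset/ndG/leq_maxr.
  by move=> [n _ []/= ? ?]; split; exists n.
move=> k; have [? ?] := Foo k; have [? ?] := Goo k.
split; first exact: measurableX.
by rewrite product_measure1E// lte_mul_pinfty// ge0_fin_numE.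
Qed.

Lemma ex_sigma_finite_measure d (T : measurableType d) (R : realType)
    (mu : set T -> \bar R) :
  mu set0 = 0%E -> (forall A, (0 <= mu A)%E) -> semi_sigma_additive mu ->
  sigma_finite setT mu ->
  exists m : {sigma_finite_measure set T -> \bar R}, mu = m.
Proof.
move=> mu0 mu_ge0 mu_sigma_additive mu_sigma_finite.
pose hm := isMeasure.Build _ _ _ mu mu0 mu_ge0 mu_sigma_additive.
pose M : {measure set T -> \bar R} := HB.pack mu hm.
pose hs := Measure_isSigmaFinite.Build _ _ _ M mu_sigma_finite.
pose S : {sigma_finite_measure set T -> \bar R} := HB.pack mu hm hs.
by exists S.
Qed.

Section lebesgue_tuple.
Context {R : realType}.
Local Open Scope ereal_scope.

(* R^n is first built as n.-tuple R, on which the library has the product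
   (Borel) sigma-algebra, with the iterated product of lebesgue_measure. *)
Definition cons_pair n (z : measurableTypeR R * n.-tuple (measurableTypeR R)) :
  n.+1.-tuple (measurableTypeR R) := [tuple of z.1 :: z.2].

Fixpoint lebesgue_tuple n : set (n.-tuple (measurableTypeR R)) -> \bar R :=
  match n with
  | 0 => \d_ [tuple]
  | m.+1 => pushforward (lebesgue_measure \x @lebesgue_tuple m) (@cons_pair m)
  end.

Lemma measurable_cons_pair n : measurable_fun [set: _] (@cons_pair n).
Proof. exact: measurable_cons. Qed.

Lemma cons_pair_inj n : injective (@cons_pair n).
Proof.
by move=> [x s] [y t] /(congr1 val)[-> st]; congr pair; exact: val_inj.
Qed.

Lemma measurable_cons_pair_image n A :
  measurable A -> measurable (@cons_pair n @` A).
Proof.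
move=> mA.
pose g (t : n.+1.-tuple (measurableTypeR R)) := (thead t, [tuple of behead t]).
have mg : measurable_fun [set: _] g.
  apply/measurable_fun_pair; last exact: measurable_behead.
  exact: measurable_tnth.
rewrite (_ : _ @` A = g @^-1` A).
  by rewrite -[X in measurable X]setTI; exact: mg.
apply/seteqP; split => [_ [[x s] Axs <-]|t At] /=.
  by rewrite /g /= (_ : [tuple of _] = s)//; exact: val_inj.
by exists (g t) => //; rewrite /cons_pair /= -tuple_eta.
Qed.

Lemma lebesgue_tupleP n :
  exists m : {sigma_finite_measure set (n.-tuple (measurableTypeR R)) -> \bar R},
    @lebesgue_tuple n = m.
Proof.
elim: n => [|n [m mE]].
  by exists (@dirac _ (0.-tuple (measurableTypeR R)) [tuple] R).
pose p := pushforward (lebesgue_measure \x m) (@cons_pair n).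
have mp := @measurable_cons_pair n.
have p0 : p set0 = 0 by rewrite /p /pushforward preimage_set0 measure0.
have p_ge0 A : 0 <= p A by exact: measure_ge0.
have p_sigma_additive : semi_sigma_additive p.
  move=> F mF tF mUF; rewrite /p /pushforward preimage_bigcup.
  apply: measure_semi_sigma_additive.
  - by move=> k; rewrite -[X in measurable X]setTI; exact: mp.
  - apply/trivIsetP => /= i j _ _ ij; rewrite -preimage_setI.
    by move/trivIsetP : tF => /(_ _ _ _ _ ij) ->//; rewrite preimage_set0.
  - by rewrite -preimage_bigcup -[X in measurable X]setTI; exact: mp.
have p_sigma_finite : sigma_finite setT p.
  have [F FT mF] := product_measure_sigma_finite lebesgue_measure m.
  exists (fun k => @cons_pair n @` F k).
    rewrite -image_bigcup -FT; apply/esym/seteqP; split => // t _.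
    exists (thead t, [tuple of behead t]) => //.
    by rewrite /cons_pair /= -tuple_eta.
  move=> k; have [mFk Fkoo] := mF k; split.
    exact: measurable_cons_pair_image.
  rewrite /p /pushforward (_ : _ @^-1` _ = F k)//.
  apply/seteqP; split => z /=; last by exists z.
  by case=> z' Fz' /cons_pair_inj <-.
have [M pE] := ex_sigma_finite_measure p0 p_ge0 p_sigma_additive p_sigma_finite.
by exists M; rewrite -pE /= mE.
Qed.

Let lebesgue_tuple0 n : @lebesgue_tuple n set0 = 0.
Proof. by have [m ->] := lebesgue_tupleP n. Qed.

Let lebesgue_tuple_ge0 n A : 0 <= @lebesgue_tuple n A.
Proof. by have [m ->] := lebesgue_tupleP n. Qed.

Let lebesgue_tuple_sigma_additive n : semi_sigma_additive (@lebesgue_tuple n).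
Proof.
by have [m ->] := lebesgue_tupleP n; exact: measure_semi_sigma_additive.
Qed.

HB.instance Definition _ n := isMeasure.Build _ _ _ (@lebesgue_tuple n)
  (@lebesgue_tuple0 n) (@lebesgue_tuple_ge0 n) (@lebesgue_tuple_sigma_additive n).

Let lebesgue_tuple_sigma_finite n : sigma_finite setT (@lebesgue_tuple n).
Proof. by have [m ->] := lebesgue_tupleP n; exact: sigma_finiteT. Qed.

HB.instance Definition _ n := Measure_isSigmaFinite.Build _ _ _
  (@lebesgue_tuple n) (@lebesgue_tuple_sigma_finite n).

End lebesgue_tuple.

Definition rV_of_tuple {R : realType} {n} (t : n.-tuple (measurableTypeR R)) :
  'rV[R]_n := \row_i tnth t i.

Definition lebesgue_rV_display : measure_display.
Proof. exact. Qed.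

(* 'rV[R]_n, which carries the topology, is then given the Lebesgue
   (completed, i.e. Caratheodory) sigma-algebra, not the Borel one. Real-valued
   coordinate functions on it are thus measurable in the sense of Lebesgue. *)
Section lebesgue_rV_measurable.
Context {R : realType} (n : nat).

Definition lebesgue_rV_measurable : set (set 'rV[R]_n) :=
  [set A | ((@lebesgue_tuple R n)^*)%mu.-cara.-measurable (rV_of_tuple @^-1` A)].

Let measurable0 : lebesgue_rV_measurable set0.
Proof. by rewrite /lebesgue_rV_measurable /= preimage_set0. Qed.

Let measurableC A : lebesgue_rV_measurable A -> lebesgue_rV_measurable (~` A).
Proof.
by rewrite /lebesgue_rV_measurable /= preimage_setC; exact: measurableC.
Qed.

Let measurable_bigcup (F : (set 'rV[R]_n)^nat) :
  (forall k, lebesgue_rV_measurable (F k)) ->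
  lebesgue_rV_measurable (\bigcup_k F k).
Proof.
by move=> mF; rewrite /lebesgue_rV_measurable /= preimage_bigcup;
  exact: bigcupT_measurable.
Qed.

HB.instance Definition _ := @isMeasurable.Build lebesgue_rV_display 'rV[R]_n
  lebesgue_rV_measurable measurable0 measurableC measurable_bigcup.

End lebesgue_rV_measurable.

Section lebesgue_rV.
Context {R : realType} {n : nat}.
Local Open Scope ereal_scope.

Definition lebesgue_rV (A : set 'rV[R]_n) : \bar R :=
  @completed_measure_extension _ _ _ (@lebesgue_tuple R n) (rV_of_tuple @^-1` A).

Let lebesgue_rV0 : lebesgue_rV set0 = 0.
Proof. by rewrite /lebesgue_rV preimage_set0 measure0. Qed.

Let lebesgue_rV_ge0 A : 0 <= lebesgue_rV A.
Proof. exact: outer_measure_ge0. Qed.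

Let lebesgue_rV_sigma_additive : semi_sigma_additive lebesgue_rV.
Proof.
move=> F mF tF mUF; rewrite /lebesgue_rV preimage_bigcup.
apply: measure_semi_sigma_additive => //.
- apply/trivIsetP => /= i j _ _ ij; rewrite -preimage_setI.
  by move/trivIsetP : tF => /(_ _ _ _ _ ij) ->//; rewrite preimage_set0.
Qed.

HB.instance Definition _ := isMeasure.Build _ _ _ lebesgue_rV
  lebesgue_rV0 lebesgue_rV_ge0 lebesgue_rV_sigma_additive.

Let lebesgue_rV_sigma_finite : sigma_finite setT lebesgue_rV.
Proof.
have [F FT mF] := @completed_measure_extension_sigma_finite _ _ _ _
  (sigma_finiteT (@lebesgue_tuple R n)).
pose tuple_of_rV (v : 'rV[R]_n) : n.-tuple (measurableTypeR R) :=
  [tuple v ord0 i | i < n].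
have FK k : rV_of_tuple @^-1` (tuple_of_rV @^-1` F k) = F k.
  rewrite -comp_preimage (_ : _ \o _ = id)//.
  by apply/funext => t; apply: eq_from_tnth => i; rewrite tnth_mktuple mxE.
exists (fun k => tuple_of_rV @^-1` F k).
  by rewrite -preimage_bigcup -FT preimage_setT.
move=> k; have [mFk Fkoo] := mF k; split.
  by rewrite /measurable /= /lebesgue_rV_measurable /= FK.
by rewrite /lebesgue_rV FK.
Qed.

HB.instance Definition _ := Measure_isSigmaFinite.Build _ _ _ lebesgue_rV
  lebesgue_rV_sigma_finite.

End lebesgue_rV.

(* Normalisation check: boxes get the product of their side lengths. *)
Section lebesgue_box.
Context {R : realType}.
Local Open Scope ereal_scope.

Lemma measurable_tuple_box n (A : 'I_n -> set (measurableTypeR R)) :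
  (forall i, measurable (A i)) ->
  measurable [set t : n.-tuple (measurableTypeR R) | forall i, A i (tnth t i)].
Proof.
move=> mA.
rewrite (_ : [set _ | _] =
    \big[setI/setT]_(i < n) ((@tnth n _)^~ i @^-1` A i)).
  apply: bigsetI_measurable => i _; rewrite -[X in measurable X]setTI.
  exact: measurable_tnth.
rewrite -bigcap_seq; apply/seteqP; split => t /= At i; first by move=> _; exact: At.
by apply: At => /=; rewrite mem_index_enum.
Qed.

Lemma lebesgue_tuple_box n (A : 'I_n -> set (measurableTypeR R)) :
  (forall i, measurable (A i)) ->
  lebesgue_tuple [set t | forall i, A i (tnth t i)] =
  \big[*%E/1]_(i < n) lebesgue_measure (A i).
Proof.
elim: n => [|n ih] in A * => mA.
  rewrite big_ord0 /= diracE mem_set//.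
  by case.
rewrite big_ord_recl -ih// -product_measure1E//; last first.
  exact: (@measurable_tuple_box n (fun i => A (lift ord0 i))).
congr product_measure1; apply/seteqP; split => [[x t] /= Axt|[x t] [/= Ax At] i].
  split; first by have := Axt ord0; rewrite tnth0.
  by move=> i /=; have := Axt (lift ord0 i); rewrite tnthS.
have [->|] := eqVneq i ord0; first by rewrite tnth0.
by rewrite eq_sym => /unlift_some[j -> _]; rewrite tnthS; exact: At.
Qed.

Lemma lebesgue_rV_box n (A : 'I_n -> set (measurableTypeR R)) :
  (forall i, measurable (A i)) ->
  lebesgue_rV [set v : 'rV[R]_n | forall i, A i (v 0%R i)] =
  \big[*%E/1]_(i < n) lebesgue_measure (A i).
Proof.
move=> mA; rewrite -lebesgue_tuple_box// -[RHS]measurable_mu_extE; last first.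
  exact: measurable_tuple_box.
rewrite /lebesgue_rV /completed_measure_extension; congr mu_ext.
by apply/seteqP; split => t /= At i; have := At i; rewrite mxE.
Qed.
End lebesgue_box.

(* The norm `|x| of 'rV[R]_n is the sup norm; the Euclidean one is needed. *)
Definition enorm {R : realType} n (x : 'rV[R]_n) : R :=
  Num.sqrt (\sum_(i < n) x 0 i ^+ 2).

Section test_functions.
Context {R : realType} {n : nat} {V : normedModType R}.
Implicit Types (f : 'rV[R]_n -> V) (Omega : set 'rV[R]_n).

Fixpoint classC k f : Prop :=
  continuous f /\
  if k is k'.+1 then
    forall i : 'I_n, let e := delta_mx 0 i in
      (forall x, derivable f x e) /\ classC k' (fun x => 'D_e f x)
  else True.

Definition smooth f := forall k, classC k f.

Definition closed_support f : set 'rV[R]_n := closure [set x | f x != 0].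

(* Elements of C_0^oo(Omega, V), identified with their extensions by zero. *)
Definition test_function Omega f :=
  [/\ smooth f, compact (closed_support f) & closed_support f `<=` Omega].

End test_functions.

Definition is_domain {R : realType} n (Omega : set 'rV[R]_n) :=
  [/\ open Omega, connected Omega & Omega !=set0].

(* Maps on Omega are total functions of which only the values on Omega matter.
   On the diagonal, which is negligible, the integrand is 0 as 0^-1 = 0. *)
Definition energy {R : realType} {n N : nat} (Omega : set 'rV[R]_n) (s p : R)
    (v : 'rV[R]_n -> 'rV[R]_N) : \bar R :=
  \int[lebesgue_rV]_(y in Omega) \int[lebesgue_rV]_(x in Omega)
    (enorm (v x - v y) `^ p / enorm (x - y) `^ (n%:R + s * p))%:E.

Definition normalize {R : realType} {N : nat} (w : 'rV[R]_N) : 'rV[R]_N :=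
  (enorm w)^-1 *: w.

(* Main.v *)
(* Put V_i = e_i - u^i u, the tangential projection of the basis vector e_i along
   the sphere. Differentiating the energy along t |-> (u + t g e_i) / |u + t g e_i|
   for a scalar test function g gives the Euler-Lagrange equation
     I(d(g V_i)) = 0, where df = f(x) - f(y) and I(W) is the double integral of
     |du|^(p-2) du . W / |x - y|^(n+sp) over Omega x Omega;
   the derivative is computed by dominated convergence along t_k -> 0.
   One then wants g = phi u^j. This g is bounded, supported in the support of phi,
   and has finite energy, so its mollifications g_k are test functions which are
   uniformly bounded, have no larger energy (Jensen), and may be taken to converge
   almost everywhere. As d((g_k - g) V_i) is bounded in the weighted L^p space and
   tends to 0 almost everywhere, while |du|^(p-1) lies in the dual space, the
   equation passes to the limit. Now
     d(phi u^j V_i) = d(phi u^j) e_i - d(phi u^i u^j u),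
   and the last term is symmetric in i and j: hence so is the double integral in the
   conclusion, and it cancels against the antisymmetric omega.
   Test functions have finite energy because min(1, |h|)^p |h|^(-2n) is integrable
   (here sp = n and p > n). *)
From HB Require Import structures.
From mathcomp Require Import all_boot all_order all_algebra.
From mathcomp Require Import all_classical all_reals all_analysis.
From mathcomp Require Import measurable_realfun ring lra.
Require Import Defs.

Set Implicit Arguments.
Unset Strict Implicit.
Unset Printing Implicit Defensive.

Import Order.TTheory GRing.Theory Num.Theory.
Import numFieldNormedType.Exports.

Local Open Scope classical_set_scope.
Local Open Scope ring_scope.

(** * Powers and the Euclidean norm *)

(** The map [u] is only Lebesgue measurable, whereas convolution and Tonelli on pairs need maps such
    as [(x, h) |-> f (x + h)] to be jointly measurable. So [u] is replaced by a Borel map [u0],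
    equal to it on Omega off a null set and of norm 1 everywhere; the analysis takes place on the
    Borel space and its square, and the iterated Lebesgue integrals are converted one variable at a
    time. When n = 1 the exponent [p] may be below 2, so second derivatives of the p-th power are
    avoided: its tangent inequality gives the limit of the difference quotients, their domination,
    and Jensen. The restriction to Omega and the singular kernel are merged into one weight on pairs
    of points, so the first variation and the limit passage are proved on an arbitrary measure
    space. The limit passage is elementary: the pairing with |du|^(p-1) is split according to
    whether the error exceeds |du| / delta, which replaces weak compactness. The exponent
    [a = n + sp] equals 2n; the estimates see it only through n < a < n + p. *)

Section powR_inequalities.
Context {R : realType}.
Implicit Types a b t p : R.

(** Young's inequality for [t] and [a ^ (p - 1)] with conjugate exponents [p] and [p / (p - 1)],
    multiplied by [p]. No derivative is taken, so [a = 0] is covered. *)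
Lemma powR_tangent a t p : 0 <= a -> 0 <= t -> 1 < p ->
  a `^ p + p * a `^ (p - 1) * (t - a) <= t `^ p.
Proof.
move=> a0 t0 p1; have p0 : 0 < p by exact: lt_trans p1.
have q0 : 0 < p / (p - 1) by rewrite divr_gt0// subr_gt0.
have p1N0 : p - 1 != 0 by rewrite subr_eq0 gt_eqF.
have pN0 : p != 0 by rewrite gt_eqF.
have := @conjugate_powR R t (a `^ (p - 1)) p (p / (p - 1)) t0 (powR_ge0 _ _) p0 q0.
rewrite -powRrM (_ : (p - 1) * (p / (p - 1)) = p); last by field; rewrite p1N0.
move=> /(_ _)/wrap[]; first by field; rewrite p1N0.
rewrite -(ler_pM2l p0) => H.
have -> : a `^ p + p * a `^ (p - 1) * (t - a) =
  a `^ p - p * a `^ p + p * (t * a `^ (p - 1)).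
  by rewrite -(mulr_powRB1 a0 p0); ring.
apply: le_trans (lerD (lexx _) H) _.
rewrite le_eqVlt; apply/orP; left; apply/eqP; field.
by rewrite p1N0 pN0.
Qed.

(** A mean value estimate, read off from the tangent at the larger of the two points. It dominates
    the difference quotients of the energy. *)
Lemma powRB_le a b p : 0 <= a -> 0 <= b -> 1 < p ->
  `|a `^ p - b `^ p| <= p * (a + b) `^ (p - 1) * `|a - b|.
Proof.
move=> a0 b0 p1.
wlog ab : a b a0 b0 / b <= a.
  move=> H; have [ba|ab] := leP b a; first exact: H.
  by rewrite distrC (distrC a) (addrC a b); apply: H => //; exact: ltW.
have p0 : 0 < p by exact: lt_trans p1.
rewrite !ger0_norm ?subr_ge0//; last by apply: ge0_ler_powR; rewrite ?nnegrE// ltW.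
have := powR_tangent a0 b0 p1.
rewrite -lerBrDl => H.
have : a `^ p - b `^ p <= p * a `^ (p - 1) * (a - b) by lra.
move=> /le_trans; apply; apply: ler_wpM2r; first by rewrite subr_ge0.
apply: ler_wpM2l; first exact: ltW.
have p10 : 0 <= p - 1 by rewrite subr_ge0 ltW.
by apply: ge0_ler_powR => //; rewrite ?lerDl// nnegrE addr_ge0.
Qed.

Lemma powRD_le a b p : 0 <= a -> 0 <= b -> 0 <= p ->
  (a + b) `^ p <= 2 `^ p * (a `^ p + b `^ p).
Proof.
move=> a0 b0 p0.
wlog ab : a b a0 b0 / b <= a.
  move=> H; have [ba|ab] := leP b a; first exact: H.
  by rewrite addrC (addrC (a `^ p)); apply: H => //; exact: ltW.
apply: (@le_trans _ _ ((2 * a) `^ p)).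
  apply: ge0_ler_powR; rewrite ?nnegrE ?addr_ge0 ?mulr_ge0//.
  by rewrite mulr_natl mulr2n lerD2l.
rewrite powRM//; apply: ler_wpM2l; first exact: powR_ge0.
by rewrite lerDl powR_ge0.
Qed.

(** Comparing [a] with [b] suffices: the larger one bounds both factors. This stands in for Hölder's
    inequality when pairing a p-1 power with an L^p function. *)
Lemma young_powRB1 a b p : 0 <= a -> 0 <= b -> 1 < p ->
  a `^ (p - 1) * b <= a `^ p + b `^ p.
Proof.
move=> a0 b0 p1; have p0 : 0 < p by exact: lt_trans p1.
have p10 : 0 <= p - 1 by rewrite subr_ge0 ltW.
have [ab|ba] := leP a b.
  rewrite -(mulr_powRB1 b0 p0) mulrC ler_wpDl ?powR_ge0//.
  by apply: ler_wpM2l => //; apply: ge0_ler_powR.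
rewrite -(mulr_powRB1 a0 p0) mulrC ler_wpDr ?powR_ge0//.
by apply: ler_wpM2r; [exact: powR_ge0|exact: ltW].
Qed.

Lemma cvg_powR (u_ : R^nat) a p : 0 < a -> u_ @ \oo --> a ->
  (u_ k `^ p) @[k --> \oo] --> a `^ p.
Proof.
move=> a0 ua; apply: (@continuous_cvg _ _ _ _ _ _ (fun x => x `^ p)) => //.
apply: differentiable_continuous; apply/derivable1_diffP.
by apply: derivable_powR; rewrite in_itv/= andbT.
Qed.

Lemma cvg_powR0 (u_ : R^nat) p : 0 < p -> (forall k, 0 <= u_ k) ->
  u_ @ \oo --> 0 -> (u_ k `^ p) @[k --> \oo] --> 0.
Proof.
move=> p0 u0 ua; apply/cvgrPdist_lt => e e0.
have e1 : 0 < e `^ (p^-1) by rewrite powR_gt0.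
move/cvgrPdist_lt : ua => /(_ _ e1).
apply: filterS => k; rewrite !sub0r !normrN !ger0_norm ?powR_ge0// => H.
have -> : e = (e `^ p^-1) `^ p.
  by rewrite -powRrM mulVf ?gt_eqF// powRr1// ltW.
by apply: gt0_ltr_powR; rewrite // nnegrE ?powR_ge0.
Qed.
End powR_inequalities.

Lemma cvg_sumr (R : realType) (I : Type) (r : seq I) (f : I -> R^nat) (l : I -> R) :
  (forall i, f i k @[k --> \oo] --> l i) ->
  \sum_(i <- r) f i k @[k --> \oo] --> \sum_(i <- r) l i.
Proof.
move=> H; elim: r => [|i r ih].
  by under eq_fun do rewrite big_nil; rewrite big_nil; exact: cvg_cst.
by under eq_fun do rewrite big_cons; rewrite big_cons; exact: cvgD.
Qed.

Section enorm.
Context {R : realType} {N : nat}.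
Implicit Types u v w : 'rV[R]_N.

Definition dotp u v : R := \sum_(i < N) u 0 i * v 0 i.

Lemma dotpC u v : dotp u v = dotp v u.
Proof. by apply: eq_bigr => i _; rewrite mulrC. Qed.

Lemma dotpDr u v w : dotp u (v + w) = dotp u v + dotp u w.
Proof. by rewrite -big_split; apply: eq_bigr => i _; rewrite mxE mulrDr. Qed.

Lemma dotpZr a u v : dotp u (a *: v) = a * dotp u v.
Proof. by rewrite mulr_sumr; apply: eq_bigr => i _; rewrite mxE mulrCA. Qed.

Lemma dotpDl u v w : dotp (v + w) u = dotp v u + dotp w u.
Proof. by rewrite !(dotpC _ u) dotpDr. Qed.

Lemma dotpZl a u v : dotp (a *: v) u = a * dotp v u.
Proof. by rewrite !(dotpC _ u) dotpZr. Qed.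

Lemma dotpBr u v w : dotp u (v - w) = dotp u v - dotp u w.
Proof. by rewrite dotpDr -scaleN1r dotpZr mulN1r. Qed.

Lemma dotpBl u v w : dotp (v - w) u = dotp v u - dotp w u.
Proof. by rewrite !(dotpC _ u) dotpBr. Qed.

Lemma enorm_ge0 u : 0 <= enorm u. Proof. exact: sqrtr_ge0. Qed.

Lemma enorm_sqr u : enorm u ^+ 2 = dotp u u.
Proof.
rewrite sqr_sqrtr; last by apply: sumr_ge0 => i _; exact: sqr_ge0.
by apply: eq_bigr => i _; rewrite expr2.
Qed.

Lemma enorm_eq0 u : enorm u = 0 -> u = 0.
Proof.
move=> u0; have : dotp u u = 0 by rewrite -enorm_sqr u0 expr0n.
move/eqP; rewrite psumr_eq0; last by move=> i _; rewrite -expr2 sqr_ge0.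
move=> /allP H; apply/rowP => i; rewrite mxE.
by have := H i (mem_index_enum _); rewrite mulf_eq0 orbb => /eqP.
Qed.

Lemma dotp_le u v : dotp u v <= enorm u * enorm v.
Proof.
have [u0|uN0] := eqVneq (enorm u) 0.
  by rewrite u0 mul0r (enorm_eq0 u0) -(scale0r (0 : 'rV[R]_N)) dotpZl mul0r.
have [v0|vN0] := eqVneq (enorm v) 0.
  by rewrite v0 mulr0 (enorm_eq0 v0) -(scale0r (0 : 'rV[R]_N)) dotpZr mul0r.
have uv0 : 0 < enorm u * enorm v.
  by rewrite mulr_gt0// lt_neqAle eq_sym ?uN0 ?vN0 enorm_ge0.
have : 0 <= enorm (enorm v *: u - enorm u *: v) ^+ 2 by rewrite sqr_ge0.
rewrite enorm_sqr !(dotpBl, dotpBr, dotpZl, dotpZr) -!enorm_sqr (dotpC v u) => H.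
rewrite -subr_ge0 -(pmulr_rge0 _ uv0); lra.
Qed.

Lemma enormD u v : enorm (u + v) <= enorm u + enorm v.
Proof.
rewrite -(@ler_pXn2r _ 2)// ?nnegrE ?addr_ge0 ?enorm_ge0//.
rewrite enorm_sqr dotpDl !dotpDr sqrrD !enorm_sqr (dotpC v u).
have := dotp_le u v; lra.
Qed.

Lemma enormZ a u : enorm (a *: u) = `|a| * enorm u.
Proof.
apply/eqP; rewrite -(@eqrXn2 _ 2)// ?mulr_ge0 ?enorm_ge0//.
by rewrite enorm_sqr dotpZl dotpZr exprMn real_normK ?num_real// enorm_sqr mulrA expr2.
Qed.

Lemma enormN u : enorm (- u) = enorm u.
Proof. by rewrite -scaleN1r enormZ normrN1 mul1r. Qed.

Lemma enormB u v : enorm (u - v) = enorm (v - u).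
Proof. by rewrite -opprB enormN. Qed.

Lemma enorm0 : enorm (0 : 'rV[R]_N) = 0.
Proof. by rewrite -(scale0r (0 : 'rV[R]_N)) enormZ normr0 mul0r. Qed.

Lemma enormB_le u v : enorm (u - v) <= enorm u + enorm v.
Proof. by rewrite -(enormN v) enormD. Qed.

Lemma enorm_dist u v : `|enorm u - enorm v| <= enorm (u - v).
Proof.
rewrite ler_norml; have := enormD (u - v) v; have := enormD (v - u) u.
rewrite !subrK (enormB v u); lra.
Qed.

Lemma normr_dotp_le u v : `|dotp u v| <= enorm u * enorm v.
Proof.
rewrite ler_norml dotp_le andbT lerNl -(enormN u).
have := dotp_le (- u) v; rewrite -scaleN1r dotpZl mulN1r; exact.
Qed.

Lemma le_coord_enorm u i : `|u 0 i| <= enorm u.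
Proof.
rewrite -sqrtr_sqr ler_wsqrtr// (bigD1 i)//= lerDl.
by apply: sumr_ge0 => j _; exact: sqr_ge0.
Qed.

Lemma enorm_le_sum u : enorm u <= \sum_(i < N) `|u 0 i|.
Proof.
rewrite -(@ler_pXn2r _ 2)// ?nnegrE ?enorm_ge0 ?sumr_ge0// enorm_sqr.
rewrite expr2 mulr_suml; apply: ler_sum => i _.
rewrite -[X in X <= _]ger0_norm; last by rewrite -expr2 sqr_ge0.
rewrite normrM ler_wpM2l// (bigD1 i)//= lerDl.
by apply: sumr_ge0.
Qed.

Lemma enorm_delta (i : 'I_N) : enorm (delta_mx 0 i : 'rV[R]_N) = 1.
Proof.
rewrite /enorm (bigD1 i)//= big1 ?addr0 ?mxE ?eqxx ?expr1n ?sqrtr1// => j ji.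
by rewrite mxE eqxx (negbTE ji) expr0n.
Qed.

Lemma cvg_enorm (w_ : nat -> 'rV[R]_N) w :
  (forall i, (w_ k 0 i) @[k --> \oo] --> w 0 i) ->
  enorm (w_ k) @[k --> \oo] --> enorm w.
Proof.
move=> H; apply: (@continuous_cvg _ _ _ _ _ _ Num.sqrt); first exact: sqrt_continuous.
apply: cvg_sumr => i; under eq_fun do rewrite expr2; rewrite expr2.
by apply: cvgM; exact: H.
Qed.

Lemma cvg_dotp (v_ w_ : nat -> 'rV[R]_N) v w :
  (forall i, (v_ k 0 i) @[k --> \oo] --> v 0 i) ->
  (forall i, (w_ k 0 i) @[k --> \oo] --> w 0 i) ->
  dotp (v_ k) (w_ k) @[k --> \oo] --> dotp v w.
Proof. by move=> Hv Hw; apply: cvg_sumr => i; exact: cvgM. Qed.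

End enorm.

Section power_of_norm.
Context {R : realType} {N : nat}.
Variables (p : R) (p1 : 1 < p).
Implicit Types a b v : 'rV[R]_N.

Definition grad a : 'rV[R]_N := enorm a `^ (p - 2) *: a.

Lemma enorm_grad a : enorm (grad a) = enorm a `^ (p - 1).
Proof.
rewrite enormZ ger0_norm ?powR_ge0//.
have [->|a0] := eqVneq (enorm a) 0; first by rewrite mulr0 powR0// subr_eq0 gt_eqF.
rewrite -[X in _ * X]powRr1 ?enorm_ge0// -powRD ?a0 ?implybT//.
by congr (_ `^ _); ring.
Qed.

Lemma dotp_grad_self a : dotp (grad a) a = enorm a `^ p.
Proof.
rewrite dotpZl -enorm_sqr -powR_mulrn ?enorm_ge0//.
have [->|a0] := eqVneq (enorm a) 0.
  by rewrite [in X in _ * X]powR0 ?mulr0 ?powR0// gt_eqF// (lt_trans _ p1).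
by rewrite -powRD ?a0 ?implybT// subrK.
Qed.

(** The scalar tangent inequality at [enorm a], followed by Cauchy-Schwarz for [dotp (grad a) b]. *)
Lemma grad_convex a b : p * dotp (grad a) (b - a) <= enorm b `^ p - enorm a `^ p.
Proof.
have := powR_tangent (enorm_ge0 a) (enorm_ge0 b) p1.
rewrite -lerBrDl; apply: le_trans.
rewrite -mulrA; apply: ler_wpM2l; first by rewrite ltW// (lt_trans _ p1).
rewrite dotpBr dotp_grad_self mulrBr.
rewrite [X in _ <= _ - X]mulrC mulr_powRB1 ?enorm_ge0 ?(lt_trans _ p1)//.
by rewrite lerD2r -enorm_grad dotp_le.
Qed.

Lemma cvg_grad (w_ : nat -> 'rV[R]_N) (w : 'rV[R]_N) :
  (forall i, (w_ k 0 i) @[k --> \oo] --> w 0 i) ->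
  forall i, (grad (w_ k) 0 i) @[k --> \oo] --> grad w 0 i.
Proof.
move=> Hw i.
have Hn := cvg_enorm Hw.
(* At a zero limit the factor [|w|^(p-2)] may blow up or jump, so the norm [|w|^(p-1)] of the whole
   product is used instead; it tends to 0 because [p > 1]. *)
have [w0|wN0] := eqVneq (enorm w) 0.
  have -> : grad w 0 i = 0 by rewrite mxE (enorm_eq0 w0) mxE mulr0.
  apply/norm_cvg0P.
  apply: (@squeeze_cvgr _ _ _ _ (cst 0) (fun k => enorm (w_ k) `^ (p - 1))).
  - by apply: nearW => k; rewrite /= normr_ge0 -enorm_grad le_coord_enorm.
  - exact: cvg_cst.
  - by apply: cvg_powR0 => [|k|]; rewrite ?subr_gt0 ?enorm_ge0// -w0.
under eq_fun do rewrite mxE; rewrite mxE.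
apply: cvgM; last exact: Hw.
by apply: cvg_powR => //; rewrite lt_neqAle eq_sym wN0 enorm_ge0.
Qed.

(* The subgradient inequality at both endpoints sandwiches the difference
   quotient, so that no differentiability of [enorm] at 0 is needed. *)
Lemma cvg_diff_quotient (t_ : R^nat) (v_ : nat -> 'rV[R]_N) a (v : 'rV[R]_N) :
  (forall k, 0 < t_ k) -> t_ @ \oo --> 0 ->
  (forall i, (v_ k 0 i) @[k --> \oo] --> v 0 i) ->
  ((enorm (a + t_ k *: v_ k) `^ p - enorm a `^ p) / t_ k) @[k --> \oo]
    --> p * dotp (grad a) v.
Proof.
move=> t0 tc vc.
have wc i : ((a + t_ k *: v_ k) 0 i) @[k --> \oo] --> a 0 i.
  suff : (a 0 i + t_ k * v_ k 0 i) @[k --> \oo] --> a 0 i + 0 * v 0 i.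
    by rewrite mul0r addr0; under [in X in _ -> X]eq_fun do rewrite 2!mxE.
  by apply: cvgD; [exact: cvg_cst|exact: cvgM].
apply: (@squeeze_cvgr _ _ _ _ (fun k => p * dotp (grad a) (v_ k))
  (fun k => p * dotp (grad (a + t_ k *: v_ k)) (v_ k))).
- apply: nearW => k; rewrite ler_pdivlMr// ler_pdivrMr//.
  have := grad_convex a (a + t_ k *: v_ k).
  have := grad_convex (a + t_ k *: v_ k) a.
  rewrite opprD addNKr -scaleNr [a + _]addrC addrK !dotpZr; lra.
- by apply: cvgM; [exact: cvg_cst|apply: cvg_dotp => // i; exact: cvg_cst].
- by apply: cvgM; [exact: cvg_cst|apply: cvg_dotp => //; exact: cvg_grad].
Qed.

End power_of_norm.

(** * The Borel space R^n *)

Definition borel_rV_display : measure_display.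
Proof. exact. Qed.

(* R^n with its Borel sigma-algebra: the maps (x, h) |-> f (x + h) needed for
   convolutions are jointly measurable for Borel f, not for Lebesgue f. *)
Definition borel_rV (R : realType) (n : nat) : Type := 'rV[R]_n.

Section borel_rV.
Context {R : realType} {n : nat}.
Local Notation B := (borel_rV R n).
Local Notation T := (n.-tuple (measurableTypeR R)).

HB.instance Definition _ := NormedModule.copy B 'rV[R]_n.

Definition borel_of_tuple (t : T) : B := rV_of_tuple t.
Definition tuple_of_borel (x : B) : T := [tuple x ord0 i | i < n].

Lemma borel_of_tupleK : cancel borel_of_tuple tuple_of_borel.
Proof. by move=> t; apply: eq_from_tnth => i; rewrite tnth_mktuple mxE. Qed.

Lemma tuple_of_borelK : cancel tuple_of_borel borel_of_tuple.
Proof. by move=> x; apply/rowP => i; rewrite mxE tnth_mktuple. Qed.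

Definition borel_rV_measurable : set (set B) :=
  [set A | measurable (borel_of_tuple @^-1` A)].

Let measurable0 : borel_rV_measurable set0.
Proof. by rewrite /borel_rV_measurable /= preimage_set0. Qed.

Let measurableC A : borel_rV_measurable A -> borel_rV_measurable (~` A).
Proof.
by rewrite /borel_rV_measurable /= preimage_setC; exact: measurableC.
Qed.

Let measurable_bigcup (F : (set B)^nat) :
  (forall k, borel_rV_measurable (F k)) -> borel_rV_measurable (\bigcup_k F k).
Proof.
by move=> mF; rewrite /borel_rV_measurable /= preimage_bigcup;
  exact: bigcupT_measurable.
Qed.

HB.instance Definition _ := @isMeasurable.Build borel_rV_display B
  borel_rV_measurable measurable0 measurableC measurable_bigcup.

Lemma measurable_borel_of_tuple : measurable_fun [set: T] borel_of_tuple.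
Proof. by move=> _ A mA; rewrite setTI. Qed.

Lemma measurable_coord i : measurable_fun [set: B] (fun x : B => x ord0 i : R).
Proof.
move=> _ A mA; rewrite setTI.
rewrite /measurable /= /borel_rV_measurable /= -comp_preimage.
rewrite -[X in measurable X]setTI (_ : _ \o _ = (@tnth n _ ^~ i)).
  exact: measurable_tnth.
by apply/funext => t /=; rewrite /borel_of_tuple /= mxE.
Qed.

Lemma measurable_tuple_of_borel : measurable_fun [set: B] tuple_of_borel.
Proof.
apply/measurable_fun_tnthP => i; rewrite (_ : _ \o _ = (fun x : B => x ord0 i)).
  exact: measurable_coord.
by apply/funext => x /=; rewrite tnth_mktuple.
Qed.

Lemma measurable_borelP d (X : measurableType d) (f : X -> B) :
  (forall i, measurable_fun [set: X] (fun x => f x ord0 i : R)) ->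
  measurable_fun [set: X] f.
Proof.
move=> mf; rewrite (_ : f = borel_of_tuple \o (tuple_of_borel \o f)).
  apply: measurableT_comp; first exact: measurable_borel_of_tuple.
  apply/measurable_fun_tnthP => i; rewrite (_ : _ \o _ = fun x => f x ord0 i).
    exact: mf.
  by apply/funext => x /=; rewrite tnth_mktuple.
by apply/funext => x /=; rewrite tuple_of_borelK.
Qed.

Lemma measurable_borelD d (X : measurableType d) (f g : X -> B) :
  measurable_fun [set: X] f -> measurable_fun [set: X] g ->
  measurable_fun [set: X] (fun x => f x + g x : B).
Proof.
move=> mf mg; apply: measurable_borelP => i; under eq_fun do rewrite mxE.
by apply: measurable_funD; apply: measurableT_comp (measurable_coord i) _.
Qed.

Lemma measurable_borelB d (X : measurableType d) (f g : X -> B) :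
  measurable_fun [set: X] f -> measurable_fun [set: X] g ->
  measurable_fun [set: X] (fun x => f x - g x : B).
Proof.
move=> mf mg; apply: measurable_borelP => i; under eq_fun do rewrite 2!mxE.
by apply: measurable_funB; apply: measurableT_comp (measurable_coord i) _.
Qed.

Local Open Scope ereal_scope.

Definition borel_measure (A : set B) : \bar R := lebesgue_tuple (borel_of_tuple @^-1` A).

Let borel_measure0 : borel_measure set0 = 0.
Proof. by rewrite /borel_measure preimage_set0 measure0. Qed.

Let borel_measure_ge0 A : 0 <= borel_measure A.
Proof. exact: measure_ge0. Qed.

Let borel_measure_sigma_additive : semi_sigma_additive borel_measure.
Proof.
move=> F mF tF mUF; rewrite /borel_measure preimage_bigcup.
apply: measure_semi_sigma_additive => //.
apply/trivIsetP => /= i j _ _ ij; rewrite -preimage_setI.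
by move/trivIsetP : tF => /(_ _ _ _ _ ij) ->//; rewrite preimage_set0.
Qed.

HB.instance Definition _ := isMeasure.Build _ _ _ borel_measure
  borel_measure0 borel_measure_ge0 borel_measure_sigma_additive.

Let borel_measure_sigma_finite : sigma_finite setT borel_measure.
Proof.
have [F FT mF] := sigma_finiteT (@lebesgue_tuple R n).
have FK k : borel_of_tuple @^-1` (tuple_of_borel @^-1` F k) = F k.
  by rewrite -comp_preimage (_ : _ \o _ = id)//; apply/funext; exact: borel_of_tupleK.
exists (fun k => tuple_of_borel @^-1` F k).
  by rewrite -preimage_bigcup -FT preimage_setT.
move=> k; have [mFk Fkoo] := mF k; split.
  by rewrite /measurable /= /borel_rV_measurable /= FK.
by rewrite /borel_measure FK.
Qed.

HB.instance Definition _ := Measure_isSigmaFinite.Build _ _ _ borel_measure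
  borel_measure_sigma_finite.

Lemma borel_measure_box (A : 'I_n -> set (measurableTypeR R)) :
  (forall i, measurable (A i)) ->
  borel_measure [set v : B | forall i, A i (v ord0 i)] =
  \big[*%E/1]_(i < n) lebesgue_measure (A i).
Proof.
move=> mA; rewrite -lebesgue_tuple_box//; congr lebesgue_tuple.
by apply/seteqP; split => t /= At i; have := At i; rewrite mxE.
Qed.

Lemma measurable_borel_box (A : 'I_n -> set (measurableTypeR R)) :
  (forall i, measurable (A i)) -> measurable [set v : B | forall i, A i (v ord0 i)].
Proof.
move=> mA; rewrite /measurable /= /borel_rV_measurable /=.
rewrite (_ : _ @^-1` _ = [set t : T | forall i, A i (tnth t i)]); last first.
  by apply/seteqP; split => t /= At i; have := At i; rewrite mxE.
exact: measurable_tuple_box.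
Qed.

Lemma measurable_rV_borel : measurable_fun [set: 'rV[R]_n] (fun x => x : B).
Proof.
move=> _ A mA; rewrite setTI /measurable /= /lebesgue_rV_measurable /=.
by apply: sub_caratheodory; exact: sub_sigma_algebra.
Qed.

Lemma lebesgue_rV_borel (A : set B) : measurable A ->
  lebesgue_rV (A : set 'rV[R]_n) = borel_measure A.
Proof.
by move=> mA; rewrite /lebesgue_rV /completed_measure_extension measurable_mu_extE.
Qed.

Lemma ge0_integral_lebesgue_rV (f : B -> \bar R) :
  measurable_fun [set: B] f -> (forall x, 0 <= f x) ->
  \int[lebesgue_rV]_x f x = \int[borel_measure]_x f x.
Proof.
move=> mf f0.
rewrite -(@ge0_integral_pushforward _ _ _ _ _ _ measurable_rV_borel lebesgue_rV setT f)//.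
apply: eq_measure_integral; first exact: measurable_rV_borel.
by move=> mid A mA _; exact: lebesgue_rV_borel.
Qed.
End borel_rV.

Lemma ex_pushforward d d' (T1 : measurableType d) (T2 : measurableType d')
    (R : realType) (m : {measure set T1 -> \bar R}) (f : T1 -> T2) :
  measurable_fun [set: T1] f ->
  exists m' : {measure set T2 -> \bar R}, forall A, m' A = m (f @^-1` A).
Proof.
by move=> mf; exists (measure_function_pushforward__canonical__measure_function_Measure m mf).
Qed.

Section topology.
Context {R : realType} {n : nat}.
Local Notation B := (borel_rV R n).

(** The sigma-algebra is pulled back from tuples, not generated by the topology. An open set is the
    countable union of the rational boxes it contains, enumerated by [unpickle]. *)
Lemma open_borel_measurable (U : set B) : open U -> measurable U.
Proof.
move=> oU.
pose A (qr : n.-tuple rat * rat) i : set (measurableTypeR R) :=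
  `]ratr (tnth qr.1 i) - ratr qr.2, ratr (tnth qr.1 i) + ratr qr.2[%classic.
pose box qr := [set x : B | forall i, A qr i (x ord0 i)].
pose F k := if unpickle k is Some qr then
  if `[< box qr `<=` U >] then box qr else set0 else set0.
have -> : U = \bigcup_k F k.
  apply/seteqP; split => [x Ux|x [k _]]; last first.
    rewrite /F; case: (unpickle k) => [qr|//].
    by case: asboolP => // + bx; exact.
  have /nbhs_ballP[e /= e0 xeU] : nbhs x U by exact: open_nbhs_nbhs.
  have e20 : 0 < e / 2 by rewrite divr_gt0.
  (* The rational centre is within [r] of [x] and the box has half side [r], so points of the box
     are within [2r < e] of [x]. *)
  have [r] := @rat_in_itvoo R 0 (e / 2) e20.
  rewrite in_itv/= => /andP[r0 re].
  have /choice[q qP] : forall i : 'I_n, exists q : rat,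
      ratr q \in `](x ord0 i : R) - ratr r, x ord0 i + ratr r[.
    by move=> i; apply: rat_in_itvoo; rewrite ltrD2l gtrN.
  pose qr := ([tuple q i | i < n], r).
  exists (pickle qr) => //; rewrite /F pickleK.
  have -> : `[< box qr `<=` U >].
    apply/asboolP => y by_; apply: xeU; split => // i j.
    rewrite (ord1 i) /ball/=.
    have := by_ j; have := qP j; rewrite /A /= !in_itv/= tnth_mktuple.
    move=> /andP[H1 H2] /andP[H3 H4].
    rewrite ltr_norml; apply/andP; split; lra.
  move=> i; rewrite /A /=; have := qP i; rewrite !in_itv/= tnth_mktuple => /andP[H1 H2].
  by apply/andP; split; lra.
apply: bigcupT_measurable => k; rewrite /F; case: unpickle => [qr|//].
case: ifP => // _; apply: (@measurable_borel_box R n (A qr)) => i.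
exact: measurable_itv.
Qed.

Lemma continuous_borel_measurable (f : B -> R) : continuous f -> measurable_fun [set: B] f.
Proof.
move=> /continuousP cf; apply: (measurability _ (RGenOpens.measurableE R)).
move=> _ [_ [a [b ->] <-]]; rewrite setTI; apply: open_borel_measurable.
exact/cf/interval_open.
Qed.

End topology.

(** * Translation invariance of Lebesgue measure on R^n *)

Section translation.
Context {R : realType}.
Local Open Scope ereal_scope.

Lemma lebesgue_measure_shift (a : R) (A : set (measurableTypeR R)) : measurable A ->
  lebesgue_measure ((fun x : measurableTypeR R => (x + a)%R : measurableTypeR R) @^-1` A) = lebesgue_measure A.
Proof.
have ma : measurable_fun [set: measurableTypeR R]
    (fun x : measurableTypeR R => (x + a)%R : measurableTypeR R).
  by apply: measurable_funD => //; exact: measurable_cst.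
have [m mE] := ex_pushforward lebesgue_measure ma.
move=> mA; rewrite -mE; apply/esym; apply: lebesgue_measure_unique => // X [[b c] _ <-].
rewrite mE (_ : _ @^-1` _ = `](b - a)%R, (c - a)%R]%classic).
  rewrite [LHS]lebesgue_measure_itv [RHS]lebesgue_measure_itv/= !lte_fin.
  rewrite ltrD2r.
  by case: ifP => // _; rewrite -!EFinB; congr EFin; ring.
by apply/seteqP; split => x /=; rewrite !in_itv/= ltrBlDr lerBrDr.
Qed.

Definition shift_tuple n (h t : n.-tuple (measurableTypeR R)) :
  n.-tuple (measurableTypeR R) := [tuple (tnth t i + tnth h i)%R | i < n].

Lemma measurable_shift_tuple n (h : n.-tuple (measurableTypeR R)) :
  measurable_fun [set: _] (shift_tuple h).
Proof.
apply/measurable_fun_tnthP => i.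
rewrite (_ : _ \o _ = fun t => (tnth t i + tnth h i)%R).
  by apply: measurable_funD; [exact: measurable_tnth|exact: measurable_cst].
by apply/funext => t /=; rewrite tnth_mktuple.
Qed.

(** Under [cons_pair] a shift splits into a shift of the head and one of the tail. The shifted
    measure then agrees with the product measure on rectangles, by the one-dimensional case and
    induction, and uniqueness of the product measure concludes. *)
Lemma lebesgue_tuple_shift n (h : n.-tuple (measurableTypeR R)) A : measurable A ->
  lebesgue_tuple (shift_tuple h @^-1` A) = lebesgue_tuple A.
Proof.
elim: n => [|n ih] in h A *.
  move=> mA; congr lebesgue_tuple; apply/seteqP; split => t /=.
    by rewrite [shift_tuple _ _]tuple0 [t]tuple0.
  by rewrite [shift_tuple _ _]tuple0 [t]tuple0.
move=> mA.
pose h' : n.-tuple (measurableTypeR R) := [tuple of behead h].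
pose s (z : measurableTypeR R * n.-tuple (measurableTypeR R)) :
  measurableTypeR R * n.-tuple (measurableTypeR R) :=
  ((z.1 + thead h)%R, shift_tuple h' z.2).
have ms : measurable_fun [set: _] s.
  apply/measurable_fun_pair.
    by apply: measurable_funD => //; exact: measurable_cst.
  by apply: measurableT_comp; [exact: measurable_shift_tuple|].
have [m mE] := ex_pushforward (lebesgue_measure \x @lebesgue_tuple R n) ms.
rewrite /= /pushforward -comp_preimage.
have -> : shift_tuple h \o @cons_pair R n = @cons_pair R n \o s.
  apply/funext => -[x t] /=; apply: eq_from_tnth => i.
  rewrite tnth_mktuple; have [->|] := eqVneq i ord0.
    by rewrite !tnth0.
  rewrite eq_sym => /unlift_some[j -> _]; rewrite !tnthS tnth_mktuple.
  by rewrite tnth_behead; congr (_ + tnth _ _)%R; apply/val_inj; rewrite /= inordK// ltnS.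
rewrite comp_preimage -mE; apply/esym; apply: product_measure_unique.
  move=> X Y mX mY; rewrite mE.
  rewrite (_ : s @^-1` (X `*` Y) =
    ((fun x : measurableTypeR R => (x + thead h)%R : measurableTypeR R) @^-1` X) `*`
    (shift_tuple h' @^-1` Y)); last by apply/seteqP; split => -[].
  rewrite [X in _ = X * _](esym (lebesgue_measure_shift (thead h) mX)).
  rewrite [X in _ = _ * X](esym (ih h' _ mY)).
  apply: product_measure1E.
    by rewrite -[X in measurable X]setTI; apply: measurable_funD => //; exact: measurable_cst.
  by rewrite -[X in measurable X]setTI; apply: measurable_shift_tuple.
by rewrite -[X in measurable X]setTI; exact: measurable_cons_pair.
Qed.

Context {n : nat}.
Local Notation B := (borel_rV R n).

Lemma measurable_shift (h : B) : measurable_fun [set: B] (fun x : B => (x + h)%R : B).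
Proof. by apply: measurable_borelD => //; exact: measurable_cst. Qed.

Lemma borel_measure_shift (h : B) (A : set B) : measurable A ->
  borel_measure ((fun x : B => (x + h)%R) @^-1` A) = borel_measure A.
Proof.
move=> mA; rewrite /borel_measure -[RHS](lebesgue_tuple_shift (tuple_of_borel h))//.
congr lebesgue_tuple; apply/funext => t /=; congr (A _).
by apply/rowP => i; rewrite !mxE !tnth_mktuple.
Qed.

Lemma ge0_integral_shift (h : B) (f : B -> \bar R) : measurable_fun [set: B] f ->
  (forall x, 0 <= f x) ->
  \int[borel_measure]_x f (x + h)%R = \int[borel_measure]_x f x.
Proof.
move=> mf f0.
rewrite -(@ge0_integral_pushforward _ _ _ _ _ _ (measurable_shift h) borel_measure setT f)//.
apply: eq_measure_integral; first exact: measurable_shift.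
by move=> mid A mA _; exact: borel_measure_shift.
Qed.

Lemma integral_shift (h : B) (f : B -> \bar R) :
  measurable_fun [set: B] f ->
  \int[borel_measure]_x f (x + h)%R = \int[borel_measure]_x f x.
Proof.
move=> mf; rewrite integralE [RHS]integralE; congr (_ - _).
  rewrite -[RHS](ge0_integral_shift h (measurable_funepos mf))//.
  by apply: eq_integral => x _; rewrite !funeposE.
rewrite -[RHS](ge0_integral_shift h (measurable_funeneg mf))//.
by apply: eq_integral => x _; rewrite !funenegE.
Qed.

End translation.

(** * Integrability of the kernel *)

Lemma powR_exprn (R : realType) (x a : R) k : 0 <= x -> (x ^+ k) `^ a = (x `^ a) ^+ k.
Proof.
move=> x0; elim: k => [|k ih]; first by rewrite !expr0 powR1.
by rewrite !exprS powRM ?exprn_ge0// ih.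
Qed.

Lemma gt1_ltr_powR (R : realType) (x y : R) : x < y -> 2 `^ x < 2 `^ y :> R.
Proof.
move=> xy; rewrite /powR (negbTE (_ : 2 != 0 :> R))// ltr_expR.
by rewrite ltr_pM2r// ln_gt0// ltr1n.
Qed.

Lemma nneseries_geometric_le (R : realType) (M z : R) : 0 <= M -> 0 <= z -> z < 1 ->
  (\sum_(k <oo) (M * z ^+ k)%:E <= (M / (1 - z))%:E)%E.
Proof.
move=> M0 z0 z1; apply: lime_le.
  by apply: is_cvg_nneseries => k _ _; rewrite lee_fin mulr_ge0// exprn_ge0.
apply: nearW => N; rewrite sumEFin lee_fin ler_pdivlMr ?subr_gt0//.
rewrite -mulr_sumr -mulrA big_mkord.
have -> : (\sum_(i < N) z ^+ i) * (1 - z) = 1 - z ^+ N.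
  by rewrite -opprB mulrN mulrC -subrX1 opprB.
by rewrite -[leRHS]mulr1 ler_wpM2l// gerBl exprn_ge0.
Qed.

Section kernel.
Context {R : realType} {n : nat}.
Local Notation B := (borel_rV R n).

(** Cubes stand in for Euclidean balls because their measure follows from that of boxes; by
    [enorm_cube] they contain the balls of radius [r]. *)
Definition cube (r : R) : set B := [set x : B | forall i, `]-r, r[%classic (x ord0 i)].

Lemma measurable_cube r : measurable (cube r).
Proof. by apply: (@measurable_borel_box R n (fun=> `]-r, r[%classic)) => i; exact: measurable_itv. Qed.

Lemma borel_measure_cube r : 0 <= r -> borel_measure (cube r) = ((2 * r) ^+ n)%:E.
Proof.
move=> r0; have := @borel_measure_box R n (fun=> `]-r, r[%classic).
rewrite -/(cube r) => ->; last by move=> i; exact: measurable_itv.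
rewrite (eq_bigr (fun=> (2 * r)%:E)).
  by rewrite -(big_morph EFin (@EFinM R) erefl) prodr_const card_ord.
move=> i _; rewrite lebesgue_measure_itv/= lte_fin.
case: ltrP => [_|]; first by rewrite -EFinB; congr EFin; ring.
by move=> H; congr EFin; lra.
Qed.

Lemma enorm_cube (x : B) r : enorm x < r -> cube r x.
Proof.
move=> xr i /=; rewrite in_itv/= -ltr_norml.
by apply: le_lt_trans xr; exact: le_coord_enorm.
Qed.

Lemma measurable_enorm d (X : measurableType d) (f : X -> B) :
  measurable_fun [set: X] f -> measurable_fun [set: X] (fun x => enorm (f x)).
Proof.
move=> mf; rewrite (_ : (fun _ => _) =
    (fun x => (\sum_(i < n) f x ord0 i ^+ 2) `^ 2^-1)).
  apply: (@measurableT_comp _ _ _ _ _ _ (fun a => a `^ 2^-1)); first exact: measurable_powR.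
  apply: measurable_sum => i; apply: measurable_funX.
  exact: measurableT_comp (measurable_coord i) _.
by apply/funext => x; rewrite powR12_sqrt//; apply: sumr_ge0 => i _; exact: sqr_ge0.
Qed.

Lemma measurable_invr d (X : measurableType d) (f : X -> R) :
  (forall x, 0 <= f x) ->
  measurable_fun [set: X] f -> measurable_fun [set: X] (fun x => (f x)^-1).
Proof.
move=> f0 mf; rewrite (_ : (fun _ => _) = (fun x => f x `^ (-1))).
  by apply: (@measurableT_comp _ _ _ _ _ _ (fun a => a `^ (-1))); first exact: measurable_powR.
by apply/funext => x; rewrite powR_inv1.
Qed.

Local Open Scope ereal_scope.

(** On [D], [f] is at most the sum of the [c k] times the indicators of [C k], whose integrals form
    a geometric series. This replaces polar coordinates; the sets [C k] may overlap. *)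
Lemma integral_shells (D : set B) (f : B -> R) (C : nat -> set B) (c : R^nat) (M z : R) :
  measurable D -> measurable_fun [set: B] f ->
  (forall k, measurable (C k)) -> (forall k, 0 <= c k)%R ->
  (forall x, 0 <= f x)%R ->
  (forall x, D x -> exists2 k, C k x & f x <= c k)%R ->
  (forall k, (c k)%:E * borel_measure (C k) <= (M * z ^+ k)%:E) ->
  (0 <= M)%R -> (0 <= z)%R -> (z < 1)%R ->
  \int[borel_measure]_(x in D) (f x)%:E <= (M / (1 - z))%:E.
Proof.
move=> mD mf mC c0 f0 fC cM M0 z0 z1.
have mg k : measurable_fun D (fun x => (c k * \1_(C k) x)%:E).
  by apply/measurable_EFinP; apply: measurable_funM; [exact: measurable_cst|
    exact: measurable_indic].
have g0 k x : 0 <= (c k * \1_(C k) x)%:E by rewrite lee_fin mulr_ge0.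
apply: (@le_trans _ _ (\int[borel_measure]_(x in D)
    \sum_(k <oo) (c k * \1_(C k) x)%:E)).
  apply: ge0_le_integral => //.
  - by move=> x _; rewrite lee_fin.
  - by apply/measurable_EFinP; exact: measurable_funTS.
  - by apply: ge0_emeasurable_sum.
  - move=> x Dx; have [k Ckx fk] := fC x Dx.
    apply: (le_trans _ (nneseries_lim_ge k.+1 _)) => //.
    rewrite big_nat_recr//= indicE mem_set// mulr1.
    by rewrite -[X in X <= _]add0e; apply: leeD; [exact: sume_ge0|rewrite lee_fin].
rewrite integral_nneseries//.
apply: le_trans (nneseries_geometric_le M0 z0 z1).
apply: lee_nneseries => [k _ _|k _]; first exact: integral_ge0.
apply: le_trans (cM k).
under eq_integral do rewrite EFinM.
rewrite ge0_integralZl_EFin//; last by apply/measurable_EFinP; exact: measurable_indic.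
rewrite integral_indic//; apply: lee_wpmul2l; first by rewrite lee_fin.
by apply: le_measure; rewrite ?inE//; exact: measurableI.
Qed.

Variables (p a : R).
Hypotheses (p0 : (0 < p)%R) (na : (n%:R < a)%R) (anp : (a < n%:R + p)%R).

Definition min_kernel (h : B) : R := (Num.min 1 (enorm h) `^ p / enorm h `^ a)%R.

Lemma min_kernel_ge0 h : (0 <= min_kernel h)%R.
Proof. by rewrite divr_ge0// powR_ge0. Qed.

Lemma measurable_min_kernel : measurable_fun [set: B] min_kernel.
Proof.
have me : measurable_fun [set: B] (fun h : B => enorm h) by exact: measurable_enorm.
apply: measurable_funM.
  apply: (@measurableT_comp _ _ _ _ _ _ (fun a => a `^ p)%R); first exact: measurable_powR.
  by apply: measurable_minr => //; exact: measurable_cst.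
apply: measurable_invr => [x|]; first exact: powR_ge0.
by apply: (@measurableT_comp _ _ _ _ _ _ (fun x => x `^ a)%R); first exact: measurable_powR.
Qed.

(** Dyadic shells on both sides of [|h| = 1]. Outside, [2^k <= |h| < 2^(k+1)] gives the ratio
    [2^n / 2^a], less than 1 since [n < a]. Inside, [2^-(k+1) <= |h| <= 2^-k] gives the ratio
    [2^a / (2^p 2^n)], less than 1 since [a < n + p]. *)
Lemma integral_min_kernel : \int[borel_measure]_h (min_kernel h)%:E < +oo.
Proof.
have a0 : (0 < a)%R by apply: le_lt_trans na.
have me : measurable_fun [set: B] (fun h : B => enorm h) by exact: measurable_enorm.
pose D : set B := [set h | 1 <= enorm h]%R.
have mD : measurable D.
  rewrite (_ : D = (fun h : B => enorm h) @^-1` `[1%R, +oo[%classic).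
    by rewrite -[X in measurable X]setTI; apply: me => //; exact: measurable_itv.
  by apply/seteqP; split => h /=; rewrite in_itv/= andbT.
have m2p : (0 < 2 `^ p :> R)%R by rewrite powR_gt0.
have m2a : (0 < 2 `^ a :> R)%R by rewrite powR_gt0.
have m2n : (0 < 2 ^+ n :> R)%R by rewrite exprn_gt0.
have -> : \int[borel_measure]_h (min_kernel h)%:E =
    \int[borel_measure]_(h in D) (min_kernel h)%:E +
    \int[borel_measure]_(h in ~` D) (min_kernel h)%:E.
  rewrite -[in LHS](setUv D); apply: ge0_integral_setU => //.
  - exact: measurableC.
  - by apply/measurable_EFinP; rewrite setUv; exact: measurable_min_kernel.
  - by move=> x _; rewrite lee_fin min_kernel_ge0.
  - exact/disj_setPCl.
apply: lte_add_pinfty.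
- pose z := (2 ^+ n / 2 `^ a : R)%R.
  apply: (@le_lt_trans _ _ ((4 ^+ n : R) / (1 - z))%:E); last exact: ltry.
  apply: (@integral_shells D min_kernel (fun k => cube (2 ^+ k.+1)%R)
    (fun k => (2 `^ a)^-1 ^+ k)%R _ z) => //.
  + exact: measurable_min_kernel.
  + by move=> k; exact: measurable_cube.
  + exact: min_kernel_ge0.
  + move=> h /= h1.
    have h0 : (0 < enorm h)%R by apply: lt_le_trans h1.
    have exk : exists k, (enorm h < 2 ^+ k.+1)%R.
      exists (Num.bound (enorm h)); apply: (lt_trans (archi_boundP (ltW h0))).
      by rewrite -natrX ltr_nat; apply: (leq_trans (ltn_expl _ (ltnSn 1))); rewrite leq_exp2l.
    case: (ex_minnP exk) => k hk kmin; exists k; first exact: enorm_cube.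
    rewrite /min_kernel min_l// powR1 div1r exprVn -powR_exprn//.
    rewrite lef_pV2 ?posrE ?powR_gt0 ?exprn_gt0//.
    apply: ge0_ler_powR; rewrite ?nnegrE ?exprn_ge0 ?(ltW h0) ?(ltW a0)//.
    case: k hk kmin => [|k] hk kmin; first by rewrite expr0.
    by rewrite leNgt; apply/negP => /kmin; rewrite ltnn.
  + move=> k; rewrite borel_measure_cube ?exprn_ge0// -EFinM lee_fin.
    have -> : ((2 * 2 ^+ k.+1) ^+ n = 4 ^+ n * (2 ^+ n) ^+ k :> R)%R.
      by rewrite -exprM mulnC exprM -exprMn; congr (_ ^+ n)%R; rewrite exprS; ring.
    rewrite /z exprMn le_eqVlt; apply/orP; left; apply/eqP; ring.
  + by rewrite divr_ge0 ?ltW.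
  + by rewrite ltr_pdivrMr// mul1r -powR_mulrn// gt1_ltr_powR.
- pose z := (2 `^ a / (2 `^ p * 2 ^+ n) : R)%R.
  apply: (@le_lt_trans _ _ ((2 ^+ n * 2 `^ a : R) / (1 - z))%:E); last exact: ltry.
  apply: (@integral_shells (~` D) min_kernel (fun k => cube (2^-1 ^+ k)%R)
    (fun k => (2 `^ p)^-1 ^+ k * (2 `^ a) ^+ k.+1)%R _ z) => //.
  + exact: measurableC.
  + exact: measurable_min_kernel.
  + by move=> k; exact: measurable_cube.
  + exact: min_kernel_ge0.
  + move=> h /= /negP; rewrite -ltNge => h1.
    (* The origin lies in no shell; the integrand is 0 there, so the cube of index 0 will do. *)
    have [hz|hN0] := eqVneq (enorm h) 0%R.
      exists 0%N; first by apply: enorm_cube; rewrite expr0.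
      rewrite /min_kernel hz min_r// powR0 ?gt_eqF// mul0r.
      by rewrite mulr_ge0// exprn_ge0// ?invr_ge0 ltW.
    have h0 : (0 < enorm h)%R by rewrite lt_neqAle eq_sym hN0 enorm_ge0.
    have exk : exists k, (2^-1 ^+ k.+1 <= enorm h)%R.
      exists (Num.bound (enorm h)^-1); rewrite exprVn -[leRHS]invrK.
      rewrite lef_pV2 ?posrE ?invr_gt0 ?exprn_gt0//.
      apply: ltW; apply: (lt_trans (archi_boundP _)); first by rewrite invr_ge0 ltW.
      by rewrite -natrX ltr_nat; apply: (leq_trans (ltn_expl _ (ltnSn 1))); rewrite leq_exp2l.
    case: (ex_minnP exk) => k hk kmin; exists k.
      apply: enorm_cube; case: k hk kmin => [|k] hk kmin; first by rewrite expr0.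
      by rewrite ltNge; apply/negP => /kmin; rewrite ltnn.
    have hk' : (enorm h <= 2^-1 ^+ k)%R.
      case: k hk kmin => [|k] hk kmin; first by rewrite expr0 ltW.
      by rewrite leNgt; apply/negP => /ltW/kmin; rewrite ltnn.
    rewrite /min_kernel min_r ?(ltW h1)//.
    apply: ler_pM; rewrite ?invr_ge0 ?powR_ge0//.
      rewrite exprVn -powR_exprn// -powRN -[X in (_ <= _ `^ X)%R]mulN1r.
      rewrite powRrM powR_inv1 ?exprn_ge0// -exprVn.
      by apply: ge0_ler_powR; rewrite ?nnegrE ?exprn_ge0 ?(ltW h0) ?(ltW p0).
    rewrite -powR_exprn// -[leRHS]invrK lef_pV2 ?posrE ?invr_gt0 ?powR_gt0 ?exprn_gt0//.
    rewrite -powRN -mulN1r powRrM powR_inv1 ?exprn_ge0// -exprVn.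
    by apply: ge0_ler_powR; rewrite ?nnegrE ?exprn_ge0 ?(ltW h0) ?(ltW a0).
  + move=> k; rewrite borel_measure_cube ?exprn_ge0// -EFinM lee_fin.
    have -> : ((2 * 2^-1 ^+ k) ^+ n = 2 ^+ n * ((2 ^+ n)^-1) ^+ k :> R)%R.
      by rewrite exprMn -exprM mulnC exprM [in LHS]exprVn.
    rewrite /z invfM !exprMn exprS le_eqVlt; apply/orP; left; apply/eqP; ring.
  + by rewrite mulr_ge0// ltW.
  + rewrite ltr_pdivrMr ?mulr_gt0// mul1r -powR_mulrn// -powRD; last by rewrite pnatr_eq0 implybT.
    by rewrite addrC gt1_ltr_powR.
Qed.

End kernel.

Section lipschitz_energy.
Context {R : realType} {n : nat}.
Local Notation B := (borel_rV R n).
Variables (p a : R).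
Hypotheses (p0 : 0 < p) (na : n%:R < a) (anp : a < n%:R + p).
Local Open Scope ereal_scope.

(** In a pair, [z.1] is the outer variable [y] and [z.2] the inner variable [x] of the iterated
    integrals, so that Tonelli returns them in the order used by [energy]. *)
Definition kernel (z : B * B) : R := (enorm (z.2 - z.1) `^ a)^-1%R.

Lemma kernel_ge0 z : (0 <= kernel z)%R.
Proof. by rewrite invr_ge0 powR_ge0. Qed.

Lemma measurable_kernel : measurable_fun [set: B * B] kernel.
Proof.
apply: measurable_invr => [z|]; first exact: powR_ge0.
apply: (@measurableT_comp _ _ _ _ _ _ (fun x => x `^ a)%R); first exact: measurable_powR.
by apply: measurable_enorm; exact: measurable_borelB.
Qed.

Lemma min_kernelN (h : B) : min_kernel p a (- h)%R = min_kernel p a h.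
Proof. by rewrite /min_kernel enormN. Qed.

Lemma measurable_indic_fst (A : set B) : measurable A ->
  measurable_fun [set: B * B] (fun z => \1_A z.1 : R).
Proof. by move=> mA; apply: measurableT_comp; [exact: measurable_indic|]. Qed.

Lemma measurable_indic_snd (A : set B) : measurable A ->
  measurable_fun [set: B * B] (fun z => \1_A z.2 : R).
Proof. by move=> mA; apply: measurableT_comp; [exact: measurable_indic|]. Qed.

(** For fixed [y] the inner integral of [min_kernel] at [x - y] is a constant [J], by translation
    invariance; what remains is [J] times the measure of the cube. *)
Lemma integral_cube_kernel r : (0 <= r)%R ->
  \int[borel_measure \x borel_measure]_z (\1_(cube r) z.1 * min_kernel p a (z.2 - z.1 : B)%R)%:E < +oo.
Proof.
move=> r0.
have mK : measurable_fun [set: B * B] (fun z => min_kernel p a (z.2 - z.1 : B)%R).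
  apply: (@measurableT_comp _ _ _ _ _ _ (min_kernel p a)); first exact: measurable_min_kernel.
  exact: measurable_borelB.
have mQ : measurable (@cube R n r) by exact: measurable_cube.
rewrite fubini_tonelli1; last 2 first.
- by apply/measurable_EFinP; apply: measurable_funM => //; exact: measurable_indic_fst.
- by move=> z; rewrite lee_fin mulr_ge0// min_kernel_ge0.
pose J := \int[borel_measure]_h (min_kernel p a (h : B))%:E.
have mk : measurable_fun [set: B] (fun h => (min_kernel p a (h : B))%:E).
  by apply/measurable_EFinP; exact: measurable_min_kernel.
have Jy (y : B) : \int[borel_measure]_x (min_kernel p a (x - y : B)%R)%:E = J.
  apply: (@ge0_integral_shift _ _ (- y)%R (fun h => (min_kernel p a (h : B))%:E)).
    exact: mk.
  by move=> x; rewrite lee_fin min_kernel_ge0.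
have -> : fubini_F borel_measure (fun z : B * B =>
     (\1_(cube r) z.1 * min_kernel p a (z.2 - z.1 : B)%R)%:E) =
   (fun y => J * (\1_(cube r) y)%:E).
  apply/funext => y; rewrite /fubini_F /=.
  under eq_integral do rewrite EFinM.
  rewrite muleC -(Jy y); apply: ge0_integralZl_EFin.
  - exact: measurableT.
  - by move=> x _; rewrite lee_fin min_kernel_ge0.
  - apply: (measurableT_comp mk); exact: (measurable_shift (- y)%R).
  - by rewrite indicE.
have J0 : 0 <= J by apply: integral_ge0 => x _; rewrite lee_fin min_kernel_ge0.
rewrite ge0_integralZl//; last by apply/measurable_EFinP; exact: measurable_indic.
rewrite integral_indic// setIT.
apply: lte_mul_pinfty => //; last by rewrite [X in X < _]borel_measure_cube// ltry.
by rewrite ge0_fin_numE// integral_min_kernel.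
Qed.

(** The integrand vanishes unless one of the two points lies in the cube, and is otherwise at most
    [A^p] times [min_kernel]. The two resulting terms have equal integrals because [min_kernel] is
    even. *)
Lemma lipschitz_energy (phi : B -> R) (L M r : R) : (0 <= r)%R ->
  measurable_fun [set: B] phi ->
  (forall x y, `|phi x - phi y| <= L * enorm (x - y))%R ->
  (forall x, `|phi x| <= M)%R -> (forall x, ~ cube r x -> phi x = 0)%R ->
  \int[borel_measure \x borel_measure]_z
    (`|phi z.2 - phi z.1| `^ p * kernel z)%:E < +oo.
Proof.
move=> r0 mphi phiL phiM phi0.
have M0 : (0 <= M)%R by apply: le_trans (phiM 0%R).
(* With this constant, [|phi x - phi y| <= A * min(1, |x - y|)]: [L] serves nearby points and
   [2 * M] distant ones. *)
pose A := Num.max L (2 * M)%R.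
have A0 : (0 <= A)%R by rewrite /A le_max [X in _ || X]mulr_ge0 ?orbT.
have mQ : measurable (@cube R n r) by exact: measurable_cube.
have mK : measurable_fun [set: B * B] (fun z => min_kernel p a (z.2 - z.1 : B)%R).
  apply: (@measurableT_comp _ _ _ _ _ _ (min_kernel p a)); first exact: measurable_min_kernel.
  exact: measurable_borelB.
pose g1 (z : B * B) := (\1_(cube r) z.1 * min_kernel p a (z.2 - z.1 : B)%R)%:E.
pose g2 (z : B * B) := (\1_(cube r) z.2 * min_kernel p a (z.2 - z.1 : B)%R)%:E.
have mg1 : measurable_fun [set: B * B] g1.
  by apply/measurable_EFinP; apply: measurable_funM => //; exact: measurable_indic_fst.
have mg2 : measurable_fun [set: B * B] g2.
  by apply/measurable_EFinP; apply: measurable_funM => //; exact: measurable_indic_snd.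
have g10 z : 0 <= g1 z by rewrite lee_fin mulr_ge0// min_kernel_ge0.
have g20 z : 0 <= g2 z by rewrite lee_fin mulr_ge0// min_kernel_ge0.
have Ap0 : (0 <= A `^ p)%R by exact: powR_ge0.
apply: (@le_lt_trans _ _ (\int[borel_measure \x borel_measure]_z
    ((A `^ p)%:E * (g1 z + g2 z)))).
  apply: ge0_le_integral => //.
  - by move=> z _; rewrite lee_fin mulr_ge0 ?powR_ge0 ?kernel_ge0.
  - apply/measurable_EFinP; apply: measurable_funM; last exact: measurable_kernel.
    apply: (@measurableT_comp _ _ _ _ _ _ (fun x => x `^ p)%R); first exact: measurable_powR.
    apply: measurableT_comp => //; apply: measurable_funB; exact: measurableT_comp.
  - by apply: emeasurable_funM; [exact: measurable_cst|exact: emeasurable_funD].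
  - move=> [y x] _; rewrite /g1 /g2 /kernel /= -EFinD -EFinM lee_fin -mulrDl.
    have [Qx|Qx] := pselect (cube r x \/ cube r y); last first.
      rewrite phi0 ?phi0; [|by move=> H; apply: Qx; right|by move=> H; apply: Qx; left].
      rewrite subrr normr0 powR0 ?gt_eqF// mul0r mulr_ge0// mulr_ge0// ?addr_ge0//.
      exact: min_kernel_ge0.
    apply: (@le_trans _ _ (A `^ p * min_kernel p a (x - y : B)))%R; last first.
      apply: ler_wpM2l => //; rewrite -[leLHS]mul1r ler_wpM2r ?min_kernel_ge0//.
      by rewrite !indicE; case: Qx => Qx; rewrite (mem_set Qx) ?lerDr ?lerDl.
    rewrite /min_kernel mulrA ler_wpM2r ?invr_ge0 ?powR_ge0// -powRM//; last first.
      by rewrite le_min ler01 enorm_ge0.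
    apply: ge0_ler_powR; rewrite ?nnegrE ?(ltW p0)//.
      by rewrite mulr_ge0// le_min ler01 enorm_ge0.
    rewrite /Num.min; case: ifPn => _.
      rewrite mulr1 /A le_max; apply/orP; right.
      apply: (le_trans (ler_normB _ _)); have := phiM x; have := phiM y; lra.
    apply: (le_trans (phiL _ _)); apply: ler_wpM2r; first exact: enorm_ge0.
    by rewrite /A le_max lexx.
rewrite ge0_integralZl//; last 2 first.
- exact: emeasurable_funD.
- by move=> z _; exact: adde_ge0.
apply: lte_mul_pinfty => //.
rewrite ge0_integralD//; apply: lte_add_pinfty; first exact: integral_cube_kernel.
suff <- : \int[borel_measure \x borel_measure]_z g1 z =
    \int[borel_measure \x borel_measure]_z g2 z by exact: integral_cube_kernel.
rewrite (fubini_tonelli1 _ mg1 g10) (fubini_tonelli2 _ mg2 g20).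
apply: eq_integral => x _; apply: eq_integral => y _.
by rewrite /g1 /g2 /= -(min_kernelN (y - x : B)%R) opprB.
Qed.

End lipschitz_energy.

(** * Test functions *)

Section directional.
Context {R : realType} {n : nat} {V : normedModType R}.
Implicit Types (f g : 'rV[R]_n -> V) (x e : 'rV[R]_n).

Lemma is_derive_line f x e d :
  is_derive (0 : R) 1 (fun t : R => f (x + t *: e)) d <-> is_derive x e f d.
Proof.
have E : (fun h : R => h^-1 *: ((fun t : R => f (x + t *: e)) (h *: 1 + 0) -
    (fun t : R => f (x + t *: e)) 0)) =
  (fun h : R => h^-1 *: (f (h *: e + x) - f x)).
  by apply/funext => h /=; rewrite scale0r !addr0 [_%:A]mulr1 [x + _]addrC.
split=> -[dx <-].
  by apply: DeriveDef; rewrite /derivable /derive -E.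
by apply: DeriveDef; rewrite /derivable /derive E.
Qed.

Lemma is_derive_line_at f x e (t : R) : derivable f (x + t *: e) e ->
  is_derive t 1 (fun t : R => f (x + t *: e)) ('D_e f (x + t *: e)).
Proof.
have E : (fun h : R => h^-1 *: ((fun t : R => f (x + t *: e)) (h *: 1 + t) -
    (fun t : R => f (x + t *: e)) t)) =
  (fun h : R => h^-1 *: (f (h *: e + (x + t *: e)) - f (x + t *: e))).
  by apply/funext => h /=; rewrite [_%:A]mulr1 scalerDl addrCA.
by move=> dx; apply: DeriveDef; rewrite /derivable /derive E.
Qed.

Lemma near_closed_support f x : ~ closed_support f x -> \near x, f x = 0.
Proof.
move=> nx; have oC : open (~` closed_support f).
  by apply: closed_openC; exact: closed_closure.
apply: filterS (open_nbhs_nbhs (conj oC nx)) => y ny.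
by apply: contrapT => /eqP fy; apply: ny; exact: subset_closure.
Qed.

Lemma closed_support0 f x : ~ closed_support f x -> f x = 0.
Proof.
by move=> nx; apply: contrapT => /eqP fx; apply: nx; exact: subset_closure.
Qed.


Lemma closed_support_sub f (A : set 'rV[R]_n) :
  closed A -> (forall x, ~ A x -> f x = 0) -> closed_support f `<=` A.
Proof.
move=> cA fA; rewrite [X in _ `<=` X](closure_id A).1//; apply: closure_subset => x /eqP fx.
by apply: contrapT => /fA.
Qed.

Lemma derive_closed_support f e : closed_support (fun x => 'D_e f x) `<=` closed_support f.
Proof.
apply: closed_support_sub; first exact: closed_closure.
move=> x /near_closed_support nx.
rewrite (@near_eq_derive _ _ _ _ (cst 0))//.
by rewrite [LHS]derive_val.
Qed.

Definition compact_support f := compact (closed_support f).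

Lemma compact_support_derive f e : compact_support f -> compact_support (fun x => 'D_e f x).
Proof.
move=> cf; apply: subclosed_compact cf _; first exact: closed_closure.
exact: derive_closed_support.
Qed.

Lemma compact_support_bounded f : continuous f -> compact_support f ->
  exists2 M, 0 <= M & forall x, `|f x| <= M.
Proof.
move=> cf kf.
have : compact (f @` closed_support f).
  by apply: continuous_compact => //; exact: continuous_subspaceT.
move=> /compact_bounded [M [_ HM]].
exists (`|M| + 1); first by rewrite addr_ge0.
move=> x; have [sx|/closed_support0 ->] := pselect (closed_support f x); last first.
  by rewrite normr0 addr_ge0.
apply: (HM (`|M| + 1)); last by exists x.
by rewrite ltr_pwDr// ler_norm.
Qed.

Lemma compact_support_cube f : compact_support f ->
  exists2 r, 0 <= r & forall x, ~ @cube R n r x -> f x = 0.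
Proof.
move=> /compact_bounded [M [_ HM]].
exists (`|M| + 2); first by rewrite addr_ge0.
move=> x nx; apply: closed_support0 => sx; apply: nx => i.
have : `|x| <= `|M| + 1 by apply: HM => //; rewrite ltr_pwDr// ler_norm.
move=> xM; rewrite /= in_itv/= -ltr_norml.
have xi : `|x ord0 i| <= `|x|.
  by rewrite [leRHS]/Num.norm/= mx_normrE; apply: (le_bigmax _ (fun i => `|x i.1 i.2|) (ord0, i)).
by apply: (le_lt_trans xi); apply: (le_lt_trans xM); rewrite ltrD2l ltr1n.
Qed.

Lemma smooth_derive f i : smooth f -> smooth (fun x => 'D_(delta_mx 0 i) f x).
Proof. by move=> sf k; have [_ /(_ i) []] := sf k.+1. Qed.

Lemma smooth_continuous f : smooth f -> continuous f.
Proof. by move=> /(_ 0%N) []. Qed.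

Lemma smooth_derivable f i x : smooth f -> derivable f x (delta_mx 0 i).
Proof. by move=> /(_ 1%N) [_ /(_ i) []]. Qed.

End directional.

Section lipschitz.
Context {R : realType} {n : nat}.
Implicit Types (f : 'rV[R]_n -> R).

Lemma line_lipschitz f (x e : 'rV[R]_n) (M : R) :
  (forall y, derivable f y e) -> (forall y, `|'D_e f y| <= M) ->
  forall t, `|f (x + t *: e) - f x| <= M * `|t|.
Proof.
move=> df fM t.
have dline (s : R) : is_derive s 1 (fun t => f (x + t *: e)) ('D_e f (x + s *: e)).
  exact: is_derive_line_at.
have cline : continuous (fun t : R => f (x + t *: e)).
  move=> s; apply: differentiable_continuous; apply/derivable1_diffP.
  by case: (dline s).
wlog t0 : x t dline cline / 0 <= t.
  move=> H; have [t0|t0] := leP 0 t; first exact: H.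
  have := H (x + t *: e) (- t).
  rewrite -addrA -scalerDl subrr scale0r addr0 distrC normrN; apply.
  - by move=> s; exact: is_derive_line_at.
  - move=> s; apply: differentiable_continuous; apply/derivable1_diffP.
    by case: (@is_derive_line_at _ _ _ f (x + t *: e) e s (df _)).
  - by rewrite oppr_ge0 ltW.
have [c _ E] := @MVT_segment R _ (fun s => 'D_e f (x + s *: e)) 0 t t0 (fun s _ => dline s)
  (continuous_subspaceT cline).
rewrite scale0r addr0 subr0 in E; rewrite E normrM.
by apply: ler_wpM2r => //; exact: fM.
Qed.

Lemma compact_support_lipschitz f : smooth f -> compact_support f ->
  exists2 L, 0 <= L & forall x y, `|f x - f y| <= L * enorm (x - y).
Proof.
move=> sf cf.
have /choice[M HM] : forall i : 'I_n, exists M : R, 0 <= M /\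
    (forall x, `|'D_(delta_mx 0 i) f x| <= M).
  move=> i; have [||M M0 HM] := @compact_support_bounded R n R (fun x => 'D_(delta_mx 0 i) f x).
    exact/smooth_continuous/smooth_derive.
    exact: compact_support_derive.
  by exists M.
exists (\sum_i M i); first by apply: sumr_ge0 => i _; case: (HM i).
move=> x y.
(* The path [z] leads from [y] to [x] by changing one coordinate at a time, so that bounds on the
   partial derivatives suffice and [f x - f y] telescopes. *)
pose z k : 'rV[R]_n := \row_(i < n) if (i < k)%N then x 0 i else y 0 i.
have zS (k : 'I_n) : z k.+1 = z k + (x 0 k - y 0 k) *: delta_mx 0 k.
  apply/rowP => i; rewrite !mxE eqxx/= ltnS leq_eqVlt.
  have [->|ik] := eqVneq i k; first by rewrite eqxx ltnn mulr1; ring.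
  by rewrite (negbTE (_ : val i != val k))// mulr0 addr0.
have -> : f x - f y = \sum_(k < n) (f (z k.+1) - f (z k)).
  rewrite -(big_mkord xpredT (fun k => f (z k.+1) - f (z k))) telescope_sumr//.
  congr (f _ - f _); apply/rowP => i; rewrite mxE ?ltn_ord//.
apply: (le_trans (ler_norm_sum _ _ _)).
rewrite mulr_suml; apply: ler_sum => k _; have [Mk0 Mk] := HM k.
rewrite zS.
have df w : derivable f w (delta_mx 0 k) by exact: smooth_derivable.
apply: (le_trans (@line_lipschitz f (z k) _ (M k) df Mk (x 0 k - y 0 k))).
by apply: ler_wpM2l => //; have := le_coord_enorm (x - y) k; rewrite !mxE.
Qed.

End lipschitz.

Section smooth_algebra.
Context {R : realType} {n : nat}.

Lemma classC_le {V : normedModType R} k (f : 'rV[R]_n -> V) : classC k.+1 f -> classC k f.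
Proof.
elim: k f => [f [cf _]|k ih f [cf df]]; first by split.
by split => // i; have [? /ih] := df i.
Qed.

Lemma classCD {V : normedModType R} k (f g : 'rV[R]_n -> V) :
  classC k f -> classC k g -> classC k (fun x => f x + g x).
Proof.
elim: k f g => [f g [cf _] [cg _]|k ih f g [cf df] [cg dg]].
  by split=> // x; exact: cvgD (cf x) (cg x).
split=> [x|i]; first exact: cvgD (cf x) (cg x).
have [df1 df2] := df i; have [dg1 dg2] := dg i.
split=> [x|]; first exact: derivableD.
rewrite (_ : (fun x => _) = fun x => 'D_(delta_mx 0 i) f x + 'D_(delta_mx 0 i) g x).
  exact: ih.
by apply/funext => x; rewrite -deriveD.
Qed.

Lemma classCM k (f g : 'rV[R]_n -> R) :
  classC k f -> classC k g -> classC k (fun x => f x * g x).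
Proof.
elim: k f g => [f g [cf _] [cg _]|k ih f g [cf df] [cg dg]].
  by split=> // x; exact: cvgM (cf x) (cg x).
split=> [x|i]; first exact: cvgM (cf x) (cg x).
have [df1 df2] := df i; have [dg1 dg2] := dg i.
split=> [x|]; first exact: derivableM.
rewrite (_ : (fun x => _) = fun x =>
    f x * 'D_(delta_mx 0 i) g x + g x * 'D_(delta_mx 0 i) f x).
  by apply: classCD; apply: ih => //; apply: classC_le; split.
by apply/funext => x; rewrite deriveM.
Qed.

Lemma classCZ {V : normedModType R} k (v : V) (f : 'rV[R]_n -> R) :
  classC k f -> classC k (fun x => f x *: v).
Proof.
have dZ (g : 'rV[R]_n -> R) x e : derivable g x e ->
    is_derive x e (fun x => g x *: v) ('D_e g x *: v).
  move=> dg; have H : (fun h : R => h^-1 *: (g (h *: e + x) *: v - g x *: v)) @ 0^' -->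
      'D_e g x *: v.
    under eq_fun do rewrite -scalerBl scalerA.
    exact: cvgZr_tmp dg.
  by apply: DeriveDef; [apply/cvg_ex; exists ('D_e g x *: v)|exact/cvg_lim].
elim: k f => [f [cf _]|k ih f [cf df]].
  by split=> // x; exact: cvgZr_tmp (cf x).
split=> [x|i]; first exact: cvgZr_tmp (cf x).
have [df1 df2] := df i.
split=> [x|]; first by case: (dZ _ _ _ (df1 x)).
rewrite (_ : (fun x => _) = fun x => 'D_(delta_mx 0 i) f x *: v).
  exact: ih.
by apply/funext => x; have [_ ->] := dZ _ _ _ (df1 x).
Qed.

Lemma classC_affine k (c : R) (b : 'rV[R]_n) (f : 'rV[R]_n -> R) :
  classC k f -> classC k (fun x : 'rV[R]_n => f (b + c *: x)).
Proof.
have cont (g : 'rV[R]_n -> R) : continuous g -> continuous (fun x : 'rV[R]_n => g (b + c *: x)).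
  move=> cg x; apply: (@continuous_comp _ _ _ (fun x : 'rV[R]_n => b + c *: x) g); last exact: cg.
  exact: cvgD (cvg_cst _) (cvgZ (cvg_cst _) cvg_id).
have dA (g : 'rV[R]_n -> R) x e : (forall x : 'rV[R]_n, derivable g x e) ->
    is_derive x e (fun x : 'rV[R]_n => g (b + c *: x)) (c * 'D_e g (b + c *: x)).
  move=> dg; apply/is_derive_line.
  rewrite (_ : (fun t => _) = (fun s => g ((b + c *: x) + s *: e)) \o (fun t => c * t)); last first.
    by apply/funext => t /=; rewrite scalerDr scalerA addrA.
  have H0 : is_derive (c * 0) 1 (fun s => g ((b + c *: x) + s *: e)) ('D_e g (b + c *: x)).
    by have := is_derive_line_at (dg (b + c *: x + (c * 0) *: e)); rewrite mulr0 scale0r addr0.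
  have H1 : is_derive (0 : R) 1 (fun t : R => c * t) c.
    have := @is_deriveZ R R R id c 0 1 1 (is_derive_id _ _).
    by rewrite [_%:A]mulr1.
  by rewrite mulrC; exact: is_derive1_comp H0 H1.
elim: k f => [f [cf _]|k ih f [cf df]]; first by split => //; exact: cont.
split=> [|i]; first exact: cont.
have [df1 df2] := df i.
split=> [x|]; first by case: (dA _ x _ df1).
rewrite (_ : (fun x => _) =
    fun x : 'rV[R]_n => 'D_(delta_mx 0 i) f (b + c *: x) *: c).
  by apply: classCZ; exact: (ih (fun x => 'D_(delta_mx 0 i) f x)).
by apply/funext => x; have [_ ->] := dA _ x _ df1; rewrite mulrC.
Qed.

End smooth_algebra.

(** * Convolution *)

Section convolution.
Context {R : realType} {n : nat}.
Local Notation B := (borel_rV R n).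
Implicit Types (g : B -> R) (eta : 'rV[R]_n -> R).

(* With eta (y - x) rather than eta (x - y), g * eta is an average of the
   translates x |-> g (x + h), without any reflection. *)
Definition conv g eta (x : 'rV[R]_n) : R :=
  \int[borel_measure]_y (g y * eta ((y : 'rV[R]_n) - x)).

Lemma measurable_translate eta (x : 'rV[R]_n) : continuous eta ->
  measurable_fun [set: B] (fun y : B => eta ((y : 'rV[R]_n) - x)).
Proof.
move=> ce; apply: (@measurableT_comp _ _ _ _ _ _ (eta : B -> R)).
  exact: continuous_borel_measurable.
exact: (measurable_shift (- x : B)).
Qed.

Lemma integrable_conv g eta (x : 'rV[R]_n) :
  borel_measure.-integrable [set: B] (EFin \o g) -> continuous eta ->
  (exists2 M, 0 <= M & forall y, `|eta y| <= M) ->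
  borel_measure.-integrable [set: B] (EFin \o (fun y : B => g y * eta ((y : 'rV[R]_n) - x))).
Proof.
move=> ig ce [M M0 HM].
have mg : measurable_fun [set: B] g by apply/measurable_EFinP; exact: measurable_int ig.
have iMg : borel_measure.-integrable [set: B] (fun y => M%:E * (EFin \o g) y)%E.
  exact: integrableZl.
apply: le_integrable iMg => //.
  by apply/measurable_EFinP; apply: measurable_funM => //; exact: measurable_translate.
move=> y _ /=; rewrite lee_fin !normrM mulrC.
by apply: ler_wpM2r => //; rewrite (ger0_norm M0).
Qed.

(** The Lipschitz constant of [eta] passes under the integral. The result supplies the continuity
    that [classC] demands at every order. *)
Lemma conv_lipschitz g eta : borel_measure.-integrable [set: B] (EFin \o g) ->
  smooth eta -> compact_support eta ->
  exists2 L, 0 <= L & forall x y, `|conv g eta x - conv g eta y| <= L * enorm (x - y).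
Proof.
move=> ig se ke.
have ce := smooth_continuous se.
have be := compact_support_bounded ce ke.
have [L L0 HL] := compact_support_lipschitz se ke.
have ing : borel_measure.-integrable [set: B] (EFin \o (fun y => `|g y|)).
  exact: (integrable_abse ig).
exists (L * \int[borel_measure]_y `|g y|).
  by rewrite mulr_ge0//; apply: Rintegral_ge0.
move=> x y; rewrite /conv -RintegralB//; [|exact: integrable_conv..].
apply: (le_trans (le_normr_Rintegral _ _)) => //.
  by have := integrableB measurableT (integrable_conv x ig ce be) (integrable_conv y ig ce be).
rewrite -mulrA [_ * enorm _]mulrC mulrA -RintegralZl//.
apply: le_Rintegral => //.
- apply: (integrable_abse (f := EFin \o _)).
  by have := integrableB measurableT (integrable_conv x ig ce be) (integrable_conv y ig ce be).
- exact: (integrableZl measurableT (L * enorm (x - y)) ing).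
- move=> z _; rewrite -mulrBr normrM mulrC ler_wpM2r//.
  apply: (le_trans (HL _ _)).
  by rewrite opprB addrC addrA subrK enormB.
Qed.

Lemma enorm_le_norm (x : 'rV[R]_n) : enorm x <= n%:R * `|x|.
Proof.
apply: (le_trans (enorm_le_sum x)).
rewrite mulr_natl -[X in _ *+ X]card_ord -sumr_const; apply: ler_sum => i _.
by rewrite [leRHS]/Num.norm/= mx_normrE; apply: (le_bigmax _ (fun i => `|x i.1 i.2|) (ord0, i)).
Qed.

Lemma lipschitz_continuous (f : 'rV[R]_n -> R) (L : R) :
  (forall x y, `|f x - f y| <= L * enorm (x - y)) -> continuous f.
Proof.
move=> HL x; apply/(@cvgrPdist_le _ _ _ (nbhs x) (nbhs_filter x)) => e e0.
have L1 : 0 < (`|L| + 1) * (n%:R + 1) by rewrite mulr_gt0// ltr_wpDl.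
have d0 : 0 < e / ((`|L| + 1) * (n%:R + 1)) by rewrite divr_gt0.
near=> y.
apply: (le_trans (HL _ _)).
have xy : `|x - y| <= e / ((`|L| + 1) * (n%:R + 1)).
  near: y; apply/nbhs_ballP; exists (e / ((`|L| + 1) * (n%:R + 1))) => //= z.
  by rewrite -ball_normE /=; exact: ltW.
rewrite ler_pdivlMr// mulrC in xy; apply: le_trans xy; rewrite -mulrA.
apply: (@le_trans _ _ ((`|L| + 1) * enorm (x - y))).
  by apply: ler_wpM2r; rewrite ?enorm_ge0// ler_wpDr// ler_norm.
apply: ler_wpM2l; first by rewrite addr_ge0.
by apply: (le_trans (enorm_le_norm _)); apply: ler_wpM2r => //; rewrite lerDl.
Unshelve. all: by end_near. Qed.

(** Differentiation under the integral along the line through [x], dominated by [|g|] times a bound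
    of the derivative of [eta]. The argument [y - x] produces a minus sign, which is attached to
    [g]: the derivative is then again a [conv], and induction on the order gives smoothness. *)
Lemma is_derive_conv g eta (i : 'I_n) (x : 'rV[R]_n) :
  borel_measure.-integrable [set: B] (EFin \o g) ->
  smooth eta -> compact_support eta ->
  is_derive x (delta_mx 0 i) (conv g eta)
    (conv (fun y => - g y) (fun y => 'D_(delta_mx 0 i) eta y) x).
Proof.
move=> ig se ke; set e := delta_mx 0 i.
have ce := smooth_continuous se.
have be := compact_support_bounded ce ke.
have cde : continuous (fun y => 'D_e eta y) by exact/smooth_continuous/smooth_derive.
have [M M0 HM] := compact_support_bounded cde (compact_support_derive ke).
have ing : borel_measure.-integrable [set: B] (EFin \o (fun y => `|g y|)).
  exact: (integrable_abse ig).
pose F (t : R) (y : B) := g y * eta ((y : 'rV[R]_n) - (x + t *: e)).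
have dF (t : R) (y : B) : is_derive t 1 (F ^~ y)
    (- g y * 'D_e eta ((y : 'rV[R]_n) - (x + t *: e))).
  have H0 : is_derive (- t) 1 (fun s : R => eta (((y : 'rV[R]_n) - x) + s *: e))
      ('D_e eta (((y : 'rV[R]_n) - x) + (- t) *: e)).
    exact/is_derive_line_at/smooth_derivable.
  have H1 : is_derive t 1 (fun t : R => - t) (- 1).
    exact: is_deriveNid.
  have H2 := @is_derive1_comp _ _ _ _ _ _ H0 H1.
  have := @is_deriveZ R R R _ (g y) t 1 _ H2.
  rewrite (_ : _ \*: _ = F ^~ y); last first.
    by apply/funext => s /=; rewrite /F opprD addrA scaleNr.
  by rewrite scaleNr opprD addrA /GRing.scale/= mulrN1 mulrN mulNr.
have intF (t : R) : borel_measure.-integrable [set: B] (EFin \o F t).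
  exact: integrable_conv.
have I0 : `]-1, 1[%classic (0 : R) by rewrite /= in_itv/= ltrN10 ltr01.
have intG : borel_measure.-integrable [set: B] (EFin \o (fun y => `|g y| * M)).
  rewrite (_ : EFin \o _ = fun y => (M%:E * (`|g y|)%:E)%E).
    exact: integrableZl ing.
  by apply/funext => y /=; rewrite -EFinM mulrC.
have derF (t : R) (y : B) : `]-1, 1[%classic t -> [set: B] y -> derivable (F ^~ y) t 1.
  by move=> _ _; case: (dF t y).
have G0 (y : B) : 0 <= `|g y| * M by rewrite mulr_ge0.
have FG (t : R) (y : B) : `]-1, 1[%classic t -> [set: B] y ->
    `|partial1of2 F t y| <= `|g y| * M.
  move=> _ _; rewrite partial1of2E; have [_ ->] := dF t y.
  by rewrite normrM normrN ler_wpM2l.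
have H := @cvg_differentiation_under_integral R _ B borel_measure F setT measurableT
  0 (-1) 1 I0 (fun t _ => intF t) derF (fun y => `|g y| * M) G0 intG FG.
apply/is_derive_line.
have E : conv (fun y => - g y) (fun y => 'D_e eta y) x =
    \int[borel_measure]_y partial1of2 F 0 y.
  apply: eq_Rintegral => y _; rewrite partial1of2E; have [_ ->] := dF 0 y.
  by rewrite scale0r addr0.
rewrite E.
have H' : (fun h : R => h^-1 *: (conv g eta (x + (h *: 1 + 0) *: e) - conv g eta (x + 0 *: e)))
    @ 0^' --> \int[borel_measure]_y partial1of2 F 0 y.
  by under eq_fun do rewrite [_%:A]mulr1; exact: H.
by apply: DeriveDef; [apply/cvg_ex; eexists; exact: H'|exact/cvg_lim].
Qed.

Lemma smooth_conv g eta : borel_measure.-integrable [set: B] (EFin \o g) ->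
  smooth eta -> compact_support eta -> smooth (conv g eta).
Proof.
move=> + + + k; elim: k g eta => [|k ih] g eta ig se ke.
  by split => //; have [L _ HL] := conv_lipschitz ig se ke; exact: lipschitz_continuous HL.
split; first by have [L _ HL] := conv_lipschitz ig se ke; exact: lipschitz_continuous HL.
move=> i; split=> [x|]; first by case: (is_derive_conv i x ig se ke).
rewrite (_ : (fun x => _) =
    conv (fun y => - g y) (fun y => 'D_(delta_mx 0 i) eta y)); last first.
  by apply/funext => x; have [_ ->] := is_derive_conv i x ig se ke.
apply: ih; [|exact: smooth_derive|exact: compact_support_derive].
exact: (integrableN ig).
Qed.

End convolution.

(** * Continuity of translations in L^1 *)

Section L1_distance.
Context d (T : measurableType d) (R : realType) (mu : {measure set T -> \bar R}).
Local Open Scope ereal_scope.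

Definition L1_dist (f g : T -> R) : \bar R := \int[mu]_x (`|f x - g x|)%:E.

Lemma L1_distC f g : L1_dist f g = L1_dist g f.
Proof. by apply: eq_integral => x _; rewrite distrC. Qed.

Lemma measurable_dist (f g : T -> R) : measurable_fun [set: T] f -> measurable_fun [set: T] g ->
  measurable_fun [set: T] (fun x => (`|f x - g x|)%:E).
Proof.
by move=> mf mg; apply/measurable_EFinP; apply: measurableT_comp => //; exact: measurable_funB.
Qed.

Lemma L1_dist_triangle g f h : measurable_fun [set: T] f -> measurable_fun [set: T] g ->
  measurable_fun [set: T] h -> L1_dist f h <= L1_dist f g + L1_dist g h.
Proof.
move=> mf mg mh; rewrite /L1_dist -ge0_integralD; first last.
- exact: measurable_dist.
- by move=> x _; rewrite lee_fin.
- exact: measurable_dist.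
- by move=> x _; rewrite lee_fin.
- exact: measurableT.
apply: ge0_le_integral.
- exact: measurableT.
- by move=> x _; rewrite lee_fin.
- exact: measurable_dist.
- by apply: emeasurable_funD; exact: measurable_dist.
- by move=> x _; rewrite -EFinD lee_fin ler_distD.
Qed.

Lemma L1_distD (f f' g g' : T -> R) : measurable_fun [set: T] f -> measurable_fun [set: T] g ->
  measurable_fun [set: T] f' -> measurable_fun [set: T] g' ->
  L1_dist (fun x => f x + f' x)%R (fun x => g x + g' x)%R <= L1_dist f g + L1_dist f' g'.
Proof.
move=> mf mg mf' mg'; rewrite /L1_dist -ge0_integralD; first last.
- exact: measurable_dist.
- by move=> x _; rewrite lee_fin.
- exact: measurable_dist.
- by move=> x _; rewrite lee_fin.
- exact: measurableT.
apply: ge0_le_integral.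
- exact: measurableT.
- by move=> x _; rewrite lee_fin.
- by apply: measurable_dist; exact: measurable_funD.
- by apply: emeasurable_funD; exact: measurable_dist.
- by move=> x _; rewrite -EFinD lee_fin opprD addrACA ler_normD.
Qed.

Lemma L1_distZ (c : R) (f g : T -> R) : measurable_fun [set: T] f -> measurable_fun [set: T] g ->
  L1_dist (fun x => c * f x)%R (fun x => c * g x)%R = `|c|%:E * L1_dist f g.
Proof.
move=> mf mg; rewrite /L1_dist -ge0_integralZl_EFin.
- by apply: eq_integral => x _; rewrite -mulrBr normrM EFinM.
- exact: measurableT.
- by move=> x _; rewrite lee_fin.
- exact: measurable_dist.
- by [].
Qed.

End L1_distance.

Lemma cvge0_near_le (R : realType) (u : nat -> \bar R) : u @ \oo --> 0%E ->
  forall e : R, 0 < e -> \forall k \near \oo, (u k <= e%:E)%E.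
Proof.
move=> /fine_cvgP[nf /cvgrPdist_le uc] e e0.
have := uc _ e0; apply: filterS2 nf => k fk /=; rewrite sub0r normrN => H.
by rewrite -(fineK fk) lee_fin; apply: le_trans H; exact: ler_norm.
Qed.

Section translation_continuity.
Context {R : realType} {n : nat}.
Local Notation B := (borel_rV R n).
Local Notation m := (@borel_measure R n).
Local Open Scope ereal_scope.

Definition translate (h : B) (f : B -> R) : B -> R := fun x => f (x + h)%R.

Lemma measurable_translate_fun h f : measurable_fun [set: B] f ->
  measurable_fun [set: B] (translate h f).
Proof. by move=> mf; apply: measurableT_comp => //; exact: measurable_shift. Qed.

(** Continuity at 0 of the translations of [f] in L^1. The class is stable under linear combinations
    and L^1 limits, so it is enough to reach indicators of open sets, then of Borel sets inside a
    ball, then simple functions. *)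
Definition L1_continuous (f : B -> R) := measurable_fun [set: B] f /\
  forall e : R, (0 < e)%R -> exists2 dl : R, (0 < dl)%R &
    forall h : B, (enorm h < dl)%R -> L1_dist m (translate h f) f <= e%:E.

Lemma L1_dist_translate h f g : measurable_fun [set: B] f -> measurable_fun [set: B] g ->
  L1_dist m (translate h f) (translate h g) = L1_dist m f g.
Proof.
move=> mf mg; apply: (@ge0_integral_shift _ _ h (fun x => (`|f x - g x|)%:E)).
  exact: measurable_dist.
by move=> x; rewrite lee_fin.
Qed.

(** A three-epsilon argument: [f] and [g] are as close after a common translation as before it. *)
Lemma L1_continuous_closed f : measurable_fun [set: B] f ->
  (forall e : R, (0 < e)%R -> exists2 g, L1_continuous g & L1_dist m f g <= e%:E) ->
  L1_continuous f.
Proof.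
move=> mf H; split=> // e e0.
have e30 : (0 < e / 3)%R by rewrite divr_gt0.
have [g [mg cg] fg] := H _ e30.
have [dl dl0 Hdl] := cg _ e30; exists dl => // h hdl.
have mth k := @measurable_translate_fun h k.
apply: (le_trans (@L1_dist_triangle _ _ _ _ (translate h g) _ _ _ _ _)); try exact: mth => //.
- exact: mf.
have -> : e%:E = (e / 3)%:E + ((e / 3)%:E + (e / 3)%:E) by rewrite -!EFinD; congr EFin; field.
apply: leeD; first by rewrite L1_dist_translate.
apply: (le_trans (@L1_dist_triangle _ _ _ _ g _ _ _ _ _)) => //; first exact: mth.
apply: leeD; first exact: Hdl.
by rewrite L1_distC.
Qed.

Lemma L1_continuousD f g : L1_continuous f -> L1_continuous g ->
  L1_continuous (fun x => f x + g x)%R.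
Proof.
move=> [mf cf] [mg cg]; split=> [|e e0]; first exact: measurable_funD.
have e20 : (0 < e / 2)%R by rewrite divr_gt0.
have [d1 d10 H1] := cf _ e20; have [d2 d20 H2] := cg _ e20.
exists (Num.min d1 d2); first by rewrite lt_min d10.
move=> h; rewrite lt_min => /andP[h1 h2].
apply: (le_trans (@L1_distD _ _ _ _ (translate h f) (translate h g) _ _ _ _ _ _)) => //;
  try exact: measurable_translate_fun.
by rewrite (splitr e) EFinD leeD//; [exact: H1|exact: H2].
Qed.

Lemma L1_continuousZ (c : R) f : L1_continuous f -> L1_continuous (fun x => c * f x)%R.
Proof.
move=> [mf cf]; split=> [|e e0]; first by apply: measurable_funM => //; exact: measurable_cst.
have e20 : (0 < e / (`|c| + 1))%R by rewrite divr_gt0// ltr_wpDl.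
have [d1 d10 H1] := cf _ e20; exists d1 => // h /H1 {}H1.
rewrite (@L1_distZ _ _ _ _ c (translate h f))//; last exact: measurable_translate_fun.
apply: (@le_trans _ _ (`|c|%:E * (e / (`|c| + 1))%:E)); first by apply: lee_wpmul2l => //; rewrite lee_fin.
rewrite -EFinM lee_fin mulrCA ler_piMr ?(ltW e0)// ler_pdivrMr ?mul1r ?lerDl//.
Qed.

Lemma L1_continuous_sum (I : Type) (r : seq I) (f : I -> B -> R) :
  (forall i, L1_continuous (f i)) -> L1_continuous (fun x => \sum_(i <- r) f i x)%R.
Proof.
move=> H; elim: r => [|i r ih].
  under eq_fun do rewrite big_nil.
  split=> [|e e0]; first exact: measurable_cst.
  exists 1%R => // h _; rewrite /L1_dist (eq_integral (cst 0)) ?integral0 ?lee_fin ?(ltW e0)//.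
  by move=> x _; rewrite /translate subrr normr0.
by under eq_fun do rewrite big_cons; exact: L1_continuousD.
Qed.

(* Lower semicontinuity of the indicator of an open set U gives
   [U `&` (U - h)] the full measure of U in the limit, which suffices since
   translation preserves the measure of U. *)
Lemma L1_continuous_open (U : set B) : open U -> m U < +oo -> L1_continuous (\1_U).
Proof.
move=> oU Uoo.
have mU : measurable U by exact: open_borel_measurable.
have mi : measurable_fun [set: B] (\1_U : B -> R) by exact: measurable_indic.
split=> // e e0; apply: contrapT => H.
(* Failure of continuity yields a sequence of shifts tending to 0, as needed for dominated
   convergence along a sequence. *)
have /choice[h hP] : forall k : nat, exists h : B, (enorm h < k.+1%:R^-1)%R /\
    ~ (L1_dist m (translate h \1_U) \1_U <= e%:E).
  move=> k; apply: contrapT => Hk; apply: H; exists (k.+1%:R^-1)%R; first by rewrite invr_gt0.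
  by move=> h hk; apply: contrapT => Hh; apply: Hk; exists h.
pose v k (x : B) : R := (\1_U x * translate (h k) \1_U x)%R.
have mv k : measurable_fun [set: B] (v k).
  by apply: measurable_funM => //; exact: measurable_translate_fun.
have v0 k x : (0 <= v k x)%R by rewrite mulr_ge0.
have intU : m.-integrable [set: B] (EFin \o (\1_U : B -> R)).
  by apply/integrableP; split;
    [exact/measurable_EFinP|rewrite (eq_integral (fun x => (\1_U x)%:E)) ?integral_indic ?setIT//
     => x _; rewrite gee0_abs ?lee_fin].
have iU : \int[m]_x (\1_U x)%:E = m U by rewrite integral_indic// setIT.
have nearU (x : B) : U x -> \forall k \near \oo, U (x + h k)%R.
  move=> Ux; have /nbhs_ballP[r /= r0 rU] : nbhs x U by exact: open_nbhs_nbhs.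
  near=> k; apply: rU; rewrite -ball_normE/= opprD addrA subrr sub0r normrN.
  have [hk _] := hP k.
  apply: (@le_lt_trans _ _ (enorm (h k))).
    rewrite [leLHS]/Num.norm/= mx_normrE; apply: bigmax_le => [|[i j] _]; first exact: enorm_ge0.
    by rewrite (ord1 i); exact: le_coord_enorm.
  apply: (lt_trans hk); near: k.
  have /cvgrPdist_lt/(_ _ r0) := @cvg_harmonic R.
  by apply: filterS => k; rewrite sub0r normrN ger0_norm// invr_ge0.
have vcvg (x : B) : (v k x)%:E @[k --> \oo] --> (\1_U x)%:E.
  have [Ux|nUx] := pselect (U x).
    apply: cvg_near_cst; have := nearU x Ux; apply: filterS => k Uk.
    by rewrite /v /translate !indicE !mem_set// mulr1.
  rewrite (_ : (fun k => _) = cst (\1_U x)%:E); first exact: cvg_cst.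
  by apply/funext => k; rewrite /v indicE memNset// mul0r.
have vdom (x : B) k : `|(v k x)%:E| <= (\1_U x)%:E.
  rewrite gee0_abs ?lee_fin// /v -[leRHS]mulr1 ler_wpM2l//.
  by rewrite /translate indicE; case: (_ \in _).
have mv' k : measurable_fun [set: B] (fun x => (v k x)%:E) by exact/measurable_EFinP.
have mi' : measurable_fun [set: B] (fun x => (\1_U x)%:E : \bar R) by exact/measurable_EFinP.
have [_ v1 _] := @dominated_convergence _ _ _ m setT measurableT
  (fun k x => (v k x)%:E) (fun x => (\1_U x)%:E) (fun x => (\1_U x)%:E)
  mv' mi' (aeW _ (fun x _ => vcvg x)) intU (aeW _ (fun x k _ => vdom x k)).
have e20 : (0 < e / 2)%R by rewrite divr_gt0.
have [k0 _ Hk0] := cvge0_near_le v1 e20.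
have {Hk0} W := Hk0 k0 (leqnn _); rewrite /= in W.
have [_] := hP k0; apply.
pose a (x : B) : R := \1_U x; pose b := translate (h k0) (\1_U : B -> R).
have ma : measurable_fun [set: B] a by exact: mi.
have mb : measurable_fun [set: B] b by exact: measurable_translate_fun.
have mab : measurable_fun [set: B] (v k0) by exact: mv.
have a01 x : (0 <= a x <= 1)%R by rewrite /a indicE; case: (_ \in _); rewrite ?ler01 ?lexx.
have b01 x : (0 <= b x <= 1)%R by rewrite /b /translate indicE; case: (_ \in _); rewrite ?ler01 ?lexx.
have vab x : v k0 x = (a x * b x)%R by [].
have va x : (v k0 x <= a x)%R.
  by have /andP[? ?] := a01 x; have /andP[? ?] := b01 x; rewrite vab ler_piMr.
have vb x : (v k0 x <= b x)%R.
  by have /andP[? ?] := a01 x; have /andP[? ?] := b01 x; rewrite vab ler_piMl.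
have split_int (c : B -> R) : measurable_fun [set: B] c -> (forall x, v k0 x <= c x)%R ->
    \int[m]_x (c x)%:E = \int[m]_x (c x - v k0 x)%:E + \int[m]_x (v k0 x)%:E.
  move=> mc vc; rewrite -ge0_integralD.
  - by apply: eq_integral => x _; rewrite -EFinD subrK.
  - exact: measurableT.
  - by move=> x _; rewrite lee_fin subr_ge0.
  - by apply/measurable_EFinP; exact: measurable_funB.
  - by move=> x _; rewrite lee_fin.
  - exact: mv'.
have ba : \int[m]_x (b x)%:E = \int[m]_x (a x)%:E.
  by apply: (@ge0_integral_shift _ _ (h k0) (fun x => (\1_U x)%:E)) => // x; rewrite lee_fin.
have vfin : \int[m]_x (v k0 x)%:E \is a fin_num.
  rewrite ge0_fin_numE; last by apply: integral_ge0 => x _; rewrite lee_fin.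
  apply: le_lt_trans Uoo; rewrite -iU; apply: ge0_le_integral => //.
  - by move=> x _; rewrite lee_fin.
  - by move=> x _; rewrite lee_fin.
have Wa : \int[m]_x (a x - v k0 x)%:E <= (e / 2)%:E.
  apply: le_trans W; rewrite le_eqVlt; apply/orP; left; apply/eqP; apply: eq_integral => x _.
  by rewrite /= distrC ger0_norm// subr_ge0.
have Wb : \int[m]_x (b x - v k0 x)%:E = \int[m]_x (a x - v k0 x)%:E.
  by rewrite -[LHS](@addeK _ (\int[m]_x (v k0 x)%:E))// -split_int// ba split_int// addeK.
(* Since the product [v] lies below both indicators, [|b - a| <= (a - v) + (b - v)], and each of the
   two parts has integral at most [e / 2]. *)
rewrite (splitr e) EFinD; apply: le_trans (leeD Wa Wa).
rewrite -[X in _ + X]Wb -ge0_integralD; last 5 first.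
- exact: measurableT.
- by move=> x _; rewrite lee_fin subr_ge0.
- by apply/measurable_EFinP; exact: measurable_funB.
- by move=> x _; rewrite lee_fin subr_ge0.
- by apply/measurable_EFinP; exact: measurable_funB.
apply: ge0_le_integral.
- exact: measurableT.
- by move=> x _; rewrite lee_fin.
- exact: measurable_dist.
- by apply: emeasurable_funD; apply/measurable_EFinP; exact: measurable_funB.
- move=> x _; rewrite -EFinD lee_fin -/b -/(a x) ler_norml.
  have := va x; have := vb x; lra.
Unshelve. all: by end_near. Qed.

End translation_continuity.

Section translation_continuity_borel.
Context {R : realType} {n : nat}.
Local Notation B := (borel_rV R n).
Local Notation m := (@borel_measure R n).

(** Open sets form a generator stable under intersection, which is what Dynkin induction
    requires. *)
Lemma borel_rV_measurableE : @measurable _ B = <<s (@open B) >>.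
Proof.
apply/seteqP; split => [A mA|]; last first.
  apply: smallest_sub; first exact: sigma_algebra_measurable.
  by move=> U oU; exact: open_borel_measurable.
have mid : measurable_fun [set: g_sigma_algebraType (@open B)]
    (fun x : g_sigma_algebraType (@open B) => x : B).
  apply: measurable_borelP => i.
  apply: (measurability _ (RGenOpens.measurableE R)).
  move=> _ [_ [a [b ->] <-]]; rewrite setTI; apply: sub_sigma_algebra.
  have /continuousP := @coord_continuous R 1 n ord0 i.
  by apply; exact: interval_open.
by have := mid measurableT _ mA; rewrite setTI.
Qed.

Variable r : R.
(** Sets are intersected with a fixed ball so that all measures are finite: the complement is taken
    relative to [Q], and the indicator of [Q] dominates the series of a disjoint union. *)
Let Q : set B := ball (0 : B) r.

Let oQ : open Q. Proof. exact: ball_open. Qed.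

Let mQ : measurable Q. Proof. exact: open_borel_measurable. Qed.

Let Qoo : (m Q < +oo)%E.
Proof.
have [r0|r0] := ltP 0 r; last first.
  rewrite /Q (_ : ball _ _ = set0); first by rewrite measure0 ltry.
  by apply/seteqP; split=> // x [H _]; move: H; rewrite ltNge r0.
apply: (@le_lt_trans _ _ (m (cube r))); last by rewrite borel_measure_cube ?ltry// ltW.
apply: le_measure; rewrite ?inE//; first exact: measurable_cube.
move=> x [_ H] i; have := H ord0 i.
by rewrite /ball/= !mxE sub0r normrN in_itv/= -ltr_norml.
Qed.

(** By disjointness the partial sums of the indicators take values in {0, 1}; they are dominated by
    the indicator of [Q] and hence converge in L^1. *)
Let L1_continuous_bigcup (F : (set B)^nat) : (forall k, measurable (F k)) ->
  trivIset setT F -> (forall k, L1_continuous (\1_(F k `&` Q))) ->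
  L1_continuous (\1_(\bigcup_k F k `&` Q)).
Proof.
move=> mF tF cF.
have mU : measurable (\bigcup_k F k `&` Q).
  by apply: measurableI => //; exact: bigcupT_measurable.
have mi (A : set B) : measurable A -> measurable_fun [set: B] (\1_A : B -> R).
  by move=> mA; exact: measurable_indic.
pose S N (x : B) : R := \sum_(k < N) \1_(F k `&` Q) x.
have SE N (x : B) j : (F j `&` Q) x -> S N x = (j < N)%N%:R.
  move=> [Fj Qx].
  have other k : k != j -> \1_(F k `&` Q) x = 0 :> R.
    move=> kj; rewrite indicE memNset// => -[Fk _].
    by move/trivIsetP : tF => /(_ k j I I kj)/seteqP[/(_ x (conj Fk Fj))].
  have [jN|jN] := ltnP j N.
    rewrite /S (bigD1 (Ordinal jN))//= big1 ?addr0.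
      by rewrite indicE mem_set.
    by move=> k kj; apply: other; apply: contra kj => /eqP kj; apply/eqP/val_inj.
  rewrite /S big1// => k _; apply: other; apply: contraL jN => /eqP <-.
  by rewrite -ltnNge.
have S0 N (x : B) : ~ (\bigcup_k F k `&` Q) x -> S N x = 0.
  move=> nx; rewrite /S big1// => k _; rewrite indicE memNset// => -[Fk Qx].
  by apply: nx; split => //; exists k.
have mS N : measurable_fun [set: B] (S N).
  by apply: measurable_sum => k; apply: mi; exact: measurableI.
apply: L1_continuous_closed; first exact: mi.
move=> e e0.
have Scvg (x : B) : (S N x)%:E @[N --> \oo] --> (\1_(\bigcup_k F k `&` Q) x)%:E.
  have [[[j _ Fj] Qx]|nx] := pselect ((\bigcup_k F k `&` Q) x).
    apply: cvg_near_cst; exists j.+1 => // N /= jN.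
    by rewrite (SE N x j)// jN indicE mem_set//; split=> //; exists j.
  rewrite (_ : (fun _ => _) = cst 0%:E); first by rewrite indicE memNset//; exact: cvg_cst.
  by apply/funext => N; rewrite S0.
have Sdom (x : B) N : (`|(S N x)%:E| <= (\1_Q x)%:E)%E.
  have [[[j _ Fj] Qx]|nx] := pselect ((\bigcup_k F k `&` Q) x).
    rewrite (SE N x j)// indicE mem_set//= lee_fin ger0_norm//.
    by case: (_ < _)%N.
  by rewrite S0//= normr0 lee_fin.
have iQ : m.-integrable [set: B] (fun x => (\1_Q x)%:E).
  apply/integrableP; split; first by apply/measurable_EFinP; exact: mi.
  under eq_integral do rewrite gee0_abs ?lee_fin//.
  by rewrite integral_indic// setIT.
have mS' N : measurable_fun [set: B] (fun x => (S N x)%:E) by exact/measurable_EFinP.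
have mi' : measurable_fun [set: B] (fun x => (\1_(\bigcup_k F k `&` Q) x)%:E : \bar R).
  by apply/measurable_EFinP; exact: mi.
have [_ S1 _] := @dominated_convergence _ _ _ m setT measurableT
  (fun N x => (S N x)%:E) _ _ mS' mi' (aeW _ (fun x _ => Scvg x)) iQ
  (aeW _ (fun x k _ => Sdom x k)).
have [N _ /(_ N (leqnn _)) W] := cvge0_near_le S1 e0.
exists (S N); first exact: L1_continuous_sum.
by rewrite L1_distC.
Qed.

Let L1_continuous_setI (A : set B) : measurable A -> L1_continuous (\1_(A `&` Q)).
Proof.
rewrite borel_rV_measurableE.
apply: (@dynkin_induction _ B (@open B) (fun A => L1_continuous (\1_(A `&` Q)))
  borel_rV_measurableE).
- by move=> U V oU oV; exact: openI.
- by rewrite setTI; exact: L1_continuous_open.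
- move=> U oU; apply: L1_continuous_open; first exact: openI.
  apply: le_lt_trans Qoo; apply: le_measure; rewrite ?inE//.
  by apply: measurableI => //; exact: open_borel_measurable.
- move=> S mS cS.
  rewrite (_ : \1_(~` S `&` Q) = (fun x => \1_Q x + (-1) * \1_(S `&` Q) x)).
    by apply: L1_continuousD; [exact: L1_continuous_open|exact: L1_continuousZ].
  apply/funext => x; rewrite !indicE !in_setI in_setC.
  by case: (x \in S); case: (x \in Q); rewrite /=; ring.
- exact: L1_continuous_bigcup.
Qed.

Import HBSimple.

(** Simple functions approximate [g] in L^1. Cutting them off to [Q] does not increase the error,
    because [g] vanishes outside [Q], and it turns their level sets into sets already treated. *)
Lemma L1_continuous_bounded_support (g : B -> R) :
  m.-integrable [set: B] (EFin \o g) -> (forall x, ~ ball (0 : B) r x -> g x = 0) ->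
  L1_continuous g.
Proof.
move=> ig g0.
have mg : measurable_fun [set: B] g by apply/measurable_EFinP; exact: measurable_int ig.
apply: L1_continuous_closed => // e e0.
have [f_ [_ _ fg]] := approximation_sfun_integrable measurableT ig.
have [N _ /(_ N (leqnn _)) W] := cvge0_near_le fg e0.
pose f : B -> R := f_ N.
have mf : measurable_fun [set: B] f by exact: measurable_funP.
exists (fun x => f x * \1_Q x).
  have -> : (fun x => f x * \1_Q x) = (fun x =>
      \sum_(c <- finmap.enum_fset (fset_set (range f))) (c * \1_(f @^-1` [set c] `&` Q) x)).
    apply/funext => x; rewrite {1}/f fimfunE fsbig_finite//= mulr_suml.
    by apply: eq_bigr => c _; rewrite indicI -mulrA.
  apply: L1_continuous_sum => c; apply: L1_continuousZ; apply: L1_continuous_setI.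
  by rewrite -[X in measurable X]setTI; exact: mf.
apply: le_trans W; apply: ge0_le_integral.
- exact: measurableT.
- by move=> x _; rewrite lee_fin.
- apply: measurable_dist => //; apply: measurable_funM => //; exact: measurable_indic.
- apply: (@measurable_dist _ _ _ g f) => //.
- move=> x _; rewrite /= lee_fin indicE.
  have [Qx|Qx] := boolP (x \in Q); first by rewrite mulr1.
  by rewrite g0 ?mulr0 ?subrr ?normr0//; move/negP : Qx; apply: contra_not; rewrite inE.
Qed.

End translation_continuity_borel.

(** * Mollification does not increase the energy *)

(** Needed to exchange an integral over pairs of points with the average over mollifier shifts. The
    sigma-finiteness of the product measure is packed into [P], which then serves as one factor. *)
Lemma fubini_tonelli_product d1 d2 d3 (T1 : measurableType d1)
    (T2 : measurableType d2) (T3 : measurableType d3) (R : realType)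
    (m1 : {sigma_finite_measure set T1 -> \bar R})
    (m2 : {sigma_finite_measure set T2 -> \bar R})
    (m3 : {sigma_finite_measure set T3 -> \bar R}) (f : T1 * T2 * T3 -> \bar R) :
  measurable_fun [set: T1 * T2 * T3] f -> (forall w, 0 <= f w)%E ->
  (\int[m1 \x m2]_z \int[m3]_t f (z, t) = \int[m3]_t \int[m1 \x m2]_z f (z, t))%E.
Proof.
move=> mf f0.
have [P PE] := ex_sigma_finite_measure (measure0 (m1 \x m2)%E)
  (@measure_ge0 _ _ _ (m1 \x m2)%E) (@measure_semi_sigma_additive _ _ _ (m1 \x m2)%E)
  (product_measure_sigma_finite m1 m2).
have intE (g : T1 * T2 -> \bar R) : (\int[m1 \x m2]_z g z = \int[P]_z g z)%E.
  by apply: eq_measure_integral => A _ _; exact: (congr1 (fun mu => mu A) PE).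
rewrite intE (fubini_tonelli _ mf f0).
by apply: eq_integral => t _; rewrite intE.
Qed.

Section bounded_functions.
Context d (T : measurableType d) (R : realType) (mu : {measure set T -> \bar R}).

Lemma integrable_bounded_mul (eta f : T -> R) (C : R) :
  mu.-integrable [set: T] (EFin \o eta) -> measurable_fun [set: T] f ->
  (forall x, `|f x| <= C) -> mu.-integrable [set: T] (EFin \o (fun x => eta x * f x)).
Proof.
move=> ie mf fC.
have me : measurable_fun [set: T] eta by apply/measurable_EFinP; exact: measurable_int ie.
have iC : mu.-integrable [set: T] (fun x => C%:E * (EFin \o eta) x)%E by exact: integrableZl.
apply: le_integrable iC => //.
  by apply/measurable_EFinP; exact: measurable_funM.
move=> x _ /=; rewrite lee_fin !normrM mulrC ler_wpM2r//.
by apply: (le_trans (fC x)); exact: ler_norm.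
Qed.

Lemma integral_Rintegral (f : T -> R) : mu.-integrable [set: T] (EFin \o f) ->
  (\int[mu]_x (f x)%:E = (Rintegral mu setT f)%:E)%E.
Proof. by move=> fi; rewrite /Rintegral fineK//; exact: integrable_fin_num fi. Qed.

(* Jensen's inequality, from the tangent line of the p-th power at the mean. *)
Lemma powR_mean_le (p : R) (eta f : T -> R) (C : R) : 1 < p ->
  mu.-integrable [set: T] (EFin \o eta) -> (forall x, 0 <= eta x) ->
  Rintegral mu setT eta = 1 -> measurable_fun [set: T] f ->
  (forall x, 0 <= f x) -> (forall x, f x <= C) ->
  (Rintegral mu setT (fun x => eta x * f x)) `^ p <=
  Rintegral mu setT (fun x => eta x * f x `^ p).
Proof.
move=> p1 ie eta0 eta1 mf f0 fC.
have p0 : 0 < p by exact: lt_trans p1.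
have fCn x : `|f x| <= C by rewrite ger0_norm.
have mfp : measurable_fun [set: T] (fun x => f x `^ p).
  by apply: (@measurableT_comp _ _ _ _ _ _ (fun x => x `^ p)); first exact: measurable_powR.
have fpC x : `|f x `^ p| <= C `^ p.
  rewrite ger0_norm ?powR_ge0//; apply: ge0_ler_powR; rewrite ?nnegrE ?(ltW p0)//.
  by apply: le_trans (fC x).
have i1 := integrable_bounded_mul ie mf fCn.
have i2 := integrable_bounded_mul ie mfp fpC.
pose A := Rintegral mu setT (fun x => eta x * f x).
have A0 : 0 <= A by apply: Rintegral_ge0 => x _; rewrite mulr_ge0.
pose c1 := A `^ p - p * A `^ (p - 1) * A; pose c2 := p * A `^ (p - 1).
have i3 : mu.-integrable [set: T] (EFin \o (fun x => c1 * eta x)).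
  exact: (integrableZl measurableT c1 ie).
have i4 : mu.-integrable [set: T] (EFin \o (fun x => c2 * (eta x * f x))).
  exact: (integrableZl measurableT c2 i1).
have -> : A `^ p = Rintegral mu setT (fun x => c1 * eta x + c2 * (eta x * f x)).
  by rewrite RintegralD// !RintegralZl// eta1 /c1 /c2 -/A mulr1 subrK.
apply: le_Rintegral => //.
  exact: (integrableD measurableT i3 i4).
move=> x _; rewrite /c1 /c2.
have := powR_tangent A0 (f0 x) p1 => H.
rewrite [leLHS](_ : _ = eta x * (A `^ p + p * A `^ (p - 1) * (f x - A))); last by ring.
by apply: ler_wpM2l.
Qed.

End bounded_functions.

Section energy_translation.
Context {R : realType} {n : nat}.
Local Notation B := (borel_rV R n).
Local Notation m := (@borel_measure R n).
Local Notation P := (m \x m)%E.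
Local Open Scope ereal_scope.

Lemma ge0_integral_shift2 (h : B) (F : B * B -> \bar R) :
  measurable_fun [set: B * B] F -> (forall z, 0 <= F z) ->
  \int[P]_z F (z.1 + h, z.2 + h)%R = \int[P]_z F z.
Proof.
move=> mF F0.
have ms : measurable_fun [set: B * B] (fun z : B * B => (z.1 + h : B, z.2 + h : B)%R).
  by apply/measurable_fun_pair; apply: measurable_borelD => //; exact: measurable_cst.
have mFs : measurable_fun [set: B * B] (fun z => F (z.1 + h, z.2 + h)%R).
  exact: (measurableT_comp mF ms).
rewrite (fubini_tonelli1 _ mFs (fun z => F0 _)) [RHS](fubini_tonelli1 _ mF F0).
have mG : measurable_fun [set: B] (fubini_F m F).
  exact: measurable_fun_fubini_tonelli_F.
rewrite -[RHS](ge0_integral_shift h mG); last by move=> x; exact: integral_ge0.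
apply: eq_integral => y _; rewrite /fubini_F /=.
apply: (@ge0_integral_shift _ _ h (fun x => F (y + h, x)%R)); last by [].
exact: measurableT_comp.
Qed.

Variables (p a : R).

(** The p-th power of the Gagliardo seminorm over all of R^n, not over Omega: only the whole-space
    quantity is invariant under translations, hence usable for mollification. *)
Definition gagliardo (f : B -> R) : \bar R :=
  \int[P]_z (`|f z.2 - f z.1| `^ p * kernel a z)%:E.

Lemma measurable_gagliardo (f : B -> R) : measurable_fun [set: B] f ->
  measurable_fun [set: B * B] (fun z => (`|f z.2 - f z.1| `^ p * kernel a z)%:E).
Proof.
move=> mf; apply/measurable_EFinP; apply: measurable_funM; last exact: measurable_kernel.
apply: (@measurableT_comp _ _ _ _ _ _ (fun x => x `^ p)%R); first exact: measurable_powR.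
by apply: measurableT_comp => //; apply: measurable_funB; exact: measurableT_comp.
Qed.

Lemma gagliardo_translate (h : B) (f : B -> R) : measurable_fun [set: B] f ->
  gagliardo (translate h f) = gagliardo f.
Proof.
move=> mf.
rewrite /gagliardo -(ge0_integral_shift2 h (measurable_gagliardo mf)); last first.
  by move=> z; rewrite lee_fin mulr_ge0 ?powR_ge0 ?kernel_ge0.
have kE (z : B * B) : kernel a (z.1 + h, z.2 + h)%R = kernel a z.
  by rewrite /kernel /= opprD addrACA subrr addr0.
by apply: eq_integral => z _; rewrite kE.
Qed.

End energy_translation.

Section mollification.
Context {R : realType} {n : nat}.
Local Notation B := (borel_rV R n).
Local Notation m := (@borel_measure R n).
Local Notation P := (m \x m)%E.

Lemma integrable_bounded_cube (f : B -> R) (M r : R) : 0 <= r -> measurable_fun [set: B] f ->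
  (forall x, `|f x| <= M) -> (forall x, ~ cube r x -> f x = 0) ->
  m.-integrable [set: B] (EFin \o f).
Proof.
move=> r0 mf fM f0.
have iQ : m.-integrable [set: B] (EFin \o (\1_(cube r) : B -> R)).
  apply/integrableP; split.
    by apply/measurable_EFinP; apply: measurable_indic; exact: measurable_cube.
  rewrite (eq_integral (fun x => (\1_(cube r) x)%:E)); last first.
    by move=> x _; rewrite gee0_abs// lee_fin.
  rewrite integral_indic ?setIT//; last exact: measurable_cube.
  by rewrite [X in (X < _)%E]borel_measure_cube// ltry.
apply: eq_integrable (integrable_bounded_mul iQ mf fM) => // x _ /=.
rewrite indicE; have [Qx|Qx] := boolP (x \in cube r); first by rewrite mul1r.
by rewrite mul0r f0//; move/negP : Qx; apply: contra_not; rewrite inE.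
Qed.

Definition mollifier (delta : R) (eta : 'rV[R]_n -> R) :=
  [/\ smooth eta, compact_support eta, forall h, 0 <= eta h,
      Rintegral m setT eta = 1 & forall h, delta <= enorm h -> eta h = 0].

Variables (delta : R) (eta : 'rV[R]_n -> R).
Hypothesis etaP : mollifier delta eta.

Let eta_smooth : smooth eta. Proof. by case: etaP. Qed.
Let eta_compact : compact_support eta. Proof. by case: etaP. Qed.
Let eta0 h : 0 <= eta h. Proof. by case: etaP. Qed.
Let eta1 : Rintegral m setT eta = 1. Proof. by case: etaP. Qed.
Let eta_supp h : delta <= enorm h -> eta h = 0. Proof. by case: etaP => _ _ _ _; apply. Qed.

Let meta : measurable_fun [set: B] (eta : B -> R).
Proof. by apply: continuous_borel_measurable; exact: smooth_continuous. Qed.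

Let ieta : m.-integrable [set: B] (EFin \o (eta : B -> R)).
Proof.
have [M M0 HM] := compact_support_bounded (smooth_continuous eta_smooth) eta_compact.
have [r r0 Hr] := compact_support_cube eta_compact.
exact: (integrable_bounded_cube r0 meta HM Hr).
Qed.

Let int_eta : (\int[m]_h (eta h)%:E = 1)%E.
Proof. by rewrite (integral_Rintegral ieta) eta1. Qed.

Variables (g : B -> R) (M r : R).
Hypotheses (r0 : 0 <= r) (mg : measurable_fun [set: B] g) (gM : forall x, `|g x| <= M)
  (g0 : forall x, ~ cube r x -> g x = 0).

Let ig : m.-integrable [set: B] (EFin \o g).
Proof. exact: (integrable_bounded_cube r0 mg gM g0). Qed.

Let mgx (x : B) : measurable_fun [set: B] (fun h : B => translate h g x).
Proof.
apply: (measurableT_comp mg); apply: measurable_borelD => //; exact: measurable_cst.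
Qed.

Lemma conv_translate (x : 'rV[R]_n) :
  conv g eta x = Rintegral m setT (fun h => eta h * translate h g x).
Proof.
rewrite /conv /Rintegral; congr fine.
have mF : measurable_fun [set: B] (fun y : B => (g y * eta ((y : 'rV[R]_n) - x))%:E).
  apply/measurable_EFinP; apply: measurable_funM => //.
  by apply: measurable_translate; exact: smooth_continuous.
rewrite -(integral_shift (x : B) mF); apply: eq_integral => h _.
by rewrite /translate mulrC addrK (addrC (x : B)).
Qed.

Let iconv (x : B) : m.-integrable [set: B] (EFin \o (fun h : B => eta h * translate h g x)).
Proof. exact: (integrable_bounded_mul ieta (mgx x) (fun h => gM _)). Qed.

Lemma conv_bounded (x : 'rV[R]_n) : `|conv g eta x| <= M.
Proof.
rewrite conv_translate; apply: (le_trans (le_normr_Rintegral measurableT (iconv x))).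
have -> : M = Rintegral m setT (fun h => M * eta h) by rewrite RintegralZl// eta1 mulr1.
apply: le_Rintegral => //.
- exact: (integrable_abse (iconv x)).
- exact: (integrableZl measurableT M ieta).
- move=> h _; rewrite normrM (ger0_norm (eta0 _)) mulrC.
  by apply: ler_wpM2r; [exact: eta0|exact: gM].
Qed.

Lemma conv_support (x : 'rV[R]_n) : (forall h, enorm h < delta -> g (x + h) = 0) ->
  conv g eta x = 0.
Proof.
move=> gx; rewrite conv_translate (_ : (fun _ => _) = cst 0).
  by rewrite /Rintegral /= integral0.
apply/funext => h /=; rewrite /translate.
have [hd|hd] := ltP (enorm h) delta; first by rewrite gx// mulr0.
by rewrite eta_supp// mul0r.
Qed.

Let mconv : measurable_fun [set: B] (conv g eta : B -> R).
Proof. by apply: continuous_borel_measurable; exact/smooth_continuous/smooth_conv. Qed.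

Let dist_conv (x : B) (c : R) :
  `|conv g eta x - c| <= Rintegral m setT (fun h => eta h * `|translate h g x - c|).
Proof.
have ic : m.-integrable [set: B] (EFin \o (fun h => c * eta h)).
  exact: (integrableZl measurableT c ieta).
have -> : conv g eta x - c =
    Rintegral m setT (fun h => eta h * (translate h g x - c)).
  rewrite conv_translate -[c in LHS]mulr1 -eta1 -RintegralZl// -RintegralB//.
  by apply: eq_Rintegral => h _; rewrite mulrBr (mulrC c).
have ii : m.-integrable [set: B] (EFin \o (fun h => eta h * (translate h g x - c))).
  apply: (integrable_bounded_mul (C := M + `|c|) ieta).
    by apply: measurable_funB => //; exact: measurable_cst.
  move=> h; apply: (le_trans (ler_normB _ _)); rewrite lerD2r; exact: gM.
apply: (le_trans (le_normr_Rintegral measurableT ii)).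
rewrite le_eqVlt; apply/orP; left; apply/eqP; apply: eq_Rintegral => h _.
by rewrite normrM (ger0_norm (eta0 _)).
Qed.

Let mtr : measurable_fun [set: B * B] (fun z : B * B => translate z.2 g z.1).
Proof. by apply: (measurableT_comp mg); exact: measurable_borelD. Qed.

Let meta2 d (X : measurableType d) : measurable_fun [set: X * B] (fun z : X * B => eta z.2).
Proof. exact: (measurableT_comp meta). Qed.

(** As [eta] has integral 1, [conv g eta - g] is an [eta]-average of translation errors. Tonelli
    moves the L^1 norm inside this average, and only shifts shorter than [delta] contribute. *)
Lemma L1_dist_conv (e : R) :
  (forall h : B, enorm h < delta -> (L1_dist m (translate h g) g <= e%:E)%E) ->
  (L1_dist m (conv g eta : B -> R) g <= e%:E)%E.
Proof.
move=> He.
pose F (z : B * B) : \bar R := (eta z.2 * `|translate z.2 g z.1 - g z.1|)%:E.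
have F0 z : (0 <= F z)%E by rewrite lee_fin mulr_ge0.
have mF : measurable_fun [set: B * B] F.
  apply/measurable_EFinP; apply: measurable_funM; first exact: meta2.
  apply: measurableT_comp => //; apply: measurable_funB; first exact: mtr.
  exact: (measurableT_comp mg).
apply: (@le_trans _ _ (\int[m]_x \int[m]_h F (x, h))%E).
  apply: ge0_le_integral.
  - exact: measurableT.
  - by move=> x _; rewrite lee_fin.
  - exact: measurable_dist.
  - exact: (measurable_fun_fubini_tonelli_F _ mF F0).
  - move=> x _; have ii : m.-integrable [set: B] (EFin \o (fun h => eta h * `|translate h g x - g x|)).
      apply: (integrable_bounded_mul (C := M + M) ieta).
        by apply: measurableT_comp => //; apply: measurable_funB => //; exact: measurable_cst.
      by move=> h; rewrite normr_id; apply: (le_trans (ler_normB _ _)); apply: lerD; exact: gM.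
    by rewrite (integral_Rintegral ii) lee_fin; exact: dist_conv.
rewrite (fubini_tonelli _ mF F0).
have mG : measurable_fun [set: B] (fun h => \int[m]_x F (x, h))%E.
  exact: (measurable_fun_fubini_tonelli_G _ mF F0).
apply: (@le_trans _ _ (\int[m]_h (e%:E * (eta h)%:E))%E).
  apply: ge0_le_integral => //.
  - by move=> h _; exact: integral_ge0.
  - by apply/measurable_EFinP; apply: measurable_funM => //; exact: measurable_cst.
  - move=> h _; rewrite /F /=.
    rewrite (_ : (\int[m]_x _)%E = ((eta h)%:E * L1_dist m (translate h g) g)%E); last first.
      rewrite /L1_dist -ge0_integralZl_EFin.
      - by apply: eq_integral => x _; rewrite EFinM.
      - exact: measurableT.
      - by move=> x _; rewrite lee_fin.
      - by apply: measurable_dist => //; exact: measurable_translate_fun.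
      - exact: eta0.
    have [hd|hd] := ltP (enorm h) delta.
      by rewrite muleC; apply: lee_wpmul2r; [rewrite lee_fin|exact: He].
    by rewrite eta_supp// mul0e mule0.
rewrite (_ : (\int[m]_h _)%E = (e%:E * \int[m]_h (eta h)%:E)%E).
  by rewrite int_eta mule1.
exact: (integralZl measurableT ieta).
Qed.

(** A difference of [conv g eta] is the [eta]-mean of the differences of the translates of [g].
    Jensen is applied at each pair of points; after Tonelli every translate contributes the same
    [gagliardo p a g], and [eta] has integral 1. *)
Lemma gagliardo_conv (p a : R) : 1 < p ->
  (gagliardo p a (conv g eta : B -> R) <= gagliardo p a g)%E.
Proof.
move=> p1; have p0 : 0 < p by exact: lt_trans p1.
pose D (w : (B * B) * B) : R := `|translate w.2 g w.1.2 - translate w.2 g w.1.1|.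
pose F (w : (B * B) * B) : \bar R := (kernel a w.1 * (eta w.2 * D w `^ p))%:E.
have mD : measurable_fun [set: (B * B) * B] D.
  apply: measurableT_comp => //; apply: measurable_funB;
    apply: (measurableT_comp mg); apply: measurable_borelD => //; exact: measurableT_comp.
have mDp : measurable_fun [set: (B * B) * B] (fun w => D w `^ p).
  by apply: (@measurableT_comp _ _ _ _ _ _ (fun x => x `^ p)); first exact: measurable_powR.
have mF : measurable_fun [set: (B * B) * B] F.
  apply/measurable_EFinP; apply: measurable_funM.
    exact: (measurableT_comp (measurable_kernel a)).
  by apply: measurable_funM => //; exact: meta2.
have F0 w : (0 <= F w)%E by rewrite lee_fin !mulr_ge0 ?powR_ge0 ?kernel_ge0.
have D2M w : D w <= M + M by apply: (le_trans (ler_normB _ _)); apply: lerD; exact: gM.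
have D0 w : 0 <= D w by rewrite /D normr_ge0.
have mDz z : measurable_fun [set: B] (fun h => D (z, h)) by exact: measurableT_comp.
have mDpz z : measurable_fun [set: B] (fun h => D (z, h) `^ p).
  by apply: (@measurableT_comp _ _ _ _ _ _ (fun x => x `^ p)); [exact: measurable_powR|exact: mDz].
have iDp z : m.-integrable [set: B] (EFin \o (fun h => eta h * D (z, h) `^ p)).
  apply: (integrable_bounded_mul (C := (M + M) `^ p) ieta) => // h.
  rewrite ger0_norm ?powR_ge0//; apply: ge0_ler_powR; rewrite ?nnegrE ?(ltW p0)//.
  exact: le_trans (D0 (z, h)) (D2M _).
apply: (@le_trans _ _ (\int[P]_z \int[m]_h F (z, h))%E).
  apply: ge0_le_integral.
  - exact: measurableT.
  - by move=> z _; rewrite lee_fin mulr_ge0 ?powR_ge0 ?kernel_ge0.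
  - exact: measurable_gagliardo.
  - exact: (measurable_fun_fubini_tonelli_F _ mF F0).
  - move=> z _.
    rewrite (_ : (\int[m]_h _)%E =
        ((kernel a z)%:E * \int[m]_h (eta h * D (z, h) `^ p)%:E)%E); last first.
      rewrite -ge0_integralZl_EFin.
      - by apply: eq_integral => h _; rewrite EFinM.
      - exact: measurableT.
      - by move=> h _; rewrite lee_fin mulr_ge0 ?powR_ge0.
      - exact: measurable_int (iDp z).
      - exact: kernel_ge0.
    rewrite (integral_Rintegral (iDp z)) -EFinM lee_fin mulrC ler_wpM2l ?kernel_ge0//.
    apply: le_trans (powR_mean_le p1 ieta eta0 eta1 (mDz z) (fun h => D0 (z, h)) (fun h => D2M (z, h))).
    apply: ge0_ler_powR; rewrite ?nnegrE ?(ltW p0)//.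
      by apply: Rintegral_ge0 => h _; rewrite mulr_ge0.
    rewrite !conv_translate -(RintegralB measurableT (iconv z.2) (iconv z.1)).
    have iB : m.-integrable [set: B] (EFin \o (fun h =>
        eta h * translate h g z.2 - eta h * translate h g z.1)).
      exact: (integrableB measurableT (iconv z.2) (iconv z.1)).
    apply: (le_trans (le_normr_Rintegral measurableT iB)).
    rewrite le_eqVlt; apply/orP; left; apply/eqP; apply: eq_Rintegral => h _.
    by rewrite -mulrBr normrM (ger0_norm (eta0 _)).
rewrite (fubini_tonelli_product m m m mF F0).
rewrite (eq_integral (fun h : B => (gagliardo p a g * (eta h)%:E)%E)); last first.
  move=> h _; rewrite -(gagliardo_translate p a h mg) muleC /gagliardo -ge0_integralZl_EFin.
  - by apply: eq_integral => z _; rewrite /F /D /= -EFinM; congr EFin; ring.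
  - exact: measurableT.
  - by move=> z _; rewrite lee_fin mulr_ge0 ?powR_ge0 ?kernel_ge0.
  - by apply: measurable_gagliardo; exact: measurable_translate_fun.
  - exact: eta0.
have gg0 : (0 <= gagliardo p a g)%E.
  by apply: integral_ge0 => z _; rewrite lee_fin mulr_ge0 ?powR_ge0 ?kernel_ge0.
rewrite ge0_integralZl; [by rewrite int_eta mule1|exact: measurableT| | |exact: gg0].
- by apply/measurable_EFinP.
- by move=> h _; rewrite lee_fin.
Qed.

End mollification.

(** * Construction of mollifiers and of approximating test functions *)

Section supports.
Context {R : realType} {n : nat}.
Local Notation B := (borel_rV R n).

Lemma norm_le_enorm (x : 'rV[R]_n) : `|x| <= enorm x.
Proof.
rewrite [leLHS]/Num.norm/= mx_normrE; apply: bigmax_le => [|[i j] _]; first exact: enorm_ge0.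
by rewrite (ord1 i); exact: le_coord_enorm.
Qed.

Lemma cube_compact_support (f : 'rV[R]_n -> R) (r : R) :
  (forall x, ~ @cube R n r x -> f x = 0) -> compact_support f.
Proof.
move=> f0; pose M := Num.max r 0.
have cA : closed [set x : 'rV[R]_n | `|x| <= M].
  rewrite (_ : [set _ | _] = (fun x : 'rV[R]_n => `|x|) @^-1` [set y | y <= M])//.
  by apply: closed_comp => [x _|]; [exact: norm_continuous|exact: closed_le].
have sA : closed_support f `<=` [set x : 'rV[R]_n | `|x| <= M].
  apply: closed_support_sub => // x xr; apply: f0 => xQ; apply: xr => /=.
  rewrite [leLHS]/Num.norm/= mx_normrE; apply: bigmax_le => [|[i j] _].
    by rewrite le_max lexx orbT.
  rewrite (ord1 i) le_max; have := xQ j.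
  by rewrite /= in_itv/= -ltr_norml => /ltW ->.
apply: bounded_closed_compact; last exact: closed_closure.
exists M; split; first exact: num_real.
by move=> M' MM' x /sA /= xr; exact: le_trans xr (ltW MM').
Qed.

(** Around each point of [K] a ball inside Omega leaves room for small shifts; the covering form of
    compactness makes this room uniform. *)
Lemma compact_thickening (K Omega : set 'rV[R]_n) : compact K -> open Omega -> K `<=` Omega ->
  exists2 rho : R, 0 < rho & forall x h, K x -> enorm h <= rho -> Omega (x + h).
Proof.
move=> cK oO KO.
have H : forall x, K x -> \forall x' \near x & rho \near (0 : R)^'+,
    forall h, enorm h <= rho -> Omega (x' + h).
  move=> x Kx.
  have /nbhs_ballP[r /= r0 rO] : nbhs x Omega by apply: open_nbhs_nbhs; split => //; exact: KO.
  have r20 : 0 < r / 2 by rewrite divr_gt0.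
  exists (ball x (r / 2), [set rho | rho < r / 2]).
    split => /=; first exact: nbhsx_ballx.
    exact: nbhs_right_lt.
  move=> [x' rho] /= [xx' rho2] h hrho; apply: rO; move: xx'; rewrite -!ball_normE/= => xx'.
  rewrite opprD addrA; apply: (le_lt_trans (ler_normB _ _)).
  rewrite (splitr r) ltrD//; apply: (le_lt_trans (norm_le_enorm h)).
  exact: le_lt_trans rho2.
have := @compact_near_coveringP _ K; move=> /propext E; move: cK; rewrite E => /(_ _ _ _ _ H) nH.
have [rho rho0 Hrho] : exists2 rho : R, 0 < rho & K `<=` (fun x => forall h, enorm h <= rho -> Omega (x + h)).
  near (0 : R)^'+ => rho; exists rho => //.
  by near: rho.
by exists rho => // x h Kx; exact: Hrho.
Unshelve. all: by end_near. Qed.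

Lemma enorm_cube_le (x : B) r : 0 <= r -> cube r x -> enorm (x : 'rV[R]_n) <= n%:R * r.
Proof.
move=> r0 xQ; apply: (le_trans (enorm_le_sum _)).
rewrite mulr_natl -[X in _ *+ X]card_ord -sumr_const; apply: ler_sum => i _.
by have := xQ i; rewrite /= in_itv/= -ltr_norml => /ltW.
Qed.

(** No explicit bump function is constructed: the square of a rescaled copy of the given nonzero
    [f], centred at a point where [f] does not vanish, is nonnegative and positive at 0, and only
    has to be normalised. *)
Lemma ex_mollifier (f : 'rV[R]_n -> R) (x0 : 'rV[R]_n) : smooth f -> compact_support f ->
  f x0 != 0 -> forall delta : R, 0 < delta -> exists eta : 'rV[R]_n -> R, mollifier delta eta.
Proof.
move=> sf cf fx0 delta d0.
have [r r0 Hr] := compact_support_cube cf.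
(* The support of [f] lies in [|x| <= n * r]. If [|h| >= delta], then [|x0 + k h| >= k * delta -
   |x0| = n * r + 1], which is outside it. *)
pose k := (n%:R * r + enorm x0 + 1) / delta.
have k0 : 0 < k.
  by rewrite divr_gt0// ltr_wpDl// addr_ge0 ?enorm_ge0// mulr_ge0.
pose psi (h : 'rV[R]_n) := f (x0 + k *: h) * f (x0 + k *: h).
have spsi : smooth psi by move=> j; apply: classCM; apply: classC_affine.
have psi0 h : 0 <= psi h by rewrite /psi -expr2 sqr_ge0.
have psi_supp h : delta <= enorm h -> psi h = 0.
  move=> dh; rewrite /psi Hr ?mul0r// => /(enorm_cube_le r0) H.
  have := enormD (x0 + k *: h) (- x0).
  rewrite addrC addKr enormN enormZ gtr0_norm// => H2.
  have : k * delta <= k * enorm h by rewrite ler_wpM2l// ltW.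
  rewrite /k divfK ?gt_eqF// -/k; lra.
have psi_cube h : ~ @cube R n delta h -> psi h = 0.
  by move=> nh; apply: psi_supp; rewrite leNgt; apply/negP => /enorm_cube.
have cpsi := cube_compact_support psi_cube.
have cont := smooth_continuous spsi.
have mpsi : measurable_fun [set: B] (psi : B -> R) by exact: continuous_borel_measurable.
have [M M0 HM] := compact_support_bounded cont cpsi.
have ipsi : borel_measure.-integrable [set: B] (EFin \o (psi : B -> R)).
  exact: (integrable_bounded_cube (ltW d0) mpsi HM psi_cube).
have psi00 : 0 < psi 0 by rewrite /psi scaler0 addr0 -expr2 lt_neqAle sqr_ge0 eq_sym sqrf_eq0 fx0.
have [rho rho0 Hrho] : exists2 rho : R, 0 < rho & forall h, @cube R n rho h -> psi 0 / 2 <= psi h.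
  have : \forall h \near (0 : 'rV[R]_n), psi 0 / 2 <= psi h.
    have := cont 0; move/(@cvgrPdist_le _ _ _ (nbhs (0 : 'rV[R]_n)) (nbhs_filter (0 : 'rV[R]_n))) => /(_ (psi 0 / 2)).
    rewrite divr_gt0// => /(_ isT); apply: filterS => h; rewrite ler_norml; lra.
  move=> /nbhs_ballP[rho /= rho0 H]; exists rho => // h hQ; apply: H; split=> // i j.
  by rewrite (ord1 i) mxE /ball/= sub0r normrN; have := hQ j; rewrite /= in_itv/= -ltr_norml.
pose c := Rintegral borel_measure [set: B] psi.
(* Continuity keeps [psi] above half its value at 0 on a small cube of positive measure. *)
have c0 : 0 < c.
  have H : ((psi 0 / 2)%:E * borel_measure (@cube R n rho) <= c%:E)%E.
    rewrite /c -(integral_Rintegral ipsi).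
    have -> : borel_measure (@cube R n rho) = (\int[borel_measure]_h (\1_(cube rho) (h : B))%:E)%E.
      by rewrite integral_indic ?setIT//; exact: measurable_cube.
    rewrite -ge0_integralZl_EFin; first last.
    - by rewrite divr_ge0// ltW.
    - by apply/measurable_EFinP; apply: measurable_indic; exact: measurable_cube.
    - by move=> h _; rewrite lee_fin.
    - exact: measurableT.
    apply: ge0_le_integral => //.
    - by move=> x _; rewrite -EFinM lee_fin mulr_ge0// divr_ge0// ltW.
    - apply/measurable_EFinP; apply: measurable_funM; first exact: measurable_cst.
      by apply: measurable_indic; exact: measurable_cube.
    - exact/measurable_EFinP.
    - move=> h _; rewrite -EFinM lee_fin indicE.
      have [hQ|hQ] := boolP (h \in cube rho); last by rewrite mulr0.
      by rewrite mulr1; apply: Hrho; rewrite inE in hQ.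
  rewrite borel_measure_cube ?(ltW rho0)// -EFinM lee_fin in H.
  by apply: lt_le_trans H; rewrite mulr_gt0 ?divr_gt0// exprn_gt0// mulr_gt0.
pose eta h := psi h *: c^-1.
have eta_cube h : ~ @cube R n delta h -> eta h = 0.
  by move=> nh; rewrite /eta psi_cube// scale0r.
exists eta; split.
- by move=> j; apply: classCZ.
- exact: cube_compact_support eta_cube.
- by move=> h; rewrite /eta /GRing.scale/= mulr_ge0// invr_ge0 ltW.
- rewrite (_ : eta = fun h => c^-1 * psi h); last first.
    by apply/funext => h; rewrite /eta /GRing.scale/= mulrC.
  by rewrite RintegralZl// -/c mulVf// gt_eqF.
- by move=> h dh; rewrite /eta psi_supp// scale0r.
Qed.

End supports.

Section approximation.
Context {R : realType} {n : nat}.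
Local Notation B := (borel_rV R n).
Local Notation m := (@borel_measure R n).

(** The approximation is [conv g eta], with [eta] made out of [phi] itself; this is why [phi] must
    not vanish identically. *)
Lemma approx_test_function (Omega : set 'rV[R]_n) (phi : 'rV[R]_n -> R) (g : B -> R)
    (p a M e : R) :
  1 < p -> 0 < e -> open Omega -> test_function Omega phi -> (exists x0, phi x0 != 0) ->
  measurable_fun [set: B] g -> (forall x, `|g x| <= M) ->
  (forall x, ~ closed_support phi x -> g x = 0) ->
  exists g' : 'rV[R]_n -> R, [/\ test_function Omega g', forall x, `|g' x| <= M,
    (L1_dist m (g' : B -> R) g <= e%:E)%E &
    (gagliardo p a (g' : B -> R) <= gagliardo p a g)%E].
Proof.
move=> p1 e0 oO [sphi cphi phiO] [x0 phix0] mg gM g0.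
have [r rp Hr] : exists2 r, 0 < r & forall x, ~ @cube R n r x -> g x = 0.
  have : compact (closed_support phi) by [].
  move=> /compact_bounded [M' [_ HM]].
  exists (`|M'| + 2); first by rewrite ltr_wpDl.
  move=> x nx; apply: g0 => sx; apply: nx => i.
  have xM : `|x| <= `|M'| + 1 by apply: HM => //; rewrite ltr_pwDr// ler_norm.
  rewrite /= in_itv/= -ltr_norml.
  have xi : `|x ord0 i| <= `|x|.
    by rewrite [leRHS]/Num.norm/= mx_normrE; apply: (le_bigmax _ (fun i => `|x i.1 i.2|) (ord0, i)).
  by apply: (le_lt_trans xi); apply: (le_lt_trans xM); rewrite ltrD2l ltr1n.
have r0 := ltW rp; have ig := integrable_bounded_cube r0 mg gM Hr.
have [rho rho0 Hrho] := compact_thickening cphi oO phiO.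
have [_ /(_ _ e0)[d1 d10 Hd1]] : L1_continuous g.
  apply: (@L1_continuous_bounded_support R n r) => // x nx; apply: Hr => xQ; apply: nx.
  split=> //.
  by move=> i j; rewrite (ord1 i) mxE /ball/= sub0r normrN; have := xQ j; rewrite /= in_itv/= -ltr_norml.
(* [d1] secures the L^1 error, and [rho / 2] keeps half of the room around the support of [phi] for
   the mollification. *)
pose delta := Num.min d1 (rho / 2).
have delta0 : 0 < delta by rewrite lt_min d10 divr_gt0.
have [eta Heta] := ex_mollifier sphi cphi phix0 delta0.
have sg' : smooth (conv g eta).
  by case: Heta => se ce _ _ _; exact: smooth_conv.
exists (conv g eta); split.
- split => //.
  + apply: (@cube_compact_support R n _ (r + delta)) => x nx.
    apply: (conv_support Heta) => // h hd; apply: Hr => xhQ; apply: nx => i.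
    have := xhQ i; rewrite /= !in_itv/= mxE -!ltr_norml => H.
    rewrite -[x ord0 i](addrK (h ord0 i)); apply: (le_lt_trans (ler_normB _ _)).
    by rewrite ltrD//; apply: le_lt_trans hd; exact: le_coord_enorm.
  + move=> x xs.
    (* The closure is taken in the sup norm. Since [enorm] is at most [n] times that norm, a point
       this close costs at most the other [rho / 2] in Euclidean distance. *)
    have rn0 : 0 < rho / (2 * (n%:R + 1)) by rewrite divr_gt0// mulr_gt0// ltr_wpDl.
    have [y [/= gy xy]] := xs _ (nbhsx_ballx x _ rn0).
    have [h [hd gyh]] : exists h, enorm h < delta /\ g (y + h) <> 0.
      apply: contrapT => H; move/eqP : gy; apply; apply: (conv_support Heta mg) => h hd.
      by apply: contrapT => gyh; apply: H; exists h.
    have Kyh : closed_support phi (y + h) by apply: contrapT => /g0.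
    rewrite (_ : x = (y + h) + (x - y - h)); last first.
      by rewrite addrACA subrr addr0 addrC subrK.
    apply: Hrho => //; apply: (le_trans (enormB_le _ _)).
    rewrite (splitr rho) lerD//; last first.
      by apply: ltW; apply: (lt_le_trans hd); rewrite ge_min lexx orbT.
    apply: (le_trans (enorm_le_norm _)).
    move: xy; rewrite -ball_normE/= => /ltW xy.
    apply: (@le_trans _ _ ((n%:R + 1) * `|x - y|)).
      by apply: ler_wpM2r => //; rewrite lerDl.
    rewrite -ler_pdivlMl ?ltr_wpDl//; apply: (le_trans xy).
    by rewrite invfM mulrA mulrC mulrA.
- by move=> x; apply: (conv_bounded Heta mg gM).
- apply: (L1_dist_conv Heta r0 mg gM Hr) => h; rewrite lt_min => /andP[h1 _].
  exact: Hd1.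
- exact: (gagliardo_conv Heta r0 mg gM Hr).
Qed.

End approximation.

(** * Variations on the sphere *)

Section normalized_variation.
Context {R : realType} {N : nat}.
Implicit Types (a b : 'rV[R]_N) (t : R).

Lemma ler_dist_mul (x y x' y' X Y dx dy : R) : `|x| <= X -> `|y'| <= Y ->
  `|x - x'| <= dx -> `|y - y'| <= dy -> `|x * y - x' * y'| <= X * dy + Y * dx.
Proof.
move=> xX yY xdx ydy.
have -> : x * y - x' * y' = x * (y - y') + y' * (x - x') by ring.
by apply: (le_trans (ler_normD _ _)); rewrite !normrM lerD// ler_pM.
Qed.

Definition quot_rho t a b : R := enorm (a + t *: b).

(** This is [(1 - 1 / rho) / t] with the division carried out. Indeed [1 - 1 / rho = (rho^2 - 1) /
    (rho * (1 + rho))], and [rho^2 - 1] is [t] times the first factor when [enorm a = 1]. *)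
Definition quot_kappa t a b : R :=
  (2 * dotp a b + t * enorm b ^+ 2) * ((quot_rho t a b)^-1 * (1 + quot_rho t a b)^-1).

(* The difference quotient [(normalize (a + t b) - a) / t] for [enorm a = 1],
   written without division by [t]. *)
Definition normalize_quot t a b : 'rV[R]_N :=
  (quot_rho t a b)^-1 *: b - quot_kappa t a b *: a.

Lemma quot_rho_sqr t a b : enorm a = 1 ->
  quot_rho t a b ^+ 2 = 1 + t * (2 * dotp a b + t * enorm b ^+ 2).
Proof.
move=> a1; rewrite /quot_rho enorm_sqr !(dotpDl, dotpDr, dotpZl, dotpZr) -!enorm_sqr a1.
rewrite (dotpC b a); ring.
Qed.

Lemma normalize_quotE t a b : enorm a = 1 -> 0 < quot_rho t a b ->
  normalize (a + t *: b) = a + t *: normalize_quot t a b.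
Proof.
move=> a1 r0; rewrite /normalize -/(quot_rho t a b) /normalize_quot.
have r1 : 0 < 1 + quot_rho t a b by rewrite addr_gt0.
have H : 1 - t * quot_kappa t a b = (quot_rho t a b)^-1.
  have := quot_rho_sqr t b a1; rewrite /quot_kappa mulrA => H.
  have -> : t * (2 * dotp a b + t * enorm b ^+ 2) = quot_rho t a b ^+ 2 - 1 by rewrite H; ring.
  by field; rewrite !gt_eqF.
have Ha : (quot_rho t a b)^-1 *: a = a - (t * quot_kappa t a b) *: a.
  by rewrite -H scalerBl scale1r.
rewrite scalerDr Ha scalerBr !scalerA (mulrC t) -addrA; congr (_ + _).
by rewrite addrC (mulrC t).
Qed.

Let s_bound (C x d y : R) : 0 <= C -> x <= C -> y <= 2^-1 * C -> d <= x ->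
  2 * d + y <= 3 * C.
Proof. by move=> *; lra. Qed.

Section lipschitz.
Variables (t C : R).
Hypotheses (t0 : 0 <= t) (t1 : t <= 1) (C0 : 0 <= C) (tC : t * C <= 2^-1).

Lemma quot_rho_ge a b : enorm a = 1 -> enorm b <= C -> 2^-1 <= quot_rho t a b.
Proof.
move=> a1 bC; have := enorm_dist a (- (t *: b)); rewrite opprK enormN enormZ a1 (ger0_norm t0).
have : t * enorm b <= 2^-1 by apply: le_trans tC; rewrite ler_wpM2l.
by rewrite -/(quot_rho t a b) ler_norml => H /andP[_ H2]; lra.
Qed.

(** The bound is uniform in [t], so the difference quotients of the energy are dominated by the
    energies of [u] and of the variation. Since [t * C <= 1/2] forces [rho >= 1/2], one has
    [1 / rho <= 2]. The term in [b] contributes [2 + 4C] and the term in [a] contributes [6 + 28C],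
    whence [8 + 32C]. *)
Lemma normalize_quot_lipschitz a b a' b' : enorm a = 1 -> enorm b <= C ->
  enorm a' = 1 -> enorm b' <= C ->
  enorm (normalize_quot t a b - normalize_quot t a' b') <=
  (8 + 32 * C) * (enorm (a - a') + enorm (b - b')).
Proof.
move=> a1 bC a1' bC'; set dl := enorm (a - a') + enorm (b - b').
have da : enorm (a - a') <= dl by rewrite lerDl enorm_ge0.
have db : enorm (b - b') <= dl by rewrite lerDr enorm_ge0.
have dl0 : 0 <= dl by rewrite addr_ge0 ?enorm_ge0.
have Cdl : 0 <= C * dl by rewrite mulr_ge0.
set r := (quot_rho t a b)^-1; set r' := (quot_rho t a' b')^-1.
set q := (1 + quot_rho t a b)^-1; set q' := (1 + quot_rho t a' b')^-1.
have Hr := quot_rho_ge a1 bC; have Hr' := quot_rho_ge a1' bC'.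
have rho0 : 0 < quot_rho t a b by apply: lt_le_trans Hr.
have rho0' : 0 < quot_rho t a' b' by apply: lt_le_trans Hr'.
have r2 : `|r| <= 2.
  by rewrite gtr0_norm ?invr_gt0// -[leRHS]invrK lef_pV2 ?posrE// invr_gt0.
have r2' : `|r'| <= 2.
  by rewrite gtr0_norm ?invr_gt0// -[leRHS]invrK lef_pV2 ?posrE// invr_gt0.
have q1 : `|q| <= 1.
  by rewrite gtr0_norm ?invr_gt0 ?addr_gt0// invf_le1 ?addr_gt0// lerDl ltW.
have q1' : `|q'| <= 1.
  by rewrite gtr0_norm ?invr_gt0 ?addr_gt0// invf_le1 ?addr_gt0// lerDl ltW.
have drho : `|quot_rho t a b - quot_rho t a' b'| <= dl.
  apply: (le_trans (enorm_dist _ _)).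
  rewrite (_ : _ - _ = (a - a') + t *: (b - b')); last by rewrite scalerBr opprD addrACA.
  apply: (le_trans (enormD _ _)); rewrite enormZ (ger0_norm t0) lerD2l.
  by rewrite ler_piMl ?enorm_ge0.
have dr : `|r - r'| <= 4 * dl.
  have -> : r - r' = (quot_rho t a' b' - quot_rho t a b) * (r * r').
    by rewrite /r /r'; field; rewrite !gt_eqF.
  rewrite normrM distrC mulrC; apply: ler_pM => //.
  by rewrite normrM (_ : 4 = 2 * 2)%R; [exact: ler_pM|ring].
have dq : `|q - q'| <= dl.
  have -> : q - q' = (quot_rho t a' b' - quot_rho t a b) * (q * q').
    by rewrite /q /q'; field; rewrite !gt_eqF// addr_gt0.
  rewrite normrM distrC -[leRHS]mulr1; apply: ler_pM => //.
  by rewrite normrM -[leRHS]mulr1; exact: ler_pM.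
set s := 2 * dotp a b + t * enorm b ^+ 2; set s' := 2 * dotp a' b' + t * enorm b' ^+ 2.
have tb (c : 'rV[R]_N) : enorm c <= C -> t * enorm c ^+ 2 <= 2^-1 * C.
  move=> cC; rewrite expr2 mulrA; apply: ler_pM; rewrite ?mulr_ge0 ?enorm_ge0//.
  by apply: le_trans tC; rewrite ler_wpM2l.
have tb0 (c : 'rV[R]_N) : 0 <= t * enorm c ^+ 2 by rewrite mulr_ge0// sqr_ge0.
have n2 : `|2| = 2 :> R by rewrite ger0_norm.
have sC : `|s| <= 3 * C.
  apply: (le_trans (ler_normD _ _)); rewrite normrM (ger0_norm (tb0 b)) n2.
  apply: s_bound C0 bC (tb _ bC) _.
  by have := normr_dotp_le a b; rewrite a1 mul1r.
have sC' : `|s'| <= 3 * C.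
  apply: (le_trans (ler_normD _ _)); rewrite normrM (ger0_norm (tb0 b')) n2.
  apply: s_bound C0 bC' (tb _ bC') _.
  by have := normr_dotp_le a' b'; rewrite a1' mul1r.
have ds : `|s - s'| <= (3 + 2 * C) * dl.
  have ddot : `|dotp a b - dotp a' b'| <= dl + C * dl.
    have -> : dotp a b - dotp a' b' = dotp a (b - b') + dotp (a - a') b'.
      by rewrite dotpBr dotpBl; ring.
    apply: (le_trans (ler_normD _ _)); apply: lerD.
      by apply: (le_trans (normr_dotp_le _ _)); rewrite a1 mul1r.
    by apply: (le_trans (normr_dotp_le _ _)); rewrite mulrC; apply: ler_pM; rewrite ?enorm_ge0.
  have dsq : `|t * enorm b ^+ 2 - t * enorm b' ^+ 2| <= dl.
    have -> : t * enorm b ^+ 2 - t * enorm b' ^+ 2 =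
        (t * (enorm b + enorm b')) * (enorm b - enorm b') by ring.
    rewrite normrM -[leRHS]mul1r; apply: ler_pM => //.
      rewrite ger0_norm ?mulr_ge0 ?addr_ge0 ?enorm_ge0//.
      have : t * enorm b <= t * C by rewrite ler_wpM2l.
      have : t * enorm b' <= t * C by rewrite ler_wpM2l.
      have := tC; rewrite mulrDr; lra.
    by apply: (le_trans (enorm_dist _ _)).
  have -> : s - s' = 2 * (dotp a b - dotp a' b') + (t * enorm b ^+ 2 - t * enorm b' ^+ 2).
    by rewrite /s /s'; ring.
  apply: (le_trans (ler_normD _ _)); rewrite normrM n2; lra.
have rq : `|r * q| <= 2 by rewrite normrM -[leRHS]mulr1; exact: ler_pM.
have rq' : `|r' * q'| <= 2 by rewrite normrM -[leRHS]mulr1; exact: ler_pM.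
have drq := ler_dist_mul r2 q1' dr dq.
have kC : `|s * (r * q)| <= 6 * C.
  by rewrite normrM (_ : 6 * C = (3 * C) * 2); [exact: ler_pM|ring].
have dk := ler_dist_mul sC rq' ds drq.
rewrite /normalize_quot /quot_kappa -/r -/r' -/q -/q' -/s -/s'.
set k := s * (r * q) in kC dk *; set k' := s' * (r' * q') in dk *.
have -> : r *: b - k *: a - (r' *: b' - k' *: a') =
   (r *: (b - b') + (r - r') *: b') - (k *: (a - a') + (k - k') *: a').
  by apply/rowP => i; rewrite !mxE; ring.
apply: (le_trans (enormB_le _ _)).
have H1 : enorm (r *: (b - b') + (r - r') *: b') <= 2 * dl + (4 * dl) * C.
  apply: (le_trans (enormD _ _)); rewrite !enormZ.
  by apply: lerD; apply: ler_pM; rewrite ?enorm_ge0.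
have H2 : enorm (k *: (a - a') + (k - k') *: a') <= 6 * C * dl +
    (3 * C * (2 * dl + 1 * (4 * dl)) + 2 * ((3 + 2 * C) * dl)).
  apply: (le_trans (enormD _ _)); rewrite !enormZ a1' mulr1.
  by apply: lerD => //; apply: ler_pM; rewrite ?enorm_ge0.
lra.
Qed.

End lipschitz.

(** As [rho] tends to 1, [quot_kappa] tends to [2 * dotp a b * (1/2)]: the limit is the tangential
    part of [b]. *)
Lemma cvg_normalize_quot (t_ : R^nat) a b : enorm a = 1 -> t_ @ \oo --> 0 ->
  forall i, normalize_quot (t_ k) a b 0 i @[k --> \oo] --> (b - dotp a b *: a) 0 i.
Proof.
move=> a1 tc i.
have rc : quot_rho (t_ k) a b @[k --> \oo] --> (1 : R).
  rewrite -a1; apply: cvg_enorm => j.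
  suff : (a 0 j + t_ k * b 0 j) @[k --> \oo] --> a 0 j + 0 * b 0 j.
    by rewrite mul0r addr0; under [in X in _ -> X]eq_fun do rewrite !mxE.
  by apply: cvgD; [exact: cvg_cst|apply: cvgM => //; exact: cvg_cst].
have rV : (quot_rho (t_ k) a b)^-1 @[k --> \oo] --> (1 : R)^-1 by apply: cvgV.
have qV : (1 + quot_rho (t_ k) a b)^-1 @[k --> \oo] --> (1 + 1 : R)^-1.
  by apply: cvgV; [rewrite gt_eqF|apply: cvgD => //; exact: cvg_cst].
under eq_fun do rewrite 4!mxE.
have -> : (b - dotp a b *: a) 0 i =
    1^-1 * b 0 i - ((2 * dotp a b + 0 * enorm b ^+ 2) * (1^-1 * (1 + 1)^-1)) * a 0 i.
  by rewrite !mxE; field.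
apply: cvgB; first by apply: cvgM => //; exact: cvg_cst.
apply: cvgM; last exact: cvg_cst.
apply: cvgM; last exact: cvgM.
by apply: cvgD; [exact: cvg_cst|apply: cvgM => //; exact: cvg_cst].
Qed.

End normalized_variation.

(** * Vector-valued maps and weighted p-energies on a measure space *)

Section measurable_vectors.
Context d (T : measurableType d) (R : realType) (N : nat).
Implicit Types f g : T -> 'rV[R]_N.

(** Coordinatewise, because the sigma-algebra attached to row vectors is the Lebesgue one and is too
    fine for a target space. *)
Definition measurable_vec f := forall i, measurable_fun [set: T] (fun x => f x 0 i).

Lemma measurable_vecB f g : measurable_vec f -> measurable_vec g ->
  measurable_vec (fun x => f x - g x).
Proof. by move=> mf mg i; under eq_fun do rewrite 2!mxE; exact: measurable_funB. Qed.

Lemma measurable_vecD f g : measurable_vec f -> measurable_vec g ->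
  measurable_vec (fun x => f x + g x).
Proof. by move=> mf mg i; under eq_fun do rewrite mxE; exact: measurable_funD. Qed.

Lemma measurable_vecZ (c : T -> R) f : measurable_fun [set: T] c -> measurable_vec f ->
  measurable_vec (fun x => c x *: f x).
Proof. by move=> mc mf i; under eq_fun do rewrite mxE; exact: measurable_funM. Qed.

Lemma measurable_vec_enorm f : measurable_vec f -> measurable_fun [set: T] (fun x => enorm (f x)).
Proof. by move=> mf; apply: (@measurable_enorm R N); exact: measurable_borelP. Qed.

Lemma measurable_dotp f g : measurable_vec f -> measurable_vec g ->
  measurable_fun [set: T] (fun x => dotp (f x) (g x)).
Proof. by move=> mf mg; apply: measurable_sum => i; exact: measurable_funM. Qed.

Lemma measurable_powR_comp (p : R) (f : T -> R) : measurable_fun [set: T] f ->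
  measurable_fun [set: T] (fun x => f x `^ p).
Proof.
by move=> mf; apply: (@measurableT_comp _ _ _ _ _ _ (fun y => y `^ p)); first exact: measurable_powR.
Qed.

Lemma measurable_grad (p : R) f : measurable_vec f -> measurable_vec (fun x => grad p (f x)).
Proof.
move=> mf; apply: measurable_vecZ => //; apply: measurable_powR_comp.
exact: measurable_vec_enorm.
Qed.

Lemma measurable_normalize f : measurable_vec f -> measurable_vec (fun x => normalize (f x)).
Proof.
move=> mf; apply: measurable_vecZ => //; apply: measurable_invr => [x|]; first exact: enorm_ge0.
exact: measurable_vec_enorm.
Qed.
End measurable_vectors.

Section weighted_energy.
Context d (T : measurableType d) (R : realType) (mu : {measure set T -> \bar R}) (N : nat).
Variables (p : R) (w : T -> R).
Hypotheses (mw : measurable_fun [set: T] w) (w0 : forall x, 0 <= w x).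

Lemma integrable_powR_enorm (f : T -> 'rV[R]_N) : measurable_vec f ->
  (\int[mu]_x (enorm (f x) `^ p * w x)%:E < +oo)%E ->
  mu.-integrable [set: T] (EFin \o (fun x => enorm (f x) `^ p * w x)).
Proof.
move=> mf fi; apply/integrableP; split.
  apply/measurable_EFinP; apply: measurable_funM => //; apply: measurable_powR_comp.
  exact: measurable_vec_enorm.
rewrite (eq_integral (fun x => (enorm (f x) `^ p * w x)%:E))// => x _.
by rewrite gee0_abs// lee_fin mulr_ge0// powR_ge0.
Qed.

(** By Cauchy-Schwarz and [young_powRB1] the integrand is at most the sum of the two energy
    densities. *)
Lemma integrable_dotp_grad (A D : T -> 'rV[R]_N) : 1 < p ->
  measurable_vec A -> measurable_vec D ->
  (\int[mu]_x (enorm (A x) `^ p * w x)%:E < +oo)%E ->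
  (\int[mu]_x (enorm (D x) `^ p * w x)%:E < +oo)%E ->
  mu.-integrable [set: T] (EFin \o (fun x => dotp (grad p (A x)) (D x) * w x)).
Proof.
move=> p1 mA mD iA iD.
have iAD := integrableD measurableT (integrable_powR_enorm mA iA) (integrable_powR_enorm mD iD).
apply: le_integrable iAD => //.
  apply/measurable_EFinP; apply: measurable_funM => //; apply: measurable_dotp => //.
  exact: measurable_grad.
move=> x _; rewrite /= lee_fin normrM (ger0_norm (w0 x)) -mulrDl.
rewrite [leRHS]ger0_norm; last by rewrite mulr_ge0// addr_ge0 ?powR_ge0.
apply: ler_wpM2r => //; apply: (le_trans (normr_dotp_le _ _)); rewrite enorm_grad//.
by apply: young_powRB1; rewrite ?enorm_ge0.
Qed.

End weighted_energy.

(** * First variation of the weighted energy *)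

Section first_variation.
Context d (T : measurableType d) (R : realType) (mu : {measure set T -> \bar R}) (N : nat).
Variables (p C : R) (a1 a2 b1 b2 : T -> 'rV[R]_N) (w : T -> R).
Hypotheses (p1 : 1 < p) (C0 : 0 <= C).
Hypotheses (ma1 : measurable_vec a1) (ma2 : measurable_vec a2)
  (mb1 : measurable_vec b1) (mb2 : measurable_vec b2).
Hypotheses (a11 : forall x, enorm (a1 x) = 1) (a21 : forall x, enorm (a2 x) = 1).
Hypotheses (b1C : forall x, enorm (b1 x) <= C) (b2C : forall x, enorm (b2 x) <= C).
Hypotheses (mw : measurable_fun [set: T] w) (w0 : forall x, 0 <= w x).
Hypothesis ia : (\int[mu]_x (enorm (a2 x - a1 x) `^ p * w x)%:E < +oo)%E.
Hypothesis ib : (\int[mu]_x (enorm (b2 x - b1 x) `^ p * w x)%:E < +oo)%E.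

Let energy_t (t : R) : \bar R := (\int[mu]_x
  (enorm (normalize (a2 x + t *: b2 x) - normalize (a1 x + t *: b1 x)) `^ p * w x)%:E)%E.

Definition tangent (a b : 'rV[R]_N) : 'rV[R]_N := b - dotp a b *: a.

Let sum_bound (W s u L t : R) : 0 <= u -> W - s <= t * (L * (s + u)) ->
  t * (L * (s + u)) <= L * (s + u) -> W + s <= (2 + L) * (s + u).
Proof. by move=> u0 H1 H2; lra. Qed.

Let quotE (x y t v : R) : t != 0 -> x * v = y * v + t * ((x - y) / t * v).
Proof. by move=> t0; field. Qed.

Let diff_quotient_of_affine (t x y I J : R) :
  t != 0 -> x = I + t * J -> y = I -> t^-1 *: (x - y) = J.
Proof. by move=> tn0 -> ->; rewrite (addrC I) addrK; exact: mulKf. Qed.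

(** Here [a1], [a2] are the values of a sphere-valued map at the two points of a pair, and [b1],
    [b2] those of the variation. The difference quotients converge pointwise to [p] times the
    integrand and are dominated, so the vanishing derivative of the energy is the integral of the
    limit. *)
Theorem first_variation : is_derive (0 : R) 1 (fun t : R => fine (energy_t t)) 0 ->
  Rintegral mu [set: T] (fun x =>
    dotp (grad p (a2 x - a1 x)) (tangent (a2 x) (b2 x) - tangent (a1 x) (b1 x)) * w x) = 0.
Proof.
move=> dE.
have p0 : 0 < p by exact: lt_trans p1.
have C10 : 0 < C + 1 by rewrite ltr_wpDl.
(* The factor [1 / (2 (C + 1))] ensures [t_ k <= 1] and [t_ k * C <= 1/2] for every [k], as the
   bounds on [normalize_quot] require. *)
pose t_ (k : nat) : R := (2 * (C + 1))^-1 * k.+1%:R^-1.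
have tpos k : 0 < t_ k by rewrite mulr_gt0// invr_gt0// mulr_gt0.
have k1 (k : nat) : k.+1%:R^-1 <= 1 :> R by rewrite invf_le1// ler1n.
have tC k : t_ k * C <= 2^-1.
  apply: (@le_trans _ _ ((2 * (C + 1))^-1 * C)).
    by apply: ler_wpM2r => //; rewrite ler_piMr// invr_ge0 mulr_ge0// ltW.
  rewrite invfM -mulrA ler_piMr// mulrC ler_pdivrMr// mul1r lerDl//.
have t1 k : t_ k <= 1.
  rewrite /t_ -[leRHS]mulr1; apply: ler_pM => //.
    by rewrite invr_ge0 mulr_ge0// ltW.
  by rewrite invf_le1 ?mulr_gt0//; move: (C0); lra.
have t00 : t_ @ \oo --> 0.
  by rewrite -(mulr0 (2 * (C + 1))^-1); apply: cvgM; [exact: cvg_cst|exact: cvg_harmonic].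
pose q1 k x := normalize_quot (t_ k) (a1 x) (b1 x).
pose q2 k x := normalize_quot (t_ k) (a2 x) (b2 x).
pose A x := a2 x - a1 x.
pose L := 8 + 32 * C.
have L0 : 0 <= L by rewrite addr_ge0// mulr_ge0.
have WE k x : normalize (a2 x + t_ k *: b2 x) - normalize (a1 x + t_ k *: b1 x) =
    A x + t_ k *: (q2 k x - q1 k x).
  have H1 := quot_rho_ge (ltW (tpos k)) (tC k) (a11 x) (b1C x).
  have H2 := quot_rho_ge (ltW (tpos k)) (tC k) (a21 x) (b2C x).
  have r1 : 0 < quot_rho (t_ k) (a1 x) (b1 x) by apply: lt_le_trans H1.
  have r2 : 0 < quot_rho (t_ k) (a2 x) (b2 x) by apply: lt_le_trans H2.
  rewrite (normalize_quotE (a11 x) r1) (normalize_quotE (a21 x) r2).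
  by rewrite (scalerBr (t_ k) (q2 k x) (q1 k x)) /A /q1 /q2 opprD addrACA.
have qL k x : enorm (q2 k x - q1 k x) <= L * (enorm (A x) + enorm (b2 x - b1 x)).
  exact: (normalize_quot_lipschitz (ltW (tpos k)) (t1 k) C0 (tC k)).
have mA : measurable_vec A by exact: measurable_vecB.
have mW k : measurable_vec (fun x => A x + t_ k *: (q2 k x - q1 k x)).
  move=> i; under eq_fun do rewrite -WE; apply: measurable_vecB; apply: measurable_normalize;
    by apply: measurable_vecD => //; apply: measurable_vecZ => //; exact: measurable_cst.
pose f k x := (enorm (A x + t_ k *: (q2 k x - q1 k x)) `^ p - enorm (A x) `^ p) / t_ k * w x.
pose F x := p * dotp (grad p (A x)) (tangent (a2 x) (b2 x) - tangent (a1 x) (b1 x)) * w x.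
(* With [s = |A|] and [u = |b2 - b1|], the perturbed norm [W] satisfies [W + s <= (2 + L)(s + u)]
   and [|W - s| <= t L (s + u)]. Then [powRB_le] gives all factors but [2^p], which comes from
   [powRD_le]. *)
pose c := p * (2 + L) `^ (p - 1) * L * 2 `^ p.
pose G x := c * (enorm (A x) `^ p * w x + enorm (b2 x - b1 x) `^ p * w x).
have fG k x : `|f k x| <= G x.
  set s := enorm (A x); set u := enorm (b2 x - b1 x).
  have su0 : 0 <= s + u by rewrite addr_ge0 ?enorm_ge0.
  rewrite /f normrM (ger0_norm (w0 x)) /G -mulrDl mulrA; apply: ler_wpM2r => //.
  rewrite normrM normfV (gtr0_norm (tpos k)) ler_pdivrMr//.
  set W := enorm (A x + _).
  have WA : `|W - s| <= t_ k * (L * (s + u)).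
    apply: (le_trans (enorm_dist _ _)); rewrite addrC addKr enormZ (gtr0_norm (tpos k)).
    by apply: ler_wpM2l; [exact: ltW|exact: qL].
  apply: (le_trans (powRB_le (enorm_ge0 _) (enorm_ge0 _) p1)).
  have Wsu : W + s <= (2 + L) * (s + u).
    have : t_ k * (L * (s + u)) <= L * (s + u) by rewrite ler_piMl// mulr_ge0.
    move: WA; rewrite ler_norml => /andP[_ H1] H2.
    exact: (sum_bound (enorm_ge0 _) H1 H2).
  apply: (@le_trans _ _ (p * ((2 + L) * (s + u)) `^ (p - 1) * (t_ k * (L * (s + u))))).
    apply: ler_pM => //; first by rewrite mulr_ge0 ?powR_ge0// ltW.
    apply: ler_wpM2l; first exact: ltW.
    have p10 : 0 <= p - 1 by rewrite subr_ge0 ltW.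
    apply: ge0_ler_powR => //; rewrite nnegrE; first by rewrite addr_ge0 ?enorm_ge0.
    by rewrite mulr_ge0// addr_ge0.
  rewrite powRM//; last by rewrite addr_ge0.
  have -> : p * ((2 + L) `^ (p - 1) * (s + u) `^ (p - 1)) * (t_ k * (L * (s + u))) =
     p * (2 + L) `^ (p - 1) * L * ((s + u) * (s + u) `^ (p - 1)) * t_ k by ring.
  rewrite mulr_powRB1// ler_wpM2r ?(ltW (tpos k))// /c -[leRHS]mulrA.
  apply: ler_wpM2l; first by rewrite !mulr_ge0 ?powR_ge0// ltW.
  by apply: powRD_le; rewrite ?enorm_ge0// ltW.
have iA := integrable_powR_enorm mw w0 mA ia.
have iB := integrable_powR_enorm mw w0 (measurable_vecB mb2 mb1) ib.
have iG : mu.-integrable [set: T] (EFin \o G).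
  exact: (integrableZl measurableT c (integrableD measurableT iA iB)).
have mpA : measurable_fun [set: T] (fun x => enorm (A x) `^ p).
  by apply: measurable_powR_comp; exact: measurable_vec_enorm.
have mf k : measurable_fun [set: T] (f k).
  apply: measurable_funM => //; apply: measurable_funM; last exact: measurable_cst.
  apply: measurable_funB; last exact: mpA.
  by apply: measurable_powR_comp; apply: measurable_vec_enorm; exact: mW.
have mtan (a b : T -> 'rV[R]_N) : measurable_vec a -> measurable_vec b ->
    measurable_vec (fun x => tangent (a x) (b x)).
  by move=> ma mb; apply: measurable_vecB => //; apply: measurable_vecZ => //; exact: measurable_dotp.
have mF : measurable_fun [set: T] F.
  apply: measurable_funM => //; apply: measurable_funM; first exact: measurable_cst.
  apply: measurable_dotp; first exact: measurable_grad.
  by apply: measurable_vecB; exact: mtan.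
have fF x : f k x @[k --> \oo] --> F x.
  have Q : ((enorm (A x + t_ k *: (q2 k x - q1 k x)) `^ p - enorm (A x) `^ p) / t_ k)
      @[k --> \oo] --> p * dotp (grad p (A x)) (tangent (a2 x) (b2 x) - tangent (a1 x) (b1 x)).
    apply: (cvg_diff_quotient p1 tpos t00) => i.
    have eB (v v' : 'rV[R]_N) : (v - v') 0 i = v 0 i - v' 0 i by rewrite !mxE.
    have c1 : q1 k x 0 i @[k --> \oo] --> tangent (a1 x) (b1 x) 0 i.
      exact: (cvg_normalize_quot (a11 x) t00).
    have c2 : q2 k x 0 i @[k --> \oo] --> tangent (a2 x) (b2 x) 0 i.
      exact: (cvg_normalize_quot (a21 x) t00).
    rewrite (_ : (fun k => _) = (fun k => q2 k x 0 i - q1 k x 0 i)).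
      by rewrite eB; exact: cvgB c2 c1.
    by apply/funext => k; rewrite eB.
  exact: (cvgM Q (cvg_cst (w x))).
have mf' k : measurable_fun [set: T] (fun x => (f k x)%:E) by exact/measurable_EFinP.
have mF' : measurable_fun [set: T] (fun x => (F x)%:E) by exact/measurable_EFinP.
have fF' x : (f k x)%:E @[k --> \oo] --> (F x)%:E.
  by apply: cvg_EFin; [exact: nearW|exact: fF].
have fG' x k : (`|(f k x)%:E| <= (EFin \o G) x)%E by rewrite /= lee_fin.
have [iF _ limF] := @dominated_convergence _ _ _ mu setT measurableT
  (fun k x => (f k x)%:E) (fun x => (F x)%:E) (EFin \o G)
  mf' mF' (aeW _ (fun x _ => fF' x)) iG (aeW _ (fun x k _ => fG' x k)).
have iF' : mu.-integrable [set: T] (EFin \o F) by [].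
have if_ k : mu.-integrable [set: T] (EFin \o f k).
  apply: le_integrable iG => //; first exact: mf'.
  by move=> x _; apply: (le_trans (fG' x k)); rewrite /= lee_fin ler_norm.
have normalize1 (a b : 'rV[R]_N) : enorm a = 1 -> normalize (a + 0 *: b) = a.
  by move=> e1; rewrite scale0r addr0 /normalize e1 invr1 scale1r.
(* The energy at time [t_ k] is the integral of [|A|^p w + t_ k * f k], which is integrable; so
   [fine] is applied to finite values and the quotient can be taken under the integral. *)
have fE k : (t_ k)^-1 *: (fine (energy_t (t_ k *: 1 + 0)) - fine (energy_t 0)) =
    Rintegral mu [set: T] (f k).
  have iW : mu.-integrable [set: T] (EFin \o (fun x => enorm (A x) `^ p * w x + t_ k * f k x)).
    exact: (integrableD measurableT iA (integrableZl measurableT (t_ k) (if_ k))).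
  have E1 : fine (energy_t (t_ k *: 1 + 0)) =
      Rintegral mu [set: T] (fun x => enorm (A x) `^ p * w x + t_ k * f k x).
    rewrite addr0 [_%:A]mulr1 /Rintegral; congr fine; apply: eq_integral => x _.
    rewrite WE /f; congr EFin.
    by apply: quotE; rewrite gt_eqF.
  have E0 : fine (energy_t 0) = Rintegral mu [set: T] (fun x => enorm (A x) `^ p * w x).
    have Ef : (fun x => (enorm (normalize (a2 x + 0 *: b2 x) -
        normalize (a1 x + 0 *: b1 x)) `^ p * w x)%:E) = (fun x => (enorm (A x) `^ p * w x)%:E).
      by apply/funext => x; rewrite (normalize1 _ _ (a21 x)) (normalize1 _ _ (a11 x)).
    by rewrite /energy_t Ef.
  have if1 : mu.-integrable [set: T] (EFin \o (fun x => t_ k * f k x)).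
    exact: (integrableZl measurableT (t_ k) (if_ k)).
  have E2 : Rintegral mu [set: T] (fun x => enorm (A x) `^ p * w x + t_ k * f k x) =
      Rintegral mu [set: T] (fun x => enorm (A x) `^ p * w x) + t_ k * Rintegral mu [set: T] (f k).
    by rewrite (RintegralD measurableT iA if1) (RintegralZl (t_ k) measurableT (if_ k)).
  exact: (diff_quotient_of_affine (lt0r_neq0 (tpos k)) (etrans E1 E2) E0).
have lim0 : Rintegral mu [set: T] (f k) @[k --> \oo] --> (0 : R).
  under eq_fun do rewrite -fE.
  have [dE1 dE2] := dE.
  have H : (fun h : R => h^-1 *: (fine (energy_t (h *: 1 + 0)) - fine (energy_t 0))) @ 0^' --> (0 : R).
    by rewrite -[X in _ --> X]dE2; exact: dE1.
  move/cvgr_dnbhsP : H; apply; split => // k; exact: lt0r_neq0.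
have limF' : Rintegral mu [set: T] (f k) @[k --> \oo] --> Rintegral mu [set: T] F.
  by apply: fine_cvg; rewrite fineK//; exact: integrable_fin_num iF'.
have F0 : Rintegral mu [set: T] F = 0 by exact: (cvg_unique _ limF' lim0).
pose H x := dotp (grad p (a2 x - a1 x)) (tangent (a2 x) (b2 x) - tangent (a1 x) (b1 x)) * w x.
have iH : mu.-integrable [set: T] (EFin \o H).
  apply: eq_integrable (integrableZl measurableT p^-1 iF') => // x _ /=.
  by congr EFin; rewrite /F /H -mulrA mulKf// gt_eqF.
have : p * Rintegral mu [set: T] H = 0.
  rewrite -(RintegralZl p measurableT iH) -[RHS]F0; apply: eq_Rintegral => x _.
  by rewrite /F /H mulrA.
move/eqP; rewrite mulf_eq0 (gt_eqF p0) orFb => /eqP; exact.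
Qed.

End first_variation.

(** * Weak limits *)

(** Where [f] exceeds [a / delta] one has [a < delta * f], and the product is at most
    [delta^(p-1) f^p]; elsewhere the minimum is [f] itself. *)
Lemma powRB1_mul_le (R : realType) (a f delta p : R) : 0 <= a -> 0 <= f -> 0 < delta -> 1 < p ->
  a `^ (p - 1) * f <= a `^ (p - 1) * Num.min f (a / delta) + delta `^ (p - 1) * f `^ p.
Proof.
move=> a0 f0 d0 p1.
have [fa|af] := leP f (a / delta).
  by rewrite lerDl mulr_ge0// powR_ge0.
rewrite -[leLHS]add0r; apply: lerD.
  by rewrite mulr_ge0 ?powR_ge0// divr_ge0// ltW.
have p0 : p != 0 by rewrite gt_eqF// (lt_trans _ p1).
rewrite -(mulr_powRB1 f0 (lt_trans ltr01 p1)) mulrCA [leRHS]mulrC -powRM//; last exact: ltW.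
apply: ler_wpM2r => //; apply: ge0_ler_powR; rewrite ?subr_ge0 ?nnegrE ?(ltW p1)//.
  by rewrite mulr_ge0// ltW.
by rewrite mulrC -ler_pdivrMr// ltW.
Qed.

Section weak_limit.
Context d (T : measurableType d) (R : realType) (mu : {measure set T -> \bar R}) (N : nat).
Variables (p : R) (w : T -> R).
Hypotheses (p1 : 1 < p) (mw : measurable_fun [set: T] w) (w0 : forall x, 0 <= w x).
Variables (A D : T -> 'rV[R]_N) (D_ : nat -> T -> 'rV[R]_N) (C : R).
Hypotheses (mA : measurable_vec A) (mD : measurable_vec D) (mD_ : forall k, measurable_vec (D_ k)).
Hypothesis iA : (\int[mu]_x (enorm (A x) `^ p * w x)%:E < +oo)%E.
Hypothesis iD : (\int[mu]_x (enorm (D x) `^ p * w x)%:E < +oo)%E.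
Hypothesis iD_ : forall k, (\int[mu]_x (enorm (D_ k x) `^ p * w x)%:E <= C%:E)%E.
Hypothesis D_D : {ae mu, forall x, forall i, D_ k x 0 i @[k --> \oo] --> D x 0 i}.
Hypothesis orthD_ : forall k, Rintegral mu [set: T] (fun x => dotp (grad p (A x)) (D_ k x) * w x) = 0.

Let f k x := enorm (D_ k x - D x).
Let K := 2 `^ p * (C + Rintegral mu [set: T] (fun x => enorm (D x) `^ p * w x)).

Let powR_f_le k x : f k x `^ p <= 2 `^ p * (enorm (D_ k x) `^ p + enorm (D x) `^ p).
Proof.
have p0 : 0 <= p by rewrite ltW// (lt_trans _ p1).
apply: le_trans (powRD_le (enorm_ge0 _) (enorm_ge0 _) p0).
apply: ge0_ler_powR; rewrite ?nnegrE ?addr_ge0 ?enorm_ge0//.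
exact: enormB_le.
Qed.

Let iD_oo k : (\int[mu]_x (enorm (D_ k x) `^ p * w x)%:E < +oo)%E.
Proof. by apply: (le_lt_trans (iD_ k)); rewrite ltry. Qed.

Let mf k : measurable_fun [set: T] (f k).
Proof. by apply: measurable_vec_enorm; exact: measurable_vecB. Qed.

Let mfp k : measurable_fun [set: T] (fun x => f k x `^ p * w x).
Proof. by apply: measurable_funM => //; exact: measurable_powR_comp. Qed.

Let integrable_bound k : mu.-integrable [set: T]
  (EFin \o (fun x => 2 `^ p * (enorm (D_ k x) `^ p * w x + enorm (D x) `^ p * w x))).
Proof.
have i1 := integrable_powR_enorm mw w0 (mD_ k) (iD_oo k).
have i2 := integrable_powR_enorm mw w0 mD iD.
exact: (integrableZl measurableT (2 `^ p) (integrableD measurableT i1 i2)).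
Qed.

Let f_bound k x : f k x `^ p * w x <= 2 `^ p * (enorm (D_ k x) `^ p * w x + enorm (D x) `^ p * w x).
Proof. by rewrite -mulrDl mulrA; apply: ler_wpM2r => //; exact: powR_f_le. Qed.

Let fw_ge0 k x : 0 <= f k x `^ p * w x.
Proof. by rewrite mulr_ge0// powR_ge0. Qed.

Let integrable_fp k : mu.-integrable [set: T] (EFin \o (fun x => f k x `^ p * w x)).
Proof.
apply: le_integrable (integrable_bound k) => //; first by apply/measurable_EFinP.
move=> x _; rewrite /= lee_fin (ger0_norm (fw_ge0 k x)).
exact: le_trans (f_bound k x) (ler_norm _).
Qed.

Let Rintegral_fp_le k : Rintegral mu [set: T] (fun x => f k x `^ p * w x) <= K.
Proof.
have i1 := integrable_powR_enorm mw w0 (mD_ k) (iD_oo k).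
have i2 := integrable_powR_enorm mw w0 mD iD.
apply: (le_trans (le_Rintegral measurableT (integrable_fp k) (integrable_bound k) _)).
  by move=> x _; exact: f_bound.
rewrite (RintegralZl (2 `^ p) measurableT (integrableD measurableT i1 i2)).
rewrite (RintegralD measurableT i1 i2) ler_wpM2l ?powR_ge0// lerD2r.
by rewrite -lee_fin -integral_Rintegral.
Qed.

(** The pairing with the error cut off at [|A| / delta]. It is dominated by [|A|^p w / delta], so
    for fixed [delta] dominated convergence applies although the errors are merely bounded in
    L^p. *)
Let m delta k x := enorm (A x) `^ (p - 1) * Num.min (f k x) (enorm (A x) / delta) * w x.

Let mmin delta k : measurable_fun [set: T] (m delta k).
Proof.
apply: measurable_funM => //; apply: measurable_funM.
  by apply: measurable_powR_comp; exact: measurable_vec_enorm.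
apply: measurable_minr => //; apply: measurable_funM; last exact: measurable_cst.
exact: measurable_vec_enorm.
Qed.

Let m_ge0 delta k x : 0 < delta -> 0 <= m delta k x.
Proof.
move=> d0; rewrite !mulr_ge0 ?powR_ge0// le_min enorm_ge0 divr_ge0 ?enorm_ge0// ltW//.
Qed.

Let m_le delta k x : 0 < delta -> m delta k x <= delta^-1 * (enorm (A x) `^ p * w x).
Proof.
move=> d0; rewrite mulrA; apply: ler_wpM2r => //.
rewrite -(mulr_powRB1 (enorm_ge0 _) (lt_trans ltr01 p1)) mulrA mulrC.
by apply: ler_wpM2r; rewrite ?powR_ge0// mulrC ge_min lexx orbT.
Qed.

Let iAw delta : mu.-integrable [set: T] (EFin \o (fun x => delta^-1 * (enorm (A x) `^ p * w x))).
Proof. exact: (integrableZl measurableT delta^-1 (integrable_powR_enorm mw w0 mA iA)). Qed.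

Let im delta k : 0 < delta -> mu.-integrable [set: T] (EFin \o m delta k).
Proof.
move=> d0; apply: le_integrable (iAw delta) => //; first exact/measurable_EFinP.
move=> x _; rewrite /= lee_fin ger0_norm ?m_ge0//.
exact: le_trans (m_le k x d0) (ler_norm _).
Qed.

Let cvg_m delta : 0 < delta -> Rintegral mu [set: T] (m delta k) @[k --> \oo] --> (0 : R).
Proof.
move=> d0.
have m1 k : measurable_fun [set: T] (fun x => (m delta k x)%:E) by exact/measurable_EFinP.
have m2 : measurable_fun [set: T] (fun=> 0%E : \bar R) by exact: measurable_cst.
have c1 : {ae mu, forall x, [set: T] x -> (m delta k x)%:E @[k --> \oo] --> 0%E}.
  apply: filterS D_D => x Hx _.
  have f0 : f k x @[k --> \oo] --> (0 : R).
    suff : f k x @[k --> \oo] --> enorm (0 : 'rV[R]_N) by rewrite enorm0.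
    apply: cvg_enorm => i.
    rewrite mxE (_ : (fun k => _) = (fun k => D_ k x 0 i - D x 0 i)); last first.
      by apply/funext => k; rewrite !mxE.
    by rewrite -(subrr (D x 0 i)); apply: cvgB => //; exact: cvg_cst.
  have mn0 : Num.min (f k x) (enorm (A x) / delta) @[k --> \oo] --> (0 : R).
    apply: (squeeze_cvgr _ (cvg_cst 0) f0); apply: nearW => k; rewrite le_min enorm_ge0 divr_ge0 ?enorm_ge0 ?(ltW d0)//=.
    by rewrite ge_min lexx.
  apply: cvg_EFin; first exact: nearW.
  have := cvgM (cvgM (cvg_cst (enorm (A x) `^ (p - 1))) mn0) (cvg_cst (w x)).
  rewrite mulr0 mul0r; exact.
have c2 : {ae mu, forall x k, [set: T] x -> (`|(m delta k x)%:E| <=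
    (EFin \o (fun x => (delta^-1 * (enorm (A x) `^ p * w x))%R)) x)%E}.
  by apply: aeW => x k _; rewrite /= lee_fin ger0_norm ?m_ge0//; exact: m_le.
have [_ _ lim] := @dominated_convergence _ _ _ mu setT measurableT
  (fun k x => (m delta k x)%:E) (fun=> 0%E) _ m1 m2 c1 (iAw delta) c2.
apply: fine_cvg; move: lim; rewrite integral0; exact.
Qed.

(** As the pairings with [D_ k] vanish, [|J|] is at most the pairing of [|A|^(p-1)] with
    [|D_ k - D|], hence at most the integral of [m delta k] plus [delta^(p-1) K], where [K] bounds
    the p-energy of [D_ k - D] for all [k]. Let [k] tend to infinity, then [delta] to 0. *)
Lemma weak_limit : Rintegral mu [set: T] (fun x => dotp (grad p (A x)) (D x) * w x) = 0.
Proof.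
set J := Rintegral _ _ _.
have p10 : 0 < p - 1 by rewrite subr_gt0.
have iJ := integrable_dotp_grad mw w0 p1 mA mD iA iD.
have iJ_ k := integrable_dotp_grad mw w0 p1 mA (mD_ k) iA (iD_oo k).
have J_le delta k : 0 < delta ->
    `|J| <= Rintegral mu [set: T] (m delta k) + delta `^ (p - 1) * K.
  move=> d0.
  have iB := integrableB measurableT (iJ_ k) iJ.
  have JE : - J = Rintegral mu [set: T] (fun x => dotp (grad p (A x)) (D_ k x) * w x -
      dotp (grad p (A x)) (D x) * w x).
    by rewrite (RintegralB measurableT (iJ_ k) iJ) orthD_ sub0r.
  have ifd := integrableZl measurableT (delta `^ (p - 1)) (integrable_fp k).
  have isum := integrableD measurableT (im k d0) ifd.
  rewrite -normrN JE; apply: (le_trans (le_normr_Rintegral measurableT iB)).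
  apply: (@le_trans _ _ (Rintegral mu [set: T]
      (fun x => m delta k x + delta `^ (p - 1) * (f k x `^ p * w x)))).
    apply: (le_Rintegral measurableT (integrable_norm iB) isum) => x _ /=.
    rewrite -mulrBl -dotpBr normrM (ger0_norm (w0 x)) mulrA -mulrDl; apply: ler_wpM2r => //.
    apply: (le_trans (normr_dotp_le _ _)); rewrite enorm_grad//.
    by apply: powRB1_mul_le => //; exact: enorm_ge0.
  rewrite (RintegralD measurableT (im k d0) ifd).
  rewrite (RintegralZl (delta `^ (p - 1)) measurableT (integrable_fp k)) lerD2l.
  by apply: ler_wpM2l (Rintegral_fp_le k); exact: powR_ge0.
have cvg_ge (v_ : R^nat) l x : v_ @ \oo --> l -> (forall k, x <= v_ k) -> x <= l.
  move=> vl xv; rewrite -(cvg_lim _ vl)//; apply: limr_ge; last exact: nearW.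
  by apply/cvg_ex; exists l.
have J_le' delta : 0 < delta -> `|J| <= 0 + delta `^ (p - 1) * K.
  move=> d0; apply: (cvg_ge (fun k => Rintegral mu [set: T] (m delta k) + delta `^ (p - 1) * K)).
    by apply: cvgD; [exact: cvg_m|exact: cvg_cst].
  by move=> k; exact: J_le.
apply/eqP; rewrite -normr_le0 -[leRHS](mul0r K).
apply: (cvg_ge (fun k : nat => (k.+1%:R^-1 : R) `^ (p - 1) * K)).
  apply: cvgM; last exact: cvg_cst.
  apply: cvg_powR0 => //; last exact: cvg_harmonic.
by move=> k; rewrite -[leRHS]add0r; apply: J_le'; rewrite invr_gt0.
Qed.
End weak_limit.

(** * Borel representatives *)

Section outer_hull.
Context d (T : measurableType d) (R : realType) (mu : {measure set T -> \bar R}).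
Local Open Scope ereal_scope.

(** Intersect countable measurable covers of [X] whose total measures exceed the outer measure by at
    most [1 / (k + 1)]. *)
Lemma mu_ext_hull (X : set T) : mu_ext mu X < +oo ->
  exists G, [/\ measurable G, X `<=` G & mu G = mu_ext mu X].
Proof.
move=> Xoo.
have Xfin : mu_ext mu X \is a fin_num by rewrite ge0_fin_numE// mu_ext_ge0.
have /choice[A HA] (k : nat) : exists A : (set T)^nat, measurable_cover X A /\
    \sum_(0 <= j <oo) mu (A j) < mu_ext mu X + k.+1%:R^-1%:E.
  have k0 : (0 < k.+1%:R^-1 :> R)%R by rewrite invr_gt0.
  by have [_/= [A XA] <-] := lb_ereal_inf_adherent k0 Xfin; exists A.
have mA k j : measurable (A k j) by have [[/(_ j)]] := HA k.
have XA k : X `<=` \bigcup_j A k j by have [[]] := HA k.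
pose G := \bigcap_k \bigcup_j A k j.
have mG : measurable G by apply: bigcapT_measurable => k; exact: bigcupT_measurable.
have XG : X `<=` G by exact: sub_bigcap.
exists G; split => //; apply/eqP; rewrite eq_le; apply/andP; split.
  apply/lee_addgt0Pr => _/posnumP[e]; near \oo => k.
  apply: (@le_trans _ _ (\sum_(0 <= j <oo) mu (A k j))).
    apply: measure_sigma_subadditive => //; exact: bigcap_inf.
  apply: (le_trans (ltW (HA k).2)); rewrite leeD// lee_fin ltW//.
  by near: k; apply: near_infty_natSinv_lt.
by rewrite -(measurable_mu_extE mu mG); exact: le_mu_ext.
Unshelve. all: by end_near. Qed.

End outer_hull.

Section borel_version.
Context {R : realType} {n : nat}.
Local Notation B := (borel_rV R n).
Local Notation leb := (@lebesgue_rV R n).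
Local Notation m := (@borel_measure R n).
Local Open Scope ereal_scope.

Lemma borel_hull (A : set 'rV[R]_n) : leb A < +oo ->
  exists G : set B, [/\ measurable G, A `<=` G & m G = leb A].
Proof.
move=> /mu_ext_hull[G [mG AG GE]]; exists (tuple_of_borel @^-1` G); split.
- by rewrite -[X in measurable X]setTI; exact: measurable_tuple_of_borel.
- by move=> x Ax; apply: AG; rewrite /= -[X in A X](tuple_of_borelK x) in Ax.
- rewrite [RHS](_ : _ = lebesgue_tuple G)//; congr lebesgue_tuple.
  by apply/seteqP; split => t /=; rewrite borel_of_tupleK.
Qed.

Lemma lebesgue_rV_complete : measure_is_complete leb.
Proof.
move=> A [/= N [mN N0 AN]].
apply: (@measure_is_complete_caratheodory _ _ (mu_ext (@lebesgue_tuple R n))).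
exists (rV_of_tuple @^-1` N); split => //.
by move=> t /= /AN.
Qed.

Lemma borel_null_hull (A : set 'rV[R]_n) : leb.-negligible A ->
  exists G : set B, [/\ measurable G, A `<=` G & m G = 0].
Proof.
move=> [N [mN N0 AN]]; have [|G [mG NG GE]] := @borel_hull N; first by rewrite N0.
by exists G; split => //; [exact: subset_trans NG|rewrite GE].
Qed.

Let null_bigcup (N : nat -> set B) : (forall k, measurable (N k)) ->
  (forall k, m (N k) = 0) -> m (\bigcup_k N k) = 0.
Proof.
move=> mN N0; apply: measure_negligible; first exact: bigcupT_measurable.
by apply: negligible_bigcup => k; apply/negligibleP; [exact: mN|exact: N0].
Qed.

(** If [A] has finite measure, a Borel hull exceeds it by a null set, which is itself inside a Borel
    null set. The general case exhausts [A] by pieces of finite measure. *)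
Lemma borel_modification (A : set 'rV[R]_n) : measurable A ->
  exists E N : set B, [/\ measurable E, measurable N, m N = 0 & A `\` N = E `\` N].
Proof.
have fin (A' : set 'rV[R]_n) : measurable A' -> leb A' < +oo ->
    exists E N : set B, [/\ measurable E, measurable N, m N = 0 & A' `\` N = E `\` N].
  move=> mA' A'oo; have [G [mG AG GE]] := borel_hull A'oo.
  have mG' : measurable (G : set 'rV[R]_n).
    by rewrite -[X in measurable X]setTI; exact: measurable_rV_borel.
  have GE' : leb (G : set 'rV[R]_n) = leb A' by rewrite -GE; exact: lebesgue_rV_borel.
  have GA0 : leb ((G : set 'rV[R]_n) `\` A') = 0.
    have GA : (G : set 'rV[R]_n) `&` A' = A' by apply/seteqP; split => x; [case|move=> Ax; split => //; exact: AG].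
    have H : leb ((G : set 'rV[R]_n) `\` A') = leb (G : set 'rV[R]_n) - leb ((G : set 'rV[R]_n) `&` A').
      by apply: measureD => //; have : leb (G : set 'rV[R]_n) < +oo by rewrite GE'.
    by rewrite H GA GE' subee// ge0_fin_numE.
  have [|N [mN AN N0]] := @borel_null_hull (G `\` A').
    by exists (G `\` A'); split => //; exact: measurableD.
  exists G, N; split => //; apply/seteqP; split => x [H1 H2]; split => //; first exact: AG.
  by apply: contrapT => H3; apply: H2; exact: AN.
move=> mA; have [F FT mF] := sigma_finiteT leb.
have /choice[E /choice[N HEN]] (k : nat) : exists E N : set B,
    [/\ measurable E, measurable N, m N = 0 & (A `&` F k) `\` N = E `\` N].
  have [mFk Fkoo] := mF k; apply: fin; first exact: measurableI.
  by apply: le_lt_trans Fkoo; apply: le_measure; rewrite ?inE//; exact: measurableI.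
exists (\bigcup_k E k), (\bigcup_k N k); split.
- by apply: bigcupT_measurable => k; have [] := HEN k.
- by apply: bigcupT_measurable => k; have [] := HEN k.
- by apply: null_bigcup => k; have [_ mNk Nk0 _] := HEN k.
- apply/seteqP; split => x [H1 H2]; split => //.
    have [k _ Fkx] : (\bigcup_k F k) x by rewrite -FT.
    exists k => //; have [_ _ _ /seteqP[+ _]] := HEN k => /(_ x) [] //.
    by split => // Nx; apply: H2; exists k.
  move: H1 => [k _ Ekx]; have [_ _ _ /seteqP[_]] := HEN k => /(_ x) [] //.
    by split => // Nx; apply: H2; exists k.
  by case.
Qed.

(** The modification is applied to the superlevel sets [f > q] for rational [q], and the countably
    many null sets are united. Off their union, [f > r] is the union of the Borel sets [E q] over
    [q > r]. *)
Lemma borel_version (Omega : set 'rV[R]_n) (f : 'rV[R]_n -> R) : open Omega ->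
  measurable_fun Omega f ->
  exists N : set B, [/\ measurable N, m N = 0 &
    measurable_fun ((Omega : set B) `\` N) (f : B -> R)].
Proof.
move=> oO mf.
have mOB : measurable (Omega : set B) by exact: open_borel_measurable.
have mO : measurable Omega by rewrite -[X in measurable X]setTI; exact: measurable_rV_borel.
have /choice[E /choice[N HEN]] (q : rat) : exists E N : set B,
    [/\ measurable E, measurable N, m N = 0 &
        (Omega `&` f @^-1` `]ratr q, +oo[%classic) `\` N = E `\` N].
  by apply: borel_modification; apply: mf => //; exact: measurable_itv.
have mN : measurable (\bigcup_q N q) by apply: bigcupT_measurable_rat => q; have [] := HEN q.
exists (\bigcup_q N q); split => //.
  have [F surjF] : exists F : nat -> rat, forall q, exists k, F k = q.
    exists (fun k => odflt 0%R (unpickle k)) => q; exists (pickle q).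
    by rewrite pickleK.
  rewrite (_ : \bigcup_q N q = \bigcup_k N (F k)); last first.
    apply/seteqP; split => x [q _ Nx]; last by exists (F q).
    by have [k kq] := surjF q; exists k => //; rewrite kq.
  by apply: (@null_bigcup (N \o F)) => k /=; have [_ mNk Nk0 _] := HEN (F k).
move=> mD; apply: (measurability _ (@RGenOInfty.measurableE R)) => // _ [_ [r ->] <-].
rewrite (_ : _ `&` _ = \bigcup_(q : rat) (if (r < ratr q)%R then E q `\` \bigcup_q N q else set0)).
  apply: bigcupT_measurable_rat => q; case: ifP => // _.
  by apply: measurableD => //; have [] := HEN q.
apply/seteqP; split => x /=.
  move=> [[Ox Nx]]; rewrite in_itv/= andbT => /rat_in_itvoo[q].
  rewrite in_itv/= => /andP[rq qf]; exists q => //; rewrite rq; split => //.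
  have [_ _ _ /seteqP[+ _]] := HEN q => /(_ x) [] //; split.
    by split => //=; rewrite in_itv/= andbT.
  by move=> Nqx; apply: Nx; exists q.
move=> [q _]; case: ifP => // rq [Eqx Nx].
have [_ _ _ /seteqP[_]] := HEN q => /(_ x) [].
  by split => // Nqx; apply: Nx; exists q.
move=> [Ox]; rewrite /= in_itv/= andbT => qf _; split => //.
by rewrite in_itv/= andbT; exact: lt_trans qf.
Qed.
End borel_version.

(** * Transfer of integrals from Lebesgue to Borel measure *)

Section iterated_integral.
Context {R : realType} {n : nat}.
Local Notation B := (borel_rV R n).
Local Notation leb := (@lebesgue_rV R n).
Local Notation m := (@borel_measure R n).
Local Open Scope ereal_scope.

Lemma integral_lebesgue_rV (f : B -> \bar R) : measurable_fun [set: B] f ->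
  \int[leb]_x f x = \int[m]_x f x.
Proof.
move=> mf; rewrite integralE [RHS]integralE.
rewrite (ge0_integral_lebesgue_rV (measurable_funepos mf))//.
by rewrite (ge0_integral_lebesgue_rV (measurable_funeneg mf)).
Qed.

Lemma measurable_lebesgue_borel (A : set B) : measurable A -> measurable (A : set 'rV[R]_n).
Proof. by move=> mA; rewrite -[X in measurable X]setTI; exact: measurable_rV_borel. Qed.

(** The measurability of [f] comes from completeness of Lebesgue measure, as [f] agrees almost
    everywhere on Omega with the Borel function [g]. *)
Lemma integral_ae_borel (Omega : set 'rV[R]_n) (N : set B) (f : 'rV[R]_n -> \bar R) (g : B -> \bar R) :
  measurable Omega -> measurable N -> m N = 0 -> measurable_fun [set: B] g ->
  (forall x, Omega x -> ~ N x -> f x = g x) -> (forall x, ~ Omega x -> g x = 0) ->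
  \int[leb]_(x in Omega) f x = \int[m]_x g x.
Proof.
move=> mO mN N0 mg fg g0.
have mg1 : measurable_fun [set: 'rV[R]_n] (g : 'rV[R]_n -> \bar R).
  exact: measurableT_comp mg measurable_rV_borel.
have mgO : measurable_fun Omega (g : 'rV[R]_n -> \bar R) by exact: measurable_funTS.
have gf : ae_eq leb Omega (g : 'rV[R]_n -> \bar R) f.
  exists (N : set 'rV[R]_n); split; first exact: measurable_lebesgue_borel.
    by rewrite -N0; exact: lebesgue_rV_borel.
  move=> x /= H; apply: contrapT => Nx; apply: H => Ox; exact/esym/fg.
have mf : measurable_fun Omega f by exact: (ae_measurable_fun (@lebesgue_rV_complete R n) gf mgO).
rewrite -(@ae_eq_integral _ _ _ leb Omega f g mO mgO mf gf) -(integral_lebesgue_rV mg) integral_mkcond.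
apply: eq_integral => x _; rewrite patchE; case: ifPn => //.
by rewrite notin_setE => /g0.
Qed.

(** The same null set is discarded in the inner integral for each good [y], and then in the outer
    one. Working in one variable at a time avoids any completion of the product measure. *)
Lemma iterated_integral_borel (Omega : set 'rV[R]_n) (N : set B)
    (f : 'rV[R]_n -> 'rV[R]_n -> \bar R) (g : B * B -> \bar R) :
  measurable Omega -> measurable N -> m N = 0 -> measurable_fun [set: B * B] g ->
  measurable_fun [set: B] (fun y => \int[m]_x g (y, x)) ->
  (forall y x, Omega y -> ~ N y -> Omega x -> ~ N x -> f y x = g (y, x)) ->
  (forall y x, ~ (Omega y /\ Omega x) -> g (y, x) = 0) ->
  \int[leb]_(y in Omega) \int[leb]_(x in Omega) f y x = \int[m]_y \int[m]_x g (y, x).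
Proof.
move=> mO mN N0 mg mF fg g0.
apply: (integral_ae_borel mO mN N0 mF) => [y Oy Ny|y Oy].
  apply: (integral_ae_borel mO mN N0) => [|x Ox Nx|x Ox].
  - by apply: measurableT_comp => //; exact: measurable_pair1.
  - exact: fg.
  - by apply: g0; case.
by rewrite integral0_eq// => x _; apply: g0; case.
Qed.

End iterated_integral.

Section borel_sphere_map.
Context {R : realType} {n N : nat}.
Local Notation B := (borel_rV R n).
Local Notation leb := (@lebesgue_rV R n).
Local Notation m := (@borel_measure R n).

(** Off the good set the value is a fixed unit vector, so that [enorm (u0 x) = 1] holds at every
    point; [i0] provides this vector. *)
Lemma borel_sphere_map (i0 : 'I_N) (Omega : set 'rV[R]_n) (u : 'rV[R]_n -> 'rV[R]_N) :
  open Omega -> (forall i, measurable_fun Omega (fun x => u x 0 i)) ->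
  {ae leb, forall x, Omega x -> enorm (u x) = 1} ->
  exists (Z : set B) (u0 : B -> 'rV[R]_N), [/\ measurable Z, m Z = 0%E,
    measurable_vec u0, forall x, enorm (u0 x) = 1 &
    forall x, Omega x -> ~ Z x -> u0 x = u x].
Proof.
move=> oO mu u1.
have /choice[Z HZ] (i : 'I_N) := borel_version oO (mu i).
have [Z1 [mZ1 Z1u Z10]] := borel_null_hull u1.
pose Z' := Z1 `|` \big[setU/set0]_(i < N) Z i.
have mZ' : measurable Z'.
  by apply: measurableU => //; apply: bigsetU_measurable => i _; have [] := HZ i.
have Z'0 : m Z' = 0%E.
  apply: measure_negligible => //; apply: negligibleU; first exact/negligibleP.
  apply: (big_ind (fun A : set B => m.-negligible A)).
  - exact: negligible_set0.
  - by move=> A A'; exact: negligibleU.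
  - by move=> i _; have [mZi Zi0 _] := HZ i; exact/negligibleP.
pose D : set B := (Omega : set B) `\` Z'.
have mD : measurable D by apply: measurableD => //; exact: open_borel_measurable.
exists Z', (fun x => if x \in D then u x else delta_mx 0 i0); split => //.
- move=> i.
  rewrite (_ : (fun x => _) = (fun x => if x \in D then u x 0 i else (delta_mx 0 i0 : 'rV[R]_N) 0 i)); last first.
    by apply/funext => x; case: ifP.
  apply: measurable_fun_if => //.
  + by apply: (measurable_fun_bool true); rewrite setTI preimage_mem_true.
  + rewrite setTI preimage_mem_true; have [mZi Zi0 mui] := HZ i.
    apply: measurable_funS mui; first by apply: measurableD => //; exact: open_borel_measurable.
    move=> x [Ox Zx]; split => // Zix; apply: Zx; right.
    by rewrite -bigcup_seq; exists i => //=; rewrite mem_index_enum.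
- move=> x; case: ifPn => [|_]; last exact: enorm_delta.
  rewrite inE => -[Ox Zx]; apply: contrapT => ux; apply: Zx; left; apply: Z1u => /= H.
  by apply: ux; exact: H.
- by move=> x Ox Zx; rewrite mem_set.
Qed.
End borel_sphere_map.

Section integral_facts.
Context d (T : measurableType d) (R : realType) (mu : {measure set T -> \bar R}).

Lemma ge0_integral_le_combination (f g h : T -> R) (c a b : R) :
  measurable_fun [set: T] f -> measurable_fun [set: T] g -> measurable_fun [set: T] h ->
  (forall x, 0 <= f x) -> (forall x, 0 <= g x) -> (forall x, 0 <= h x) ->
  0 <= c -> 0 <= a -> 0 <= b -> (forall x, f x <= c * (a * g x + b * h x)) ->
  (\int[mu]_x (f x)%:E <=
    c%:E * (a%:E * \int[mu]_x (g x)%:E + b%:E * \int[mu]_x (h x)%:E))%E.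
Proof.
move=> mf mg mh f0 g0 h0 c0 a0 b0 fgh.
have mZ (k : R) (F : T -> R) : measurable_fun [set: T] F ->
    measurable_fun [set: T] (fun x => (k * F x)%:E).
  by move=> mF; apply/measurable_EFinP; apply: measurable_funM => //; exact: measurable_cst.
have iZ (k : R) (F : T -> R) : measurable_fun [set: T] F -> (forall x, 0 <= F x) -> 0 <= k ->
    (\int[mu]_x (k * F x)%:E = k%:E * \int[mu]_x (F x)%:E)%E.
  move=> mF F0 k0; rewrite -ge0_integralZl_EFin//; first by move=> x _; rewrite lee_fin.
  exact/measurable_EFinP.
rewrite -(iZ a)// -(iZ b)// -ge0_integralD//; first last.
- exact: mZ.
- by move=> x _; rewrite lee_fin mulr_ge0.
- exact: mZ.
- by move=> x _; rewrite lee_fin mulr_ge0.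
rewrite -ge0_integralZl_EFin//; first last.
- by apply: emeasurable_funD; exact: mZ.
- by move=> x _; rewrite -EFinD lee_fin addr_ge0// mulr_ge0.
apply: ge0_le_integral => //.
- by move=> x _; rewrite lee_fin.
- exact/measurable_EFinP.
- apply: measurable_funeM; apply: emeasurable_funD; exact: mZ.
- by move=> x _; rewrite -EFinD -EFinM lee_fin.
Qed.

Lemma cvg_nneseries_fin (u : (\bar R)^nat) : (forall k, 0 <= u k)%E ->
  (\sum_(0 <= k <oo) u k < +oo)%E -> fine (u k) @[k --> \oo] --> (0 : R).
Proof.
move=> u0 uoo.
have ufin k : u k \is a fin_num.
  rewrite ge0_fin_numE//; apply: le_lt_trans uoo.
  apply: (@le_trans _ _ (\sum_(0 <= j < k.+1) u j)%E); last exact: nneseries_lim_ge.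
  by rewrite big_nat_recr//= leeDr// sume_ge0.
apply: cvg_series_cvg_0.
have -> : series (fun k => fine (u k)) = fine \o (fun k => \sum_(0 <= j < k) u j)%E.
  apply/funext => k /=; rewrite /series/= sum_fine// => j _.
apply/cvg_ex; exists (fine (\sum_(0 <= k <oo) u k)%E).
apply: fine_cvg; rewrite fineK; first exact: is_cvg_nneseries.
by rewrite ge0_fin_numE// nneseries_ge0.
Qed.

(** The errors [2^-k] are summable, so the series of the [|f_ k - f|] is integrable, hence finite
    almost everywhere, and its terms tend to 0. No subsequence is extracted. *)
Lemma L1_dist_ae_cvg (f_ : nat -> T -> R) (f : T -> R) :
  measurable_fun [set: T] f -> (forall k, measurable_fun [set: T] (f_ k)) ->
  (forall k, L1_dist mu (f_ k) f <= (2^-1 ^+ k)%:E)%E ->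
  {ae mu, forall x, f_ k x @[k --> \oo] --> f x}.
Proof.
move=> mf mf_ fL.
pose S x := (\sum_(0 <= k <oo) (`|f_ k x - f x|)%:E)%E.
have d0 k x : (0 <= (`|f_ k x - f x|)%:E :> \bar R)%E by rewrite lee_fin.
have mS : measurable_fun [set: T] S.
  by apply: ge0_emeasurable_sum => [k x _ _|k _]; [exact: d0|exact: measurable_dist].
have S0 x : (0 <= S x)%E by apply: nneseries_ge0 => k _ _; exact: d0.
have iS : mu.-integrable [set: T] S.
  apply/integrableP; split => //.
  rewrite (eq_integral S); last by move=> x _; rewrite gee0_abs.
  rewrite integral_nneseries//; last by move=> k; exact: measurable_dist.
  apply: (@le_lt_trans _ _ (\sum_(0 <= k <oo) (2^-1 ^+ k)%:E)%E).
    by apply: lee_nneseries => [k _ _|k _]; [exact: integral_ge0|exact: fL].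
  rewrite (eq_eseriesr (g := fun k => (1 * 2^-1 ^+ k)%:E)); last by move=> k _; rewrite mul1r.
  apply: (le_lt_trans (nneseries_geometric_le _ _ _)); rewrite ?ltry//.
  by rewrite invf_lt1// ltr1n.
have := integrable_ae measurableT iS.
apply: filterS => x /(_ I) Sx.
have Soo : (S x < +oo)%E by move: Sx; rewrite (ge0_fin_numE (S0 x)).
have /= H := cvg_nneseries_fin (d0^~ x) Soo.
apply/cvgrPdist_lt => e e0; move/cvgrPdist_lt : H => /(_ e e0); apply: filterS => k.
by rewrite sub0r normrN normr_id distrC.
Qed.

End integral_facts.

Lemma ae_pair_measure d1 d2 (T1 : measurableType d1) (T2 : measurableType d2) (R : realType)
    (m1 : {sigma_finite_measure set T1 -> \bar R}) (m2 : {sigma_finite_measure set T2 -> \bar R})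
    (P : T1 -> Prop) (Q : T2 -> Prop) :
  {ae m1, forall x, P x} -> {ae m2, forall y, Q y} ->
  {ae m1 \x m2, forall z, P z.1 /\ Q z.2}%E.
Proof.
move=> [A [mA A0 PA]] [A' [mA' A'0 QA']].
have mAT : measurable (A `*` [set: T2]) by exact: measurableX.
have mTA : measurable ([set: T1] `*` A') by exact: measurableX.
have AT0 : (m1 \x m2)%E (A `*` [set: T2]) = 0%E by rewrite product_measure1E// [X in (X * _)%E]A0 mul0e.
have TA0 : (m1 \x m2)%E ([set: T1] `*` A') = 0%E by rewrite product_measure1E// [X in (_ * X)%E]A'0 mule0.
exists ((A `*` setT) `|` (setT `*` A')); split.
- exact: measurableU.
- exact: null_set_setU.
- move=> z /= /not_andP[Pz|Qz]; [left|right]; split => //; [exact: PA|exact: QA'].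
Qed.

(** * The Euler-Lagrange equation *)

Section critical_map.
Context {R : realType} {n N : nat}.
Local Notation B := (borel_rV R n).
Local Notation m := (@borel_measure R n).
Local Notation P := (@borel_measure R n \x @borel_measure R n)%E.
Variables (Omega : set 'rV[R]_n) (p a : R).
Hypotheses (oO : open Omega) (p1 : 1 < p) (na : n%:R < a) (anp : a < n%:R + p).

(** With the indicators in the weight, integrals over Omega x Omega become integrals over all pairs,
    where translation and Tonelli apply directly. *)
Definition domain_kernel (z : B * B) : R :=
  \1_(Omega : set B) z.1 * \1_(Omega : set B) z.2 * kernel a z.
Local Notation w := domain_kernel.

Lemma domain_kernel_ge0 z : 0 <= w z.
Proof. by rewrite !mulr_ge0 ?kernel_ge0 ?indicE. Qed.

Lemma domain_kernel_le z : w z <= kernel a z.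
Proof.
rewrite /w -[leRHS]mul1r; apply: ler_wpM2r; first exact: kernel_ge0.
by rewrite !indicE; case: (_ \in _); case: (_ \in _); rewrite ?mulr1 ?mul1r ?mulr0.
Qed.

Lemma measurable_domain_kernel : measurable_fun [set: B * B] w.
Proof.
have mO : measurable (Omega : set B) by exact: open_borel_measurable.
apply: measurable_funM; last exact: measurable_kernel.
by apply: measurable_funM; [exact: measurable_indic_fst|exact: measurable_indic_snd].
Qed.

Lemma domain_kernel_out z : ~ (Omega z.1 /\ Omega z.2) -> w z = 0.
Proof.
move=> /not_andP nz; rewrite /w !indicE.
by case: nz => nz; rewrite (memNset nz) ?mulr0 ?mul0r.
Qed.

Lemma domain_kernel_in z : Omega z.1 -> Omega z.2 -> w z = kernel a z.
Proof. by move=> z1 z2; rewrite /w !indicE !mem_set// !mul1r. Qed.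

Let mw := measurable_domain_kernel.
Let w0 := domain_kernel_ge0.
Let p0 : 0 <= p.
Proof. by rewrite ltW// (lt_trans _ p1). Qed.

Variable u0 : B -> 'rV[R]_N.
Hypotheses (mu0 : measurable_vec u0) (u01 : forall x, enorm (u0 x) = 1).

Let du (z : B * B) := u0 z.2 - u0 z.1.

Hypothesis Eu : (\int[P]_z (enorm (du z) `^ p * w z)%:E < +oo)%E.
Hypothesis crit : forall psi : 'rV[R]_n -> 'rV[R]_N, test_function Omega psi ->
  is_derive (0 : R) 1 (fun t : R => fine (\int[P]_z
    (enorm (normalize (u0 z.2 + t *: psi z.2) - normalize (u0 z.1 + t *: psi z.1)) `^ p
      * w z)%:E)) 0.

Let mfst (f : B -> 'rV[R]_N) : measurable_vec f -> measurable_vec (fun z : B * B => f z.1).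
Proof. by move=> mf i; exact: (measurableT_comp (mf i)). Qed.

Let msnd (f : B -> 'rV[R]_N) : measurable_vec f -> measurable_vec (fun z : B * B => f z.2).
Proof. by move=> mf i; exact: (measurableT_comp (mf i)). Qed.

Let mdu : measurable_vec du.
Proof. by apply: measurable_vecB; [exact: msnd|exact: mfst]. Qed.

Lemma test_functionZ (g : 'rV[R]_n -> R) (v : 'rV[R]_N) : test_function Omega g ->
  test_function Omega (fun x => g x *: v).
Proof.
move=> [sg cg gO].
have sub : closed_support (fun x => g x *: v) `<=` closed_support g.
  by apply: closed_support_sub => [|x /closed_support0 ->]; [exact: closed_closure|rewrite scale0r].
split; first by move=> k; exact: classCZ.
- by apply: subclosed_compact cg sub; exact: closed_closure.
- exact: subset_trans gO.
Qed.

Lemma test_function_gagliardo (g : 'rV[R]_n -> R) : test_function Omega g ->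
  (gagliardo p a (g : B -> R) < +oo)%E.
Proof.
move=> [sg cg _].
have [L L0 HL] := compact_support_lipschitz sg cg.
have [M M0 HM] := compact_support_bounded (smooth_continuous sg) cg.
have [r r0 Hr] := compact_support_cube cg.
apply: (@lipschitz_energy R n p a _ na anp g L M r) => //; first exact: lt_trans p1.
by apply: continuous_borel_measurable; exact: smooth_continuous.
Qed.

Lemma test_function_measurable (g : 'rV[R]_n -> R) : test_function Omega g ->
  measurable_fun [set: B] (g : B -> R).
Proof. by move=> [sg _ _]; apply: continuous_borel_measurable; exact: smooth_continuous. Qed.

Let e (i : 'I_N) : 'rV[R]_N := delta_mx 0 i.
Let c (i : 'I_N) (x : B) : 'rV[R]_N := e i - u0 x 0 i *: u0 x.

Let mc i : measurable_vec (c i).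
Proof.
apply: measurable_vecB; first by move=> j; exact: measurable_cst.
by apply: measurable_vecZ => //; exact: mu0.
Qed.

Let c_le i x : enorm (c i x) <= 2.
Proof.
apply: (le_trans (enormB_le _ _)); rewrite enorm_delta enormZ u01 mulr1.
have := le_coord_enorm (u0 x) i; rewrite u01 => ?; lra.
Qed.

Let dc_le i (x y : B) : enorm (c i y - c i x) <= 2 * enorm (u0 y - u0 x).
Proof.
have -> : c i y - c i x = (u0 x 0 i - u0 y 0 i) *: u0 x - u0 y 0 i *: (u0 y - u0 x).
  by apply/rowP => k; rewrite !mxE; ring.
apply: (le_trans (enormB_le _ _)); rewrite !enormZ u01 mulr1.
have H1 := le_coord_enorm (u0 y) i; rewrite u01 in H1.
have := le_coord_enorm (u0 y - u0 x) i; rewrite !mxE distrC => H2.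
have := enorm_ge0 (u0 y - u0 x) => H3.
have := ler_wpM2r H3 H1; lra.
Qed.

Let D i (g : B -> R) (z : B * B) : 'rV[R]_N := g z.2 *: c i z.2 - g z.1 *: c i z.1.

Let mD i g : measurable_fun [set: B] g -> measurable_vec (D i g).
Proof.
move=> mg; apply: measurable_vecB.
- by apply: (@msnd (fun x => g x *: c i x)); exact: measurable_vecZ.
- by apply: (@mfst (fun x => g x *: c i x)); exact: measurable_vecZ.
Qed.

(** The first variation in the direction [g *: e i], whose tangential part along [u0] is
    [g *: c i]. *)
Lemma euler_lagrange_test (g : 'rV[R]_n -> R) i : test_function Omega g ->
  Rintegral P [set: B * B] (fun z => dotp (grad p (du z)) (D i (g : B -> R) z) * w z) = 0.
Proof.
move=> tg; have [sg cg _] := tg.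
have mg := test_function_measurable tg.
have [M M0 HM] := compact_support_bounded (smooth_continuous sg) cg.
have mb : measurable_vec (fun x : B => g x *: e i).
  by apply: measurable_vecZ => // j; exact: measurable_cst.
have bM (x : B) : enorm (g x *: e i) <= M by rewrite enormZ enorm_delta mulr1.
have ib : (\int[P]_z (enorm (g z.2 *: e i - g z.1 *: e i) `^ p * w z)%:E < +oo)%E.
  apply: le_lt_trans (test_function_gagliardo tg); apply: ge0_le_integral => //.
  - by move=> z _; rewrite lee_fin mulr_ge0 ?powR_ge0.
  - apply/measurable_EFinP; apply: measurable_funM => //; apply: measurable_powR_comp.
    by apply: measurable_vec_enorm; apply: measurable_vecB; [exact: (msnd mb)|exact: (mfst mb)].
  - exact: measurable_gagliardo.
  - move=> z _; rewrite lee_fin -scalerBl enormZ enorm_delta mulr1.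
    by apply: ler_wpM2l; [exact: powR_ge0|exact: domain_kernel_le].
have := @first_variation _ _ R P N p M (fun z => u0 z.1) (fun z => u0 z.2)
  (fun z => g z.1 *: e i) (fun z => g z.2 *: e i) w p1 M0 (mfst mu0) (msnd mu0) (mfst mb) (msnd mb)
  (fun z => u01 z.1) (fun z => u01 z.2) (fun z => bM z.1) (fun z => bM z.2) mw w0 Eu ib
  (crit (test_functionZ (e i) tg)).
have tE (x : B) : tangent (u0 x) (g x *: e i) = g x *: c i x.
  rewrite /tangent /c scalerBr scalerA dotpZr; congr (_ - (_ * _) *: _).
  rewrite /dotp (bigD1 i)//= big1 ?addr0 => [|j ji]; first by rewrite mxE !eqxx mulr1.
  by rewrite mxE (negbTE ji) andbF mulr0.
by under eq_Rintegral do rewrite !tE.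
Qed.

Let mdist (g : B -> R) : measurable_fun [set: B] g ->
  measurable_fun [set: B * B] (fun z => `|g z.2 - g z.1| `^ p * kernel a z).
Proof. by move=> mg; apply/measurable_EFinP; exact: measurable_gagliardo. Qed.

Let mduw : measurable_fun [set: B * B] (fun z => enorm (du z) `^ p * w z).
Proof.
apply: measurable_funM => //; apply: measurable_powR_comp.
by apply: measurable_vec_enorm.
Qed.

Let duw0 z : 0 <= enorm (du z) `^ p * w z.
Proof. by rewrite mulr_ge0 ?powR_ge0. Qed.

Let dg0 (g : B -> R) z : 0 <= `|g z.2 - g z.1| `^ p * kernel a z.
Proof. by rewrite mulr_ge0 ?powR_ge0 ?kernel_ge0. Qed.

Let powR_combination (x y al be f : R) : 0 <= x -> 0 <= y -> 0 <= al -> 0 <= be -> 0 <= f ->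
  f <= al * x + be * y -> f `^ p <= 2 `^ p * (al `^ p * x `^ p + be `^ p * y `^ p).
Proof.
move=> x0 y0 al0 be0 f0 fxy; rewrite -!powRM//.
apply: le_trans (powRD_le (mulr_ge0 al0 x0) (mulr_ge0 be0 y0) p0).
by apply: ge0_ler_powR; rewrite // nnegrE addr_ge0// mulr_ge0.
Qed.

Let leibniz (x y : R) (v v' : 'rV[R]_N) : x *: v - y *: v' = x *: (v - v') + (x - y) *: v'.
Proof. by rewrite scalerBr scalerBl addrA subrK. Qed.

(** Leibniz: [d(g V_i) = g dV_i + dg V_i] with the factors taken at suitable endpoints. The
    constants come from [|g| <= M], [|dV_i| <= 2 |du|] and [|V_i| <= 2]. The bound depends on [g]
    only through [M] and [gagliardo], both controlled under mollification. *)
Lemma energy_tangent_le (g : B -> R) i M : measurable_fun [set: B] g -> 0 <= M ->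
  (forall x, `|g x| <= M) ->
  (\int[P]_z (enorm (D i g z) `^ p * w z)%:E <= (2 `^ p)%:E *
    (((M * 2) `^ p)%:E * \int[P]_z (enorm (du z) `^ p * w z)%:E +
     (2 `^ p)%:E * gagliardo p a g))%E.
Proof.
move=> mg M0 gM.
have mDw : measurable_fun [set: B * B] (fun z => enorm (D i g z) `^ p * w z).
  apply: measurable_funM => //; apply: measurable_powR_comp.
  by apply: measurable_vec_enorm; exact: mD.
have Dw0 z : 0 <= enorm (D i g z) `^ p * w z by rewrite mulr_ge0 ?powR_ge0.
apply: (@ge0_integral_le_combination _ _ R P (fun z => enorm (D i g z) `^ p * w z)
  (fun z => enorm (du z) `^ p * w z) (fun z => `|g z.2 - g z.1| `^ p * kernel a z)
  (2 `^ p) ((M * 2) `^ p) (2 `^ p) mDw mduw (mdist mg) Dw0 duw0 (dg0 g)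
  (powR_ge0 _ _) (powR_ge0 _ _) (powR_ge0 _ _)).
move=> z; set x := enorm (du z); set y := `|g z.2 - g z.1|.
have Dz : enorm (D i g z) <= M * 2 * x + 2 * y.
  have -> : D i g z = g z.2 *: (c i z.2 - c i z.1) + (g z.2 - g z.1) *: c i z.1.
    exact: leibniz.
  apply: (le_trans (enormD _ _)); rewrite !enormZ; apply: lerD.
    by rewrite -mulrA; apply: ler_pM; [exact: normr_ge0|exact: enorm_ge0|exact: gM|exact: dc_le].
  by rewrite mulrC; apply: ler_wpM2r.
have x0 : 0 <= x by exact: enorm_ge0.
have := powR_combination x0 (normr_ge0 _ : 0 <= y) (mulr_ge0 M0 (ler0n _ 2)) (ler0n _ 2)
  (enorm_ge0 _) Dz.
move=> /(ler_wpM2r (w0 z)) H; apply: (le_trans H).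
rewrite -mulrA; apply: ler_wpM2l; first exact: powR_ge0.
rewrite mulrDl -!mulrA lerD2l; apply: ler_wpM2l; first exact: powR_ge0.
by apply: ler_wpM2l; [exact: powR_ge0|exact: domain_kernel_le].
Qed.

Let g (phi : 'rV[R]_n -> R) j (x : B) : R := phi x * u0 x 0 j.

Let mg phi j : test_function Omega phi -> measurable_fun [set: B] (g phi j).
Proof. by move=> tphi; apply: measurable_funM; [exact: test_function_measurable|exact: mu0]. Qed.

(** The energy of [u0] is finite on Omega x Omega only. For two points of Omega the Leibniz rule
    applies with [|u^j| <= 1]; if one point is outside Omega, then [phi] vanishes there and the
    difference is at most that of [phi], whose energy over R^n is finite. *)
Lemma gagliardo_test_coord (phi : 'rV[R]_n -> R) j : test_function Omega phi ->
  (gagliardo p a (g phi j) < +oo)%E.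
Proof.
move=> tphi; have [sphi cphi phiO] := tphi.
have [M M0 HM] := compact_support_bounded (smooth_continuous sphi) cphi.
have u1 x : `|u0 x 0 j| <= 1 by rewrite -(u01 x) le_coord_enorm.
have phi0 x : ~ Omega x -> phi x = 0.
  by move=> Ox; apply: closed_support0 => /phiO.
have Gphi := test_function_gagliardo tphi.
have Gphi0 : (0 <= gagliardo p a (phi : B -> R))%E.
  by apply: integral_ge0 => z _; rewrite lee_fin.
have Eu0 : (0 <= \int[P]_z (enorm (du z) `^ p * w z)%:E)%E.
  by apply: integral_ge0 => z _; rewrite lee_fin.
have ub : (gagliardo p a (g phi j) <= (2 `^ p)%:E *
    ((M `^ p)%:E * \int[P]_z (enorm (du z) `^ p * w z)%:E +
     (1 `^ p)%:E * gagliardo p a (phi : B -> R)))%E.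
  apply: (@ge0_integral_le_combination _ _ R P
    (fun z => `|g phi j z.2 - g phi j z.1| `^ p * kernel a z)
    (fun z => enorm (du z) `^ p * w z) (fun z => `|phi z.2 - phi z.1| `^ p * kernel a z)
    (2 `^ p) (M `^ p) (1 `^ p) (mdist (mg j tphi)) mduw (mdist (test_function_measurable tphi))
    (dg0 _) duw0 (dg0 _) (powR_ge0 _ _) (powR_ge0 _ _) (powR_ge0 _ _)).
  move=> z.
  have [[z1 z2]|nz] := pselect (Omega z.1 /\ Omega z.2).
    rewrite (domain_kernel_in z1 z2) !mulrA -mulrDl mulrA; apply: ler_wpM2r; first exact: kernel_ge0.
    apply: (@powR_combination (enorm (du z)) `|phi z.2 - phi z.1| M 1) => //; first exact: enorm_ge0.
    have -> : g phi j z.2 - g phi j z.1 = phi z.2 * (u0 z.2 0 j - u0 z.1 0 j) + (phi z.2 - phi z.1) * u0 z.1 0 j.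
      by rewrite /g; ring.
    apply: (le_trans (ler_normD _ _)); rewrite !normrM mul1r; apply: lerD.
      apply: ler_pM; [exact: normr_ge0|exact: normr_ge0|exact: HM|].
      by have := le_coord_enorm (du z) j; rewrite /du !mxE.
    by rewrite ler_piMr.
  rewrite (domain_kernel_out nz) mulr0 mulr0 add0r powR1 mul1r.
  have gp : `|g phi j z.2 - g phi j z.1| <= `|phi z.2 - phi z.1|.
    have [z1|z2] : ~ Omega z.1 \/ ~ Omega z.2 by apply/not_andP.
      by rewrite /g (phi0 _ z1) mul0r !subr0 normrM ler_piMr.
    by rewrite /g (phi0 _ z2) mul0r !sub0r !normrN normrM ler_piMr.
  apply: (@le_trans _ _ (`|phi z.2 - phi z.1| `^ p * kernel a z)).
    apply: ler_wpM2r; first exact: kernel_ge0.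
    by apply: ge0_ler_powR; rewrite ?nnegrE.
  rewrite ler_peMl//.
  by rewrite -[leLHS](powRr0 2) ler_powR// ler1n.
apply: (le_lt_trans ub).
by rewrite lte_mul_pinfty ?lee_fin ?powR_ge0// lte_add_pinfty// lte_mul_pinfty ?lee_fin ?powR_ge0.
Qed.
Let coord_leibniz (x y : R) (v v' : 'rV[R]_N) l :
  (x *: v - y *: v') 0 l = x * v 0 l - y * v' 0 l.
Proof. by rewrite !mxE. Qed.

Let energy_tangent_fin (f : B -> R) i M : measurable_fun [set: B] f -> 0 <= M ->
  (forall x, `|f x| <= M) -> (gagliardo p a f < +oo)%E ->
  (\int[P]_z (enorm (D i f z) `^ p * w z)%:E < +oo)%E.
Proof.
move=> mf M0 fM Gf; apply: (le_lt_trans (energy_tangent_le i mf M0 fM)).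
by rewrite lte_mul_pinfty ?lee_fin ?powR_ge0// lte_add_pinfty// lte_mul_pinfty ?lee_fin ?powR_ge0.
Qed.

Let g_bounded (phi : 'rV[R]_n -> R) j M : (forall x, `|phi x| <= M) -> forall x, `|g phi j x| <= M.
Proof.
move=> HM x; apply: le_trans (HM x); rewrite normrM ler_piMr//.
by rewrite -(u01 x) le_coord_enorm.
Qed.

Lemma integrable_euler_lagrange (phi : 'rV[R]_n -> R) i j : test_function Omega phi ->
  P.-integrable [set: B * B]
    (EFin \o (fun z => dotp (grad p (du z)) (D i (g phi j) z) * w z)).
Proof.
move=> tphi; have [sphi cphi phiO] := tphi.
have [M M0 HM] := compact_support_bounded (smooth_continuous sphi) cphi.
have iD := energy_tangent_fin i (mg j tphi) M0 (g_bounded j HM) (gagliardo_test_coord j tphi).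
exact: (@integrable_dotp_grad _ _ R P N p w mw w0 du (D i (g phi j)) p1 mdu (mD i (mg j tphi)) Eu iD).
Qed.

Lemma euler_lagrange (phi : 'rV[R]_n -> R) i j : test_function Omega phi ->
  Rintegral P [set: B * B] (fun z => dotp (grad p (du z)) (D i (g phi j) z) * w z) = 0.
Proof.
move=> tphi; have [sphi cphi phiO] := tphi.
have [M M0 HM] := compact_support_bounded (smooth_continuous sphi) cphi.
(* The approximation builds its mollifier from a nonzero value of [phi], so the zero function is
   handled apart. *)
have [phi0|phi_neq0] := pselect (forall x, phi x = 0).
  rewrite (_ : (fun z => _) = fun=> 0); first by rewrite /Rintegral integral0.
  apply/funext => z; rewrite /D /g !phi0 !mul0r !scale0r subrr.
  by rewrite -(scale0r (0 : 'rV[R]_N)) dotpZr !mul0r.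
have [x0 x0P] : exists x0, phi x0 != 0.
  by apply: contrapT => H; apply: phi_neq0 => x; apply: contrapT => /eqP Hx; apply: H; exists x.
have gM := g_bounded j HM.
have gsupp x : ~ closed_support phi x -> g phi j x = 0.
  by move=> /closed_support0 px; rewrite /g px mul0r.
have Gg := gagliardo_test_coord j tphi.
have /choice[g_ Hg_] (k : nat) : exists g' : 'rV[R]_n -> R, [/\ test_function Omega g',
    forall x, `|g' x| <= M, (L1_dist m (g' : B -> R) (g phi j) <= (2^-1 ^+ k)%:E)%E &
    (gagliardo p a (g' : B -> R) <= gagliardo p a (g phi j))%E].
  have k0 : 0 < 2^-1 ^+ k :> R by rewrite exprn_gt0// invr_gt0.
  exact: (approx_test_function a p1 k0 oO tphi (ex_intro _ x0 x0P) (mg j tphi) gM gsupp).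
have mg_ k : measurable_fun [set: B] (g_ k : B -> R).
  by have [tg _ _ _] := Hg_ k; exact: test_function_measurable tg.
have cvg_g : {ae m, forall x, g_ k x @[k --> \oo] --> g phi j x}.
  by apply: L1_dist_ae_cvg => //; [exact: mg|move=> k; have [] := Hg_ k].
(* A bound on the energies of all the approximations at once: they share the sup bound [M], and
   their [gagliardo] is at most that of [g phi j]. *)
pose C := fine ((2 `^ p)%:E *
    (((M * 2) `^ p)%:E * \int[P]_z (enorm (du z) `^ p * w z)%:E +
     (2 `^ p)%:E * gagliardo p a (g phi j)))%E.
have Gg0 : (0 <= gagliardo p a (g phi j))%E.
  by apply: integral_ge0 => z _; rewrite lee_fin.
have Eu0 : (0 <= \int[P]_z (enorm (du z) `^ p * w z)%:E)%E.
  by apply: integral_ge0 => z _; rewrite lee_fin.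
have CE : (C%:E = (2 `^ p)%:E *
    (((M * 2) `^ p)%:E * \int[P]_z (enorm (du z) `^ p * w z)%:E +
     (2 `^ p)%:E * gagliardo p a (g phi j)))%E.
  rewrite fineK// ge0_fin_numE.
    by rewrite lte_mul_pinfty ?lee_fin ?powR_ge0// lte_add_pinfty// lte_mul_pinfty ?lee_fin ?powR_ge0.
  by rewrite mule_ge0 ?adde_ge0 ?mule_ge0 ?lee_fin ?powR_ge0.
apply: (@weak_limit _ _ R P N p w p1 mw w0 du (D i (g phi j)) (fun k => D i (g_ k : B -> R)) C
  mdu (mD i (mg j tphi)) (fun k => mD i (mg_ k)) Eu).
- exact: (energy_tangent_fin i (mg j tphi) M0 gM Gg).
- move=> k; have [_ gkM _ Ggk] := Hg_ k.
  apply: (le_trans (energy_tangent_le i (mg_ k) M0 gkM)); rewrite CE.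
  apply: lee_wpmul2l; first by rewrite lee_fin powR_ge0.
  by apply: leeD; [exact: lexx|apply: lee_wpmul2l Ggk; rewrite lee_fin powR_ge0].
- apply: filterS (ae_pair_measure cvg_g cvg_g) => z [c1 c2] l.
  rewrite (_ : (fun k => _) = (fun k => g_ k z.2 * c i z.2 0 l - g_ k z.1 * c i z.1 0 l)).
    have -> : D i (g phi j) z 0 l = g phi j z.2 * c i z.2 0 l - g phi j z.1 * c i z.1 0 l.
      exact: coord_leibniz.
    by apply: cvgB; apply: cvgM => //; exact: cvg_cst.
  by apply/funext => k; exact: coord_leibniz.
- by move=> k; have [tg _ _ _] := Hg_ k; exact: euler_lagrange_test.
Qed.
(** The integrand of the conclusion for the pair [(i, j)], weight included; it is the pairing of
    [grad p (du z)] with [d(phi u^j) e_i]. *)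
Definition current (phi : 'rV[R]_n -> R) i j (z : B * B) : R :=
  enorm (du z) `^ (p - 2) * du z 0 i * (phi z.2 * u0 z.2 0 j - phi z.1 * u0 z.1 0 j) * w z.

Let currentE phi i j z :
  current phi i j z = dotp (grad p (du z)) ((g phi j z.2 - g phi j z.1) *: e i) * w z.
Proof.
rewrite dotpZr /current; congr (_ * w z).
rewrite /dotp (bigD1 i)//= big1 ?addr0 => [|l li]; first by rewrite !mxE !eqxx mulr1 mulrC.
by rewrite [X in _ * X]mxE (negbTE li) andbF mulr0.
Qed.

Lemma integrable_current (phi : 'rV[R]_n -> R) i j : test_function Omega phi ->
  P.-integrable [set: B * B] (EFin \o current phi i j).
Proof.
move=> tphi.
have mge : measurable_vec (fun z : B * B => (g phi j z.2 - g phi j z.1) *: e i).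
  apply: measurable_vecZ; last by move=> l; exact: measurable_cst.
  by apply: measurable_funB; exact: (measurableT_comp (mg j tphi)).
have ie : (\int[P]_z (enorm ((g phi j z.2 - g phi j z.1) *: e i) `^ p * w z)%:E < +oo)%E.
  apply: le_lt_trans (gagliardo_test_coord j tphi); apply: ge0_le_integral.
  - exact: measurableT.
  - by move=> z _; rewrite lee_fin mulr_ge0 ?powR_ge0.
  - apply/measurable_EFinP; apply: measurable_funM => //; apply: measurable_powR_comp.
    exact: measurable_vec_enorm.
  - exact: measurable_gagliardo (mg j tphi).
  - move=> z _; rewrite lee_fin enormZ enorm_delta mulr1.
    by apply: ler_wpM2l; [exact: powR_ge0|exact: domain_kernel_le].
have := @integrable_dotp_grad _ _ R P N p w mw w0 du _ p1 mdu mge Eu ie.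
rewrite (_ : (fun z => _) = current phi i j)//.
by apply/funext => z; rewrite currentE.
Qed.

(* Subtracting the Euler-Lagrange equation leaves an integrand in which u^i and u^j
   play symmetric roles. *)
Lemma Rintegral_current_sym (phi : 'rV[R]_n -> R) i j : test_function Omega phi ->
  Rintegral P [set: B * B] (current phi i j) = Rintegral P [set: B * B] (current phi j i).
Proof.
move=> tphi.
pose EL i j z := dotp (grad p (du z)) (D i (g phi j) z) * w z.
have E i' j' : Rintegral P [set: B * B] (current phi i' j') =
    Rintegral P [set: B * B] (fun z => current phi i' j' z - EL i' j' z).
  rewrite (RintegralB measurableT (integrable_current i' j' tphi)
    (integrable_euler_lagrange i' j' tphi)).
  by rewrite (euler_lagrange i' j' tphi) subr0.
have diffE i' j' z : current phi i' j' z - EL i' j' z =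
    dotp (grad p (du z)) ((g phi j' z.2 * u0 z.2 0 i') *: u0 z.2 -
      (g phi j' z.1 * u0 z.1 0 i') *: u0 z.1) * w z.
  rewrite currentE /EL -mulrBl -dotpBr; congr (dotp _ _ * w z).
  by apply/rowP => l; rewrite /D /c !mxE; ring.
rewrite (E i j) (E j i); apply: eq_Rintegral => z _; rewrite !diffE.
by rewrite /g !(mulrAC _ (u0 _ 0 j) (u0 _ 0 i)).
Qed.
End critical_map.

(** Stated for an arbitrary map [v] with Borel version [v0] because it serves twice: for [u], and
    for each of its normalized variations. *)
Lemma energy_borel (R : realType) (n N : nat) (Omega : set 'rV[R]_n) (s p : R)
    (Z : set (borel_rV R n)) (v : 'rV[R]_n -> 'rV[R]_N) (v0 : borel_rV R n -> 'rV[R]_N) :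
  open Omega -> measurable Z -> borel_measure Z = 0%E -> measurable_vec v0 ->
  (forall x, Omega x -> ~ Z x -> v x = v0 x) ->
  energy Omega s p v = (\int[borel_measure \x borel_measure]_z
    (enorm (v0 z.2 - v0 z.1) `^ p * domain_kernel Omega (n%:R + s * p) z)%:E)%E.
Proof.
move=> oO mZ Z0 mv0 vv0.
have mO : measurable Omega.
  by apply: measurable_lebesgue_borel; exact: open_borel_measurable.
pose g (z : borel_rV R n * borel_rV R n) :=
  (enorm (v0 z.2 - v0 z.1) `^ p * domain_kernel Omega (n%:R + s * p) z)%:E.
have mg : measurable_fun [set: borel_rV R n * borel_rV R n] g.
  apply/measurable_EFinP; apply: measurable_funM; last exact: measurable_domain_kernel.
  apply: measurable_powR_comp; apply: measurable_vec_enorm; apply: measurable_vecB => i.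
    exact: (measurableT_comp (mv0 i)).
  exact: (measurableT_comp (mv0 i)).
have g0 z : (0 <= g z)%E by rewrite lee_fin mulr_ge0 ?powR_ge0 ?domain_kernel_ge0.
rewrite /energy (iterated_integral_borel (g := g) mO mZ Z0 mg).
- by rewrite (fubini_tonelli1 _ mg g0).
- exact: measurable_fun_fubini_tonelli_F.
- move=> y x Oy Zy Ox Zx; rewrite /g (domain_kernel_in _ Oy Ox) /kernel/=.
  by rewrite (vv0 y Oy Zy) (vv0 x Ox Zx).
- by move=> y x Oyx; rewrite /g (domain_kernel_out _ Oyx) mulr0.
Qed.

(* The derivative of the energy is taken through fine, which is harmless: for t
   small, the normalized variations of a map of finite energy have finite energy.
   When u x = u y the factor u x 0 i - u y 0 i makes the integrand 0, whatever
   the value of 0 `^ (p - 2). *)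
Theorem proposition1p2 (R : realType) (n N : nat) (hn : (1 <= n)%N)
    (hN : (1 <= N)%N) (Omega : set 'rV[R]_n) (hOmega : is_domain Omega)
    (s : R) (hs0 : 0 < s) (hs1 : s < 1) (p : R) (hp : p = n%:R / s)
    (u : 'rV[R]_n -> 'rV[R]_N)
    (u_meas : forall i : 'I_N, measurable_fun Omega (fun x => u x 0 i))
    (u_sphere : {ae lebesgue_rV, forall x, Omega x -> enorm (u x) = 1})
    (u_energy : (energy Omega s p u < +oo)%E)
    (u_crit : forall psi : 'rV[R]_n -> 'rV[R]_N, test_function Omega psi ->
      is_derive (0 : R) 1 (fun t : R =>
        fine (energy Omega s p (fun x => normalize (u x + t *: psi x)))) 0)
    (phi : 'rV[R]_n -> R) (hphi : test_function Omega phi)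
    (omega : 'M[R]_N) (omega_skew : forall i j, omega i j = - omega j i)
    (omega_val : forall i j, omega i j \in [:: -1; 0; 1]) :
  (\sum_(i < N) \sum_(j < N) (omega i j)%:E *
    \int[lebesgue_rV]_(y in Omega) \int[lebesgue_rV]_(x in Omega)
      (enorm (u x - u y) `^ (p - 2) * (u x 0 i - u y 0 i)
        * (u x 0 j * phi x - u y 0 j * phi y)
        / enorm (x - y) `^ (n%:R + s * p))%:E = 0)%E.
Proof.
have [oO _ _] := hOmega.
have n1 : 1 <= n%:R :> R by rewrite ler1n.
have n0 : 0 < n%:R :> R by exact: lt_le_trans n1.
(* From [s < 1] one gets [p > n >= 1]; together with [s * p = n] this places [a = 2n] strictly
   between [n] and [n + p]. *)
have np : n%:R < p by rewrite hp ltr_pdivlMr// gtr_pMr.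
have p1 : 1 < p by exact: le_lt_trans np.
have sp : s * p = n%:R by rewrite hp mulrC divfK// gt_eqF.
pose a := n%:R + s * p.
have na : n%:R < a by rewrite /a sp ltrDl.
have anp : a < n%:R + p by rewrite /a sp ltrD2l.
have [Z [u0 [mZ Z0 mu0 u01 uu0]]] := borel_sphere_map (Ordinal hN) oO u_meas u_sphere.
have uE x : Omega x -> ~ Z x -> u x = u0 x by move=> Ox Zx; rewrite uu0.
have Eu : (\int[borel_measure \x borel_measure]_z
    (enorm (u0 z.2 - u0 z.1) `^ p * domain_kernel Omega a z)%:E < +oo)%E.
  by rewrite -(energy_borel s p oO mZ Z0 mu0 uE).
have crit (psi : 'rV[R]_n -> 'rV[R]_N) : test_function Omega psi ->
    is_derive (0 : R) 1 (fun t : R => fine (\int[borel_measure \x borel_measure]_z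
      (enorm (normalize (u0 z.2 + t *: psi z.2) - normalize (u0 z.1 + t *: psi z.1)) `^ p
        * domain_kernel Omega a z)%:E)%E) 0.
  (* For every [t], the variations of [u] and of [u0] by [psi] agree on Omega off the same null set
     [Z], so the two energies coincide as functions of [t]. *)
  move=> tpsi.
  have mpsi : measurable_vec (psi : borel_rV R n -> 'rV[R]_N).
    move=> i; apply: continuous_borel_measurable => x.
    have [spsi _ _] := tpsi.
    apply: (@continuous_comp _ _ _ psi (fun v : 'rV[R]_N => v 0 i)).
      exact: smooth_continuous spsi x.
    exact: coord_continuous.
  have := u_crit psi tpsi.
  rewrite (_ : (fun t => _) = (fun t : R => fine (\int[borel_measure \x borel_measure]_z
      (enorm (normalize (u0 z.2 + t *: psi z.2) - normalize (u0 z.1 + t *: psi z.1)) `^ p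
        * domain_kernel Omega a z)%:E)%E))//.
  apply/funext => t.
  have mv0 : measurable_vec (fun x : borel_rV R n => normalize (u0 x + t *: psi x)).
    apply: measurable_normalize; apply: measurable_vecD => //.
    by apply: measurable_vecZ => //; exact: measurable_cst.
  rewrite (energy_borel s p oO mZ Z0 mv0)//.
  by move=> x Ox Zx; rewrite uE.
pose S i j := Rintegral (borel_measure \x borel_measure)%E setT (current Omega p a u0 phi i j).
have SE i j : (\int[lebesgue_rV]_(y in Omega) \int[lebesgue_rV]_(x in Omega)
      (enorm (u x - u y) `^ (p - 2) * (u x 0 i - u y 0 i)
        * (u x 0 j * phi x - u y 0 j * phi y)
        / enorm (x - y) `^ (n%:R + s * p))%:E = (S i j)%:E)%E.
  have iS := integrable_current oO p1 na anp mu0 u01 Eu i j hphi.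
  have mS := measurable_int _ iS.
  have mO : measurable Omega.
    by apply: measurable_lebesgue_borel; exact: open_borel_measurable.
  (* The integrand has no sign, so Fubini rests on the integrability [iS]. *)
  rewrite /S -integral_Rintegral// -(integral12_prod_meas1 iS).
  apply: (iterated_integral_borel (g := EFin \o current Omega p a u0 phi i j) mO mZ Z0 mS).
  - exact: measurable_fubini_F iS.
  - move=> y x Oy Zy Ox Zx; rewrite /= /current (domain_kernel_in _ Oy Ox) /kernel/=.
    rewrite (uE y Oy Zy) (uE x Ox Zx) !mxE.
    by rewrite (mulrC (phi x)) (mulrC (phi y)).
  - by move=> y x Oyx; rewrite /= /current (domain_kernel_out _ Oyx) mulr0.
have S_sym i j : S i j = S j i by exact: Rintegral_current_sym.
under eq_bigr do under eq_bigr do rewrite SE -EFinM.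
under eq_bigr do rewrite sumEFin.
rewrite sumEFin; congr EFin.
(* Exchanging [i] and [j] keeps [S i j] and changes the sign of [omega i j]. *)
set X := LHS; suff : X = - X by lra.
rewrite /X [in LHS]exchange_big -sumrN; apply: eq_bigr => i _.
rewrite -sumrN; apply: eq_bigr => j _.
by rewrite omega_skew S_sym mulNr.
Qed.
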